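(* Let $N$ be a renewal point process on $[0,T]$, $T<\infty$, with points $T_0:=0<T_1<T_2<\cdots<T_{N([0,T])}$ and a spacing density $f$ such that $f$ is continuous on $[0,+\infty)$ and $f>0$ on $(a,C)$ for some $a\in[0,T]$ and $C\in(T,+\infty]$. Let $\overline F$ be the tail function of $f$. Assume further that $$h(z):=\sup_{x\in[z,T]}\frac{f(x-z)}{f(x)}<\infty\quad\text{for any }z\in[0,T],$$ and $$\gamma:=\int_0^T\sup_{z\in[0,t]}f(z)\biggl[\frac{\overline F(T-t)^2}{\overline F(T-t+z)}+h(z)^2\bigl(\overline F(z)-\overline F(T-t+z)\bigr)-\frac1{\overline F(z)}\biggr]\mathrm dt<1.$$ Then, for any square-integrable functional $G$ of $N$, $$\mathrm{Var}(G)\le\bigl(1-\sqrt\gamma\bigr)^{-2}\,\mathbb E\biggl[\int_0^T\pi_t\,|D_tG|^2\,\mathrm dt\biggr],$$ where the Papangelou conditional intensity $\pi$ of $N$ is given by $$\pi_t=\begin{cases}f(T_i-t)\,f(t-T_{i-1})\big/f(T_i-T_{i-1})&\text{if }T_{i-1}\le t<T_i,\\ f(t-T_{N([0,T])})\,\overline F(T-t)\big/\overline F(T-T_{N([0,T])})&\text{if }T_{N([0,T])}\le t\le T.\end{cases}$$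
   Context: A renewal point process on $[0,T]$ with spacing density $f$ is the restriction to $[0,T]$ of the point process with points $T_n=\sum_{i=1}^n\tau_i$, $n\ge1$, where $(\tau_i)$ are i.i.d. with probability density $f$ on $[0,\infty)$; $N$ is the associated counting measure and $N([0,T])$ the number of points in $[0,T]$. $\overline F(x):=\int_x^\infty f(u)\,\mathrm du$. $N$ is regarded as a random element of the space of finite simple integer-valued measures $\omega$ on $[0,T]$ with no atom at $0$; a functional $G$ of $N$ is a measurable function $G(\omega)$ on that space, square-integrable if $\mathbb E[G(N)^2]<\infty$, and $D_tG(\omega):=G(\omega+\varepsilon_t)-G(\omega)$, where $\varepsilon_t$ is the Dirac measure at $t$ and $\omega+\varepsilon_t$ is replaced by $\omega$ if $t\in\mathrm{Supp}(\omega)$. A non-negative jointly measurable process $\pi_t(\omega)$ is a Papangelou conditional intensity of $N$ (with respect to $\mathrm dt$) if $\mathbb E\bigl[\int_{[0,T]}X_t(N-\varepsilon_t)\,N(\mathrm dt)\bigr]=\mathbb E\bigl[\int_0^TX_t(N)\,\pi_t(N)\,\mathrm dt\bigr]$ for every non-negative measurable process $X$. Convention: $0/0:=0$. *)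

(* Defs.v *)
From HB Require Import structures.
From mathcomp Require Import all_boot all_order all_algebra finmap.
From mathcomp Require Import all_classical all_reals all_analysis.
From mathcomp Require Import measurable_realfun.

Set Implicit Arguments.
Unset Strict Implicit.
Unset Printing Implicit Defensive.

Import Order.TTheory GRing.Theory Num.Theory.
Import numFieldNormedType.Exports.

Local Open Scope classical_set_scope.
Local Open Scope ring_scope.

(** * Configurations on [0, T] *)

(** A measure on [0, T] is encoded as a Borel measure on the line giving no
    mass to the complement of [0, T].  Being [nat]-valued includes finiteness. *)
Record is_config (R : realType) (T : R)
    (w : {measure set (measurableTypeR R) -> \bar R}) : Prop := IsConfig {
  config_int : forall A, measurable A -> exists n : nat, w A = n%:R%:E ;
  config_simple : forall t : R, (w [set t] <= 1)%E ;
  config_supp : w (~` `[0, T]) = 0%E ;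
  config_atom0 : w [set 0] = 0%E }.

Record config (R : realType) (T : R) := Config {
  config_measure :> {measure set (measurableTypeR R) -> \bar R} ;
  configP : is_config T config_measure }.

Section config_measurable.
Variables (R : realType) (T : R).

Lemma is_config0 :
  is_config T (@mzero _ (measurableTypeR R) R
                : {measure set (measurableTypeR R) -> \bar R}).
Proof.
by split => // [A mA|t]; [exists 0%N | exact: lee01].
Qed.

HB.instance Definition _ := gen_eqMixin (config T).
HB.instance Definition _ := gen_choiceMixin (config T).
HB.instance Definition _ := isPointed.Build (config T) (Config is_config0).

(** The sigma-algebra generated by the evaluations [w |-> w A], [A] Borel. *)
Definition config_ev : set (set (config T)) :=
  \bigcup_(A in (measurable : set (set (measurableTypeR R))))
    preimage_set_system setT (fun w : config T => w A) measurable.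

HB.instance Definition _ := @isMeasurable.Build (sigma_display config_ev)
  (config T) <<s config_ev >>
  (@sigma_algebra0 _ setT config_ev) (@sigma_algebraC _ config_ev)
  (@sigma_algebra_bigcup _ setT config_ev).

End config_measurable.

Section point_operations.
Variables (R : realType) (T : R).
Implicit Types (w : config T) (t : R).

Lemma is_config_add w t : t \in `]0, T] -> w [set t] = 0%E ->
  is_config T (measure_add w (@dirac _ (measurableTypeR R) t R)).
Proof.
rewrite in_itv/= => /andP[t0 tT] wt.
have [ci cs cc c0] := configP w.
have E A : measure_add w (@dirac _ (measurableTypeR R) t R) A =
    (w A + (t \in A)%:R%:E)%E by rewrite measure_addE /= diracE.
split=> [A mA|s||].
- have [n wA] := ci _ mA; exists (n + (t \in A))%N.
  by rewrite [LHS]E wA -EFinD natrD.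
- rewrite [leLHS]E; case: (eqVneq t s) => [<-|ts].
    by rewrite wt add0e lee_fin; case: (_ \in _).
  by rewrite memNset ?adde0//= => ts'; rewrite ts' eqxx in ts.
- rewrite [LHS]E cc add0e memNset//=; apply; rewrite in_itv/=.
  by rewrite (ltW t0).
- rewrite [LHS]E c0 add0e memNset//= => t0'.
  by rewrite t0' ltxx in t0.
Qed.

Lemma is_config_del w t :
  is_config T (mrestr w (measurableC (measurable_set1 t))).
Proof.
have [ci cs cc c0] := configP w.
have m1 s : measurable ([set s] : set (measurableTypeR R)) by exact: measurable_set1.
have mI : measurable (~` `[0, T] : set (measurableTypeR R)).
  by apply: measurableC; exact: measurable_itv.
have mt : measurable (~` [set t] : set (measurableTypeR R)) by exact: measurableC.
split.
- by move=> A mA; apply: ci; exact: measurableI.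
- by move=> s; apply: le_trans (cs s); apply: le_measure; rewrite ?inE//; exact: measurableI.
- apply/eqP; rewrite eq_le measure_ge0 andbT -cc.
  by apply: le_measure; rewrite ?inE//; exact: measurableI.
- apply/eqP; rewrite eq_le measure_ge0 andbT -c0.
  by apply: le_measure; rewrite ?inE//; exact: measurableI.
Qed.

(** [w + eps_t], replaced by [w] if [t] is in the support of [w].  It is also
    [w] if [t] is not in ]0, T], where the sum is not a configuration; in
    [0, T] this concerns [t = 0] only. *)
Definition add_point t w : config T :=
  match pselect (t \in `]0, T] /\ w [set t] = 0%E) with
  | left p => Config (is_config_add p.1 p.2)
  | right _ => w
  end.

(** [w - eps_t] for an atom [t] of the simple measure [w]: the restriction of
    [w] to the complement of [t]. *)
Definition del_point t w : config T := Config (is_config_del w t).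

Definition diff_operator t (G : config T -> R) w : R := G (add_point t w) - G w.

(** The number of points in [0, t]. *)
Definition npoints w t : nat := Num.truncn (fine (w `[0, t]%classic)).

(** The [i]-th point, for [i <= npoints w T]; it is [0] for [i = 0]. *)
Definition point_of w (i : nat) : R :=
  inf [set s : R | s \in `[0, T] /\ (i%:R%:E <= w `[0%R, s]%classic)%E].

End point_operations.

(** * Renewal processes *)

Section renewal.
Variable R : realType.
Implicit Types f : R -> R.

Local Notation mu := (@lebesgue_measure R).

(** Probability densities on [0, +oo[; the values of [f] on the negative
    half-line are irrelevant. *)
Definition is_density f : Prop :=
  [/\ measurable_fun (`[0%R, +oo[%classic : set R) f,
      (forall x, 0 <= x -> 0 <= f x) &
      (\int[mu]_(x in `[0%R, +oo[) (f x)%:E = 1)%E].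

Definition tail f (x : R) : R := \int[mu]_(u in `[x, +oo[) f u.

Definition has_density d (Omega : measurableType d) (P : probability Omega R)
    (X : {RV P >-> R}) f : Prop :=
  forall A, measurable A ->
    distribution P X A = (\int[mu]_(u in A `&` `[0%R, +oo[) (f u)%:E)%E.

Definition mutually_independent d (Omega : measurableType d)
    (P : probability Omega R) (X : nat -> {RV P >-> R}) : Prop :=
  forall (J : {fset nat}) (A : nat -> set R),
    (forall i, measurable (A i)) ->
    P (\bigcap_(i in [set` J]) (X i @^-1` A i)) =
      (\prod_(i <- J) P (X i @^-1` A i))%E.

(** [tau i] is the spacing between the [i]-th and the [i.+1]-th points.
    The identity holds almost surely only, since the right-hand side is a
    configuration only almost surely. *)
Definition is_renewal_process d (Omega : measurableType d)
    (P : probability Omega R) (T : R) f (N : {RV P >-> config T}) : Prop :=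
  is_density f /\
  exists tau : nat -> {RV P >-> R},
    [/\ mutually_independent tau,
        (forall i, has_density (tau i) f) &
        {ae P, forall o : Omega, forall A : set (measurableTypeR R),
          measurable A ->
          N o A = (\sum_(1 <= n <oo)
                     \d_(\sum_(i < n) tau i o)%R (A `&` `[0%R, T]))%E}].

(** In [\bar R], [0 / 0 = 0] and [c / 0 = +oo] for [c > 0]. *)
Definition ratio_sup (T : R) f (z : R) : \bar R :=
  ereal_sup [set ((f (x - z))%:E / (f x)%:E)%E | x in `[z, T]].

Definition gamma_const (T : R) f : \bar R :=
  (\int[mu]_(t in `[0%R, T])
     ereal_sup [set (f z)%:E *
       ((tail f (T - t) ^+ 2 / tail f (T - t + z))%R%:E
        + ratio_sup T f z ^+ 2 * (tail f z - tail f (T - t + z))%R%:E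
        - ((tail f z)^-1)%R%:E) | z in `[0%R, t]])%E.

(** If [t] is in [0, T] and [i := npoints w t] is less than [npoints w T], then
    [point_of w i <= t < point_of w i.+1]; otherwise [t] is at or after the last
    point. *)
Definition renewal_intensity (T : R) f (t : R) (w : config T) : R :=
  let i := npoints w t in
  let n := npoints w T in
  if (i < n)%N then
    f (point_of w i.+1 - t) * f (t - point_of w i)
      / f (point_of w i.+1 - point_of w i)
  else
    f (t - point_of w n) * tail f (T - t) / tail f (T - point_of w n).

Definition is_papangelou d (Omega : measurableType d) (P : probability Omega R)
    (T : R) (N : {RV P >-> config T}) (pi : R -> config T -> R) : Prop :=
  let D := (`[0, T] `*` setT : set (measurableTypeR R * config T)) in
  [/\ measurable_fun D (fun x => pi x.1 x.2),
      (forall x, D x -> 0 <= pi x.1 x.2) &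
      forall X : measurableTypeR R * config T -> \bar R,
        measurable_fun D X -> (forall x, D x -> (0 <= X x)%E) ->
        (\int[P]_o \int[N o]_(t in `[0%R, T]) X (t, del_point t (N o)) =
         \int[P]_o \int[mu]_(t in `[0%R, T])
           (X (t, N o) * (pi t (N o))%:E))%E].

End renewal.

(* Main.v *)
Require Import Defs.
From HB Require Import structures.
From mathcomp Require Import all_boot all_order all_algebra finmap.
From mathcomp Require Import all_classical all_reals all_analysis.
From mathcomp Require Import measurable_realfun.
From mathcomp Require Import ring lra.
Import Order.TTheory GRing.Theory Num.Theory.
Import numFieldNormedType.Exports.
Local Open Scope classical_set_scope.
Local Open Scope ring_scope.

(** Let [S n] be the arrivals, and condition on the past at [S n] and on the
    event that [t] comes before the next arrival.  If that arrival is at [r],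
    its density is [f (r - S n)]; with a point added at [t] the density becomes
    [f (t - S n) * f (r - t)].  The ratio of the two is the intensity [pi t],
    and likewise when no point is left before [T].  Hence, given that past, an
    integral over the times between two arrivals, weighted by [pi], is an
    integral over the position of the next arrival ([resume_intensity]), and
    the Papangelou formula follows by summing over the arrivals
    ([papangelou_intensity]).

    For the variance, let [u t] be the difference between the expectation of
    [G] given that the next arrival is at [t] and its expectation given only
    that the next arrival is after [t].  The conditional expectations of [G] at
    the successive arrivals form a martingale, and the variance of each of its
    increments is the integral of [u ^ 2] against the density of the next
    arrival; this last point is the integral of a derivative
    ([step_variance]).  So the variance [V] of [G] is the sum of these integrals
    over the arrivals ([variance_jumps]).

    Now replace one factor [u] by its definition.  The expectation given an
    arrival at [t] is produced by the weight [pi], acting on [G (N + eps_t)],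
    and the expectation given no arrival up to [t] by the hazard rate
    [lam := f / tail f], acting on [G N].  Since [pi] and [lam] have the same
    conditional mean, the expectation of [G] can be subtracted, and
<<
  V = E int u * (pi * D_t G + (pi - lam) * (G - E G)) dt.
>>
    The first part is at most [sqrt V] times the square root of the expectation
    of [int pi * |D_t G| ^ 2].  In the second part, the second moment of
    [pi - lam] given the past at [S n], on the event that [t] comes before the
    next arrival, can be computed ([dispersionE]): it is [f (t - S n)] times the
    dispersion [k], and the integral of [k] over [0, T] along any path is at most
    [gamma] ([dispersion_gamma]).  By the Cauchy-Schwarz inequality with the
    weight [k], the second part is at most [sqrt gamma * V], whence the claim.

    The integrals are kept nonnegative, and the two applications of the
    Cauchy-Schwarz inequality are replaced by that of the inequality of
    arithmetic and geometric means in each gap between arrivals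
    ([jump_mass_le]), with a parameter [q] above [sqrt gamma].  The sum over the
    gaps gives the bound for bounded functionals ([variance_bounded]); the
    general case follows by letting [q] tend to [sqrt gamma] and by truncation
    ([variance_poincare]). *)

Set Implicit Arguments.
Unset Strict Implicit.
Unset Printing Implicit Defensive.

(** * Configurations as a measurable space *)

Section config_space.
Context {R : realType} {T : R}.
Implicit Types (w : config T) (t : R).

Local Notation RR := (measurableTypeR R).

(** A measure is a function on all sets, and two configurations may differ on
    nonmeasurable ones; this is the equality that measurable functionals see. *)
Definition eqc w w' := forall A : set RR, measurable A -> w A = w' A.

(** The sets that do not separate [w] and [w'] form a sigma-algebra, which
    contains the generators. *)
Lemma eqc_measurable w w' (B : set (config T)) :
  eqc w w' -> measurable B -> B w -> B w'.
Proof.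
move=> ww' mB; pose C := [set B : set (config T) | B w <-> B w'].
suff : C B by case.
have : <<s @config_ev R T >> B by exact: mB.
apply: smallest_sub => //.
- split => //.
  + by move=> A [h1 h2]; split => -[_ nA]; split => // Aw; apply: nA; [exact: h2|exact: h1].
  + by move=> F CF; split => -[n _ Fn]; exists n => //; apply/(CF n).
- move=> _ [A mA [D mD <-]]; split => -[_ /=]; rewrite /preimage/= => h; split => //=.
    by rewrite -ww'.
  by rewrite ww'.
Qed.

Lemma eqc_ereal w w' (Psi : config T -> \bar R) :
  measurable_fun setT Psi -> eqc w w' -> Psi w = Psi w'.
Proof.
move=> mPsi ww'; apply/esym.
by have := eqc_measurable ww' (mPsi measurableT _ (emeasurable_set1 (Psi w))); rewrite !setTI; apply.
Qed.

Lemma measurable_config_ev (A : set RR) : measurable A ->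
  measurable_fun setT (fun w : config T => w A).
Proof.
move=> mA _ B mB; apply: sub_sigma_algebra; exists A => //.
by exists B.
Qed.

Lemma measurable_to_config d' (X : measurableType d') (g : X -> config T) :
  (forall A : set RR, measurable A -> measurable_fun setT (fun x => g x A)) ->
  measurable_fun setT g.
Proof.
move=> mg; apply: (@measurability _ _ _ _ _ _ (@config_ev R T)) => //.
move=> _ [_ [A mA [B mB <-]] <-]; rewrite !setTI.
by have := mg A mA measurableT B mB; rewrite setTI.
Qed.

Lemma config_nat w (A : set RR) : measurable A -> exists n : nat, w A = n%:R%:E.
Proof. exact: (config_int (configP w)). Qed.

(** A measurable family of configurations is an s-finite transition kernel:
    fixing the total number of points splits it into bounded kernels. *)
Section config_kernel.
Context d (X : measurableType d) (g : {mfun X >-> config T}).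

Definition config_slice (n : nat) (x : X) : {measure set RR -> \bar R} :=
  if g x setT == n%:R%:E then config_measure (g x) else mzero.

Lemma measurable_mfun_config (A : set RR) : measurable A ->
  measurable_fun setT (fun x => g x A).
Proof. by move=> mA; exact: (measurableT_comp (measurable_config_ev mA)). Qed.

Lemma config_slice_kernel n U : measurable U ->
  measurable_fun setT (config_slice n ^~ U).
Proof.
move=> mU; rewrite (_ : (config_slice n) ^~ U = fun x =>
   if g x setT == n%:R%:E then g x U else 0%E); last first.
  by apply/funext => w; rewrite /config_slice; case: ifP.
apply: measurable_fun_ifT.
- apply: (measurable_fun_bool true).
  rewrite (_ : _ @^-1` _ = (fun x => g x setT) @^-1` [set n%:R%:E]); last first.
    by apply/seteqP; split => w /= /eqP.
  exact: (measurable_mfun_config measurableT measurableT (emeasurable_set1 n%:R%:E)).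
- exact: measurable_mfun_config.
- exact: measurable_cst.
Qed.

HB.instance Definition _ n :=
  @isKernel.Build _ _ X RR R (config_slice n) (@config_slice_kernel n).

Lemma config_slice_uub n : measure_fam_uub (config_slice n).
Proof.
exists (n.+1%:R) => w; rewrite /config_slice; case: ifP => [/eqP ->|_].
  by rewrite lte_fin ltr_nat.
by rewrite /mzero/= lte_fin ltr0n.
Qed.

HB.instance Definition _ n :=
  @Kernel_isFinite.Build _ _ X RR R (config_slice n) (@config_slice_uub n).

Definition config_kernel (x : X) : {measure set RR -> \bar R} := g x.

HB.instance Definition _ :=
  @isKernel.Build _ _ X RR R config_kernel measurable_mfun_config.

Lemma config_kernel_sfinite : exists s : (R.-fker X ~> RR)^nat,
  forall x U, measurable U -> config_kernel x U = kseries s x U.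
Proof.
exists (fun n => config_slice n) => w U mU; rewrite /config_kernel /kseries/= /mseries.
have [n wn] := config_nat (g w) measurableT.
rewrite (@nneseriesD1 _ _ n)//.
rewrite {1}/config_slice wn eqxx /= eseries0 ?adde0// => k _ /= kn.
rewrite /config_slice wn; case: ifPn => // /eqP [] /eqP; rewrite eqr_nat => /eqP nk.
by rewrite nk eqxx in kn.
Qed.

HB.instance Definition _ :=
  @Kernel_isSFinite.Build _ _ X RR R config_kernel config_kernel_sfinite.

End config_kernel.

Lemma measurable_config_integral d (X : measurableType d) (g : X -> config T)
    (k : X * RR -> \bar R) : measurable_fun setT g ->
  (forall x, 0 <= k x)%E -> measurable_fun setT k ->
  measurable_fun setT (fun x => \int[g x]_t k (x, t))%E.
Proof.
move=> mg k0 mk; pose g' : {mfun X >-> config T} :=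
  HB.pack g (isMeasurableFun.Build _ _ _ _ g mg).
exact: (measurable_fun_integral_sfinite_kernel k (config_kernel g')).
Qed.

(** The evaluation at a set that moves with the parameter is an integral
    against a kernel. *)
Lemma measurable_config_xsection d (X : measurableType d) (g : X -> config T)
    (B : set (X * RR)) : measurable_fun setT g -> measurable B ->
  measurable_fun setT (fun x => g x (xsection B x)).
Proof.
move=> mg mB.
have := @measurable_config_integral _ X g (EFin \o \1_B) mg.
rewrite (_ : (fun x => \int[g x]_t _)%E = (fun x => g x (xsection B x))).
  apply; first by move=> x; rewrite lee_fin.
  exact/measurable_EFinP.
apply/funext => x /=.
transitivity (\int[g x]_t (\1_(xsection B x) t)%:E)%E; last first.
  by rewrite integral_indic ?setIT//; exact: measurable_xsection.
by apply: eq_integral => t _; rewrite /= !indicE mem_xsection.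
Qed.

Lemma measurable_atom : measurable_fun setT (fun p : RR * config T => p.2 [set p.1]).
Proof.
pose B : set ((RR * config T) * RR) := [set x | x.2 == x.1.1].
rewrite (_ : (fun p : RR * config T => _) = (fun p : RR * config T => p.2 (xsection B p))); last first.
  apply/funext => p; congr (p.2 _); apply/seteqP; split => t; rewrite /xsection /B/= inE/=.
    by move=> ->.
  by move=> /eqP.
apply: measurable_config_xsection; first exact: measurable_snd.
have : measurable_fun setT (fun x : (RR * config T) * RR => (x.2 : R) == x.1.1).
  apply: measurable_fun_eqr; first exact: measurable_snd.
  exact: (measurableT_comp measurable_fst measurable_fst).
by move=> /(_ measurableT [set true]); rewrite setTI; exact.
Qed.

Lemma measurable_cumul : measurable_fun setT (fun p : RR * config T => p.2 `[0%R, p.1]%classic).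
Proof.
pose B : set ((RR * config T) * RR) := [set x | (0 <= x.2) && (x.2 <= x.1.1)].
rewrite (_ : (fun p : RR * config T => _) = (fun p : RR * config T => p.2 (xsection B p))); last first.
  apply/funext => p; congr (p.2 _); apply/seteqP; split => t; rewrite /xsection /B/= inE/= in_itv/=.
    by [].
  by [].
apply: measurable_config_xsection; first exact: measurable_snd.
have : measurable_fun setT (fun x : (RR * config T) * RR => (0 <= x.2) && (x.2 <= x.1.1)).
  apply: measurable_and; first by apply: measurable_fun_ler => //; exact: measurable_snd.
  apply: measurable_fun_ler; first exact: measurable_snd.
  exact: (measurableT_comp measurable_fst measurable_fst).
by move=> /(_ measurableT [set true]); rewrite setTI; exact.
Qed.

(** ** Adding and deleting a point *)

Lemma add_pointE t w (A : set RR) : 0 < t <= T -> w [set t] = 0%E ->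
  add_point t w A = (w A + (t \in A)%:R%:E)%E.
Proof.
move=> tT wt; rewrite /add_point; case: pselect => [p|]; last first.
  by move=> np; exfalso; apply: np; split => //; rewrite in_itv.
transitivity (measure_add w (@dirac _ RR t R) A) => //.
by rewrite measure_addE /= diracE.
Qed.

Lemma add_pointN t w : ~ (0 < t <= T /\ w [set t] = 0%E) -> add_point t w = w.
Proof.
move=> h; by rewrite /add_point; case: pselect.
Qed.

Lemma del_pointE t w (A : set RR) : del_point t w A = w (A `\` [set t]).
Proof. by []. Qed.

Lemma measurable_add_point :
  measurable_fun setT (fun p : RR * config T => add_point p.1 p.2).
Proof.
apply: measurable_to_config => A mA.
rewrite (_ : (fun _ => _) = (fun p : RR * config T =>
    if (0 < p.1) && (p.1 <= T) && (p.2 [set p.1] == 0%E) then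
     (p.2 A + (\1_A p.1)%:E)%E else p.2 A)); last first.
  apply/funext => p; case: ifPn => [/andP[pT /eqP p0]|h].
    by rewrite add_pointE// indicE.
  by rewrite add_pointN// => -[pT p0]; rewrite pT p0 eqxx in h.
have m2 : measurable_fun setT (fun p : RR * config T => p.2 A).
  exact: (measurableT_comp (measurable_config_ev mA) measurable_snd).
apply: measurable_fun_ifT => //.
- apply: measurable_and; first apply: measurable_and.
  + by apply: measurable_fun_ltr => //; exact: measurable_fst.
  + by apply: measurable_fun_ler => //; exact: measurable_fst.
  + apply: (measurable_fun_bool true).
    rewrite (_ : _ @^-1` _ = (fun p : RR * config T => p.2 [set p.1]) @^-1` [set 0%E]).
      exact: (measurable_atom measurableT (emeasurable_set1 0%E)).
    by apply/seteqP; split => p /= /eqP.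
- apply: emeasurable_funD => //; apply/measurable_EFinP.
  by apply: measurableT_comp => //; exact: measurable_fst.
Qed.

Lemma measurable_del_point :
  measurable_fun setT (fun p : RR * config T => del_point p.1 p.2).
Proof.
apply: measurable_to_config => A mA.
pose B : set ((RR * config T) * RR) :=
  (snd @^-1` A) `&` [set x | ~~ (x.2 == x.1.1)].
rewrite (_ : (fun p : RR * config T => _) = (fun p : RR * config T => p.2 (xsection B p))); last first.
  apply/funext => p; rewrite del_pointE; congr (p.2 _).
  apply/seteqP; split => t; rewrite /xsection /B/= inE/=.
    by move=> [At pt]; split => //; apply/eqP.
  by move=> [At /eqP pt].
apply: measurable_config_xsection; first exact: measurable_snd.
apply: measurableI; first by rewrite -[X in measurable X]setTI; exact: measurable_snd.
have : measurable_fun setT (fun x : (RR * config T) * RR => (x.2 : R) == x.1.1).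
  apply: measurable_fun_eqr; first exact: measurable_snd.
  exact: (measurableT_comp measurable_fst measurable_fst).
move=> /(_ measurableT [set false]); rewrite setTI => h.
rewrite [X in measurable X](_ : _ = (fun x : RR * config T * RR => (x.2 : R) == x.1.1) @^-1` [set false]).
  exact: h.
by apply/seteqP; split => x /=; [move/negbTE|move=> ->].
Qed.

End config_space.

(** * The points of a configuration *)

Lemma measurable_fun_natP d (X : measurableType d) (c : X -> nat) :
  (forall n, measurable [set x | c x = n]) -> measurable_fun setT c.
Proof.
move=> mc _ B _; rewrite setTI.
rewrite (_ : _ @^-1` _ = \bigcup_(n in B) [set x | c x = n]).
  by apply: bigcup_measurable.
by apply/seteqP; split => [x Bx|x [n Bn /= cn]]; [exists (c x)|rewrite /preimage/= cn].
Qed.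

Lemma measurable_fun_dispatch d d' (X : measurableType d) (U : measurableType d')
    (c : X -> nat) (h : nat -> X -> U) :
  measurable_fun setT c -> (forall n, measurable_fun setT (h n)) ->
  measurable_fun setT (fun x => h (c x) x).
Proof.
move=> mc mh _ B mB; rewrite setTI.
rewrite (_ : _ @^-1` _ = \bigcup_n ((c @^-1` [set n]) `&` (h n @^-1` B))).
  apply: bigcup_measurable => n _; apply: measurableI.
    by rewrite -[X in measurable X]setTI; exact: mc.
  by rewrite -[X in measurable X]setTI; exact: mh.
by apply/seteqP; split => [x Bx|x [n _ [/= cn hn]]]; [exists (c x)|rewrite /preimage/= cn].
Qed.

Lemma inf_min_eq (R : realType) (S : set R) (x : R) :
  S x -> lbound S x -> inf S = x.
Proof.
move=> Sx lS; apply/eqP; rewrite eq_le; apply/andP; split.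
  by apply: ge_inf => //; exists x.
by apply: lb_le_inf => //; exists x.
Qed.

Section config_points.
Context {R : realType} {T : R}.
Implicit Types (w : config T) (t : R).

Local Notation RR := (measurableTypeR R).

Lemma config_le w (A B : set RR) : measurable A -> measurable B -> A `<=` B ->
  (w A <= w B)%E.
Proof. by move=> mA mB AB; apply: le_measure; rewrite ?inE. Qed.

Lemma npointsP w t : w `[0%R, t]%classic = (npoints w t)%:R%:E.
Proof.
rewrite /npoints; have [n ->] := config_nat w (measurable_itv `[0%R, t]).
by rewrite /= natrK.
Qed.

Lemma npoints_le w s t : s <= t -> (npoints w s <= npoints w t)%N.
Proof.
move=> st; rewrite -(ler_nat R) -lee_fin -!npointsP.
apply: config_le; try exact: measurable_itv.
by apply: subset_itvl; rewrite bnd_simp.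
Qed.

Lemma npoints_split w s t : 0 <= s <= t ->
  ((npoints w t)%:R%:E = (npoints w s)%:R%:E + w `]s, t]%classic)%E.
Proof.
move=> /andP[s0 st]; rewrite -!npointsP -measureU//=.
- congr (w _); rewrite -[RHS](@itv_bndbnd_setU _ _ (BLeft 0) (BRight s) (BRight t))//=.
- apply/seteqP; split => // x /=; rewrite !in_itv/= => -[/andP[_ xs] /andP[sx _]].
  by move: (lt_le_trans sx xs); rewrite ltxx.
Qed.

Lemma npoints_const w s t : 0 <= s <= t -> w `]s, t]%classic = 0%E ->
  npoints w t = npoints w s.
Proof.
move=> st w0; have := npoints_split w st; rewrite w0 adde0 => -[] /eqP.
by rewrite eqr_nat => /eqP.
Qed.

Lemma npoints_lt w s t : 0 <= s < t -> w [set t] = 1%E ->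
  (npoints w s < npoints w t)%N.
Proof.
move=> /andP[s0 st] wt.
have st' : 0 <= s <= t by rewrite s0 ltW.
have h := npoints_split w st'.
have : (1 <= w `]s, t]%classic)%E.
  rewrite -wt; apply: config_le => //.
  by move=> x /= ->; rewrite in_itv/= st lexx.
move: h; have [n ->] := config_nat w (measurable_itv `]s, t]).
move=> [] /eqP; rewrite -natrD eqr_nat => /eqP ->.
by rewrite lee_fin ler1n; case: n => // n _; rewrite addnS ltnS leq_addr.
Qed.

(** At a time before [s], fewer points have been counted than at [t], because
    [s] carries one; nothing has to be excluded if [s] is the origin. *)
Lemma last_pointE w s t : 0 <= s -> s <= t -> t <= T ->
  w `]s, t]%classic = 0%E -> (s = 0 \/ w [set s] = 1%E) ->
  point_of w (npoints w t) = s.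
Proof.
move=> s0 st tT w0 ws; rewrite (@npoints_const w s t)// ?s0//.
apply: inf_min_eq => /=.
  by rewrite in_itv/= s0 (le_trans st tT); split => //; rewrite npointsP.
move=> x /= []; rewrite in_itv/= => /andP[x0 xT]; rewrite npointsP lee_fin ler_nat.
rewrite leNgt; apply: contraTN => xs; rewrite -ltnNge.
case: ws => [s00|ws]; first by move: xs; rewrite s00 ltNge x0.
by apply: npoints_lt => //; rewrite x0.
Qed.

Lemma next_pointE w t r : 0 <= t -> t < r -> r <= T ->
  w `]t, r[%classic = 0%E -> w [set r] = 1%E ->
  (npoints w t < npoints w T)%N /\ point_of w (npoints w t).+1 = r.
Proof.
move=> t0 tr rT w0 wr.
have tr1 : (npoints w t < npoints w r)%N by apply: npoints_lt => //; rewrite t0.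
split; first by rewrite (leq_trans tr1)// npoints_le.
have ltr x : t <= x -> x < r -> npoints w x = npoints w t.
  move=> tx xr; apply: npoints_const; first by rewrite t0.
  apply/eqP; rewrite eq_le measure_ge0 andbT -w0; apply: config_le => //.
  by apply: subset_itvl; rewrite bnd_simp.
apply: inf_min_eq => /=.
  by rewrite in_itv/= (le_trans t0 (ltW tr)) rT npointsP lee_fin ler_nat.
move=> x /= []; rewrite in_itv/= => /andP[x0 xT]; rewrite npointsP lee_fin ler_nat.
rewrite leNgt; apply: contraTN => xr; rewrite -leqNgt.
case: (leP t x) => [tx|xt]; first by rewrite ltr.
by apply: npoints_le; exact: ltW.
Qed.

Lemma point_of_le w t : 0 <= t <= T -> point_of w (npoints w t) <= t.
Proof.
move=> /andP[t0 tT]; apply: ge_inf.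
  by exists 0 => x /= []; rewrite in_itv/= => /andP[].
by split; rewrite /= ?in_itv/= ?t0// npointsP.
Qed.

Lemma point_of_ge w t : 0 <= t <= T -> (npoints w t < npoints w T)%N ->
  t <= point_of w (npoints w t).+1.
Proof.
move=> /andP[t0 tT] lt; apply: lb_le_inf.
  by exists T; split; rewrite /= ?in_itv/= ?lexx ?(le_trans t0 tT)// npointsP lee_fin ler_nat.
move=> x /= []; rewrite in_itv/= => /andP[x0 xT]; rewrite npointsP lee_fin ler_nat.
rewrite leNgt; apply: contraTN => xr; rewrite -leqNgt.
by apply: npoints_le; exact: ltW.
Qed.

Lemma measurable_npoints :
  measurable_fun setT (fun p : RR * config T => npoints p.2 p.1).
Proof.
apply: measurable_fun_natP => n.
rewrite (_ : mkset _ = (fun p : RR * config T => p.2 `[0%R, p.1]%classic) @^-1` [set n%:R%:E]).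
  by rewrite -[X in measurable X]setTI; apply: measurable_cumul => //; exact: emeasurable_set1.
apply/seteqP; split => p /=; rewrite npointsP; first by move=> ->.
by move=> [] /eqP; rewrite eqr_nat => /eqP.
Qed.

Lemma measurable_npointsr t : measurable_fun setT (fun w : config T => npoints w t).
Proof.
apply: (measurableT_comp measurable_npoints (g := fun w => (t, w))).
exact: measurable_fun_pair.
Qed.

(** The infimum is below [x] when enough points have been counted at [T], or
    at a rational time before [T], and this time is below [x]; if there are too
    few points, it is the infimum of the empty set, which is [0]. *)
Lemma measurable_point_of i : 0 <= T ->
  measurable_fun setT (fun w : config T => point_of w i).
Proof.
move=> T0.
have mn (n : nat) t : measurable [set w : config T | (n <= npoints w t)%N].
  have := measurable_npointsr t measurableT (Y := [set m | (n <= m)%N]).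
  by rewrite setTI; apply.
have mP (Q : Prop) : measurable [set _ : config T | Q].
  case: (pselect Q) => q.
    by rewrite (_ : mkset _ = setT)//; apply/seteqP; split.
  by rewrite (_ : mkset _ = set0)//; apply/seteqP; split.
pose A x := [set w : config T | (i <= npoints w T)%N] `&`
  ([set _ | T < x] `|`
   \bigcup_(q in [set q : rat | [/\ 0 <= ratr q :> R, ratr q < x & ratr q <= T]])
    [set w : config T | (i <= npoints w (ratr q))%N]).
pose B (x : R) := [set w : config T | (npoints w T < i)%N] `&` [set _ | 0 < x].
have AB x : (fun w : config T => point_of w i) @^-1` `]-oo, x[ = A x `|` B x.
  apply/seteqP; split => w /=; rewrite in_itv/=.
    move=> px; case: (leqP i (npoints w T)) => iT; last first.
      right; split => //; move: px; rewrite /point_of.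
      rewrite (_ : mkset _ = set0); first by rewrite inf0.
      apply/seteqP; split => // s /= []; rewrite in_itv/= => /andP[s0 sT].
      rewrite npointsP lee_fin ler_nat => h; move: (npoints_le w sT) => h2.
      by move: (leq_trans h h2); rewrite leqNgt iT.
    left; split => //.
    have hinf : has_inf [set s : R | s \in `[0, T] /\ (i%:R%:E <= w `[0%R, s]%classic)%E].
      split; first by exists T; rewrite /= in_itv/= T0 lexx npointsP lee_fin ler_nat.
      by exists 0 => s /= []; rewrite in_itv/= => /andP[].
    have [s [/=]] := inf_lt hinf.1 px.
    rewrite in_itv/= npointsP lee_fin ler_nat => /andP[s0 sT] si sx.
    move: sT; rewrite le_eqVlt => /predU1P[sT|sT]; first by left; rewrite /= -sT.
    right; have /rat_in_itvoo[q] : s < Num.min x T by rewrite lt_min sx.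
    rewrite in_itv/= lt_min => /and3P[sq qx qT]; exists q => /=.
      by rewrite (le_trans s0 (ltW sq)) qx ltW.
    by rewrite (leq_trans si)// npoints_le// ltW.
  case=> [[iT [Tx|[q [q0 qx qT] /= iq]]]|[iT x0]].
  - apply: le_lt_trans Tx; apply: ge_inf.
      by exists 0 => s /= []; rewrite in_itv/= => /andP[].
    by rewrite /= in_itv/= T0 lexx npointsP lee_fin ler_nat.
  - apply: le_lt_trans qx; apply: ge_inf.
      by exists 0 => s /= []; rewrite in_itv/= => /andP[].
    by rewrite /= in_itv/= q0 qT npointsP lee_fin ler_nat.
  - rewrite /point_of (_ : mkset _ = set0); first by rewrite inf0.
    apply/seteqP; split => // s /= []; rewrite in_itv/= => /andP[s0 sT].
    rewrite npointsP lee_fin ler_nat => h; move: (npoints_le w sT) => h2.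
    by move: (leq_trans h h2); rewrite leqNgt iT.
have mB x : measurable (B x).
  apply: measurableI => //.
  rewrite (_ : mkset _ = ~` [set w : config T | (i <= npoints w T)%N]).
    exact: measurableC.
  by apply/seteqP; split => w /=; rewrite ltnNge; move/negP.
have mA x : measurable (A x).
  apply: measurableI => //; apply: measurableU => //.
  rewrite bigcup_mkcond; apply: bigcupT_measurable_rat => q.
  by case: ifP.
apply: (measurability (@RGenInftyO.G R)) => [|/= _ [_] [x] -> <-].
  exact: RGenInftyO.measurableE.
rewrite setTI AB; exact: measurableU.
Qed.

End config_points.

(** * Shifts and densities in Lebesgue integrals *)

Lemma addIe_fin (R : realType) (z x y : \bar R) : z \is a fin_num ->
  (x + z = y + z)%E -> x = y.
Proof. by move=> zf xy; rewrite -(addeK x zf) xy addeK. Qed.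

Lemma measurable_funV d (X : measurableType d) {R : realType} (g : X -> R) :
  measurable_fun setT g -> measurable_fun setT (fun x => (g x)^-1).
Proof.
move=> mg.
rewrite (_ : (fun _ => _) =
  fun x => if 0 <= g x then g x `^ (-1) else - ((- g x) `^ (-1))); last first.
  apply/funext => x; case: ifPn => [g0|]; first by rewrite powR_inv1.
  by rewrite -ltNge => g0; rewrite powR_inv1 ?invrN ?opprK// oppr_ge0 ltW.
apply: measurable_fun_ifT; first exact: measurable_fun_ler.
  exact: (measurableT_comp (measurable_powR (-1)) mg).
apply: measurable_funN.
apply: (measurableT_comp (measurable_powR (-1)) (g := fun x => - g x)).
  exact: measurable_funN.
Qed.

Section shift_density.
Context {R : realType}.
Local Notation mu := (@lebesgue_measure R).
Local Notation RR := (measurableTypeR R).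

Lemma lebesgue_measure_shift (s : R) (A : set RR) : measurable A ->
  pushforward mu (fun t : RR => t - s : RR) A = mu A.
Proof.
move=> mA; apply/esym.
have ms : measurable_fun setT (fun t : RR => t - s : RR) by exact: measurable_funB.
pose g : {mfun RR >-> RR} := HB.pack (fun t : RR => t - s : RR)
  (isMeasurableFun.Build _ _ _ _ (fun t : RR => t - s : RR) ms).
apply: (lebesgue_measure_unique (mu := pushforward mu g)) => //= _ [[a b]] _ <-.
rewrite /pushforward (_ : _ @^-1` _ = `]a + s, b + s]%classic); last first.
  by apply/seteqP; split => t; rewrite /= !in_itv/= ltrBrDr lerBlDr.
rewrite !lebesgue_measure_itv/= !lte_fin ltrD2r; case: ifP => // _.
by rewrite -!EFinB opprD addrACA subrr addr0.
Qed.

Lemma ge0_integral_shift (g : R -> \bar R) (s : R) :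
  measurable_fun setT g -> (forall t, 0 <= g t)%E ->
  (\int[mu]_t g (t - s)%R = \int[mu]_t g t)%E.
Proof.
move=> mg g0.
have ms : measurable_fun setT (fun t : RR => t - s : RR) by exact: measurable_funB.
pose sh : RR -> RR := fun t : RR => t - s : RR.
rewrite -[LHS]/(\int[mu]_(t in sh @^-1` setT) (g \o sh) t)%E.
rewrite -ge0_integral_pushforward//.
by apply: eq_measure_integral => A mA _; exact: lebesgue_measure_shift.
Qed.

End shift_density.

Section integral_density.
Context d (X : measurableType d) {R : realType}.
Variables (nu m : {measure set X -> \bar R}) (f : X -> R).
Hypothesis mf : measurable_fun setT f.
Hypothesis f0 : forall x, 0 <= f x.
Hypothesis nuE : forall A, measurable A -> nu A = (\int[m]_(x in A) (f x)%:E)%E.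

Import HBNNSimple.

(** Monotone convergence, from simple functions. *)
Lemma ge0_integral_density (g : X -> \bar R) :
  measurable_fun setT g -> (forall x, 0 <= g x)%E ->
  (\int[nu]_x g x = \int[m]_x ((f x)%:E * g x))%E.
Proof.
move=> mg g0; pose g_ := nnsfun_approx measurableT mg.
have gE x : g x = limn (fun n => (g_ n x)%:E).
  by apply/esym/cvg_lim => //; exact: cvg_nnsfun_approx.
transitivity (limn (fun n => \int[nu]_x (g_ n x)%:E))%E.
  rewrite -monotone_convergence//.
  - by apply: eq_integral => x _; exact: gE.
  - by move=> n; exact/measurable_EFinP.
  - by move=> n x _; rewrite lee_fin.
  - by move=> x _ a b ab; rewrite lee_fin; exact/lefP/nd_nnsfun_approx.
transitivity (limn (fun n => \int[m]_x ((f x)%:E * (g_ n x)%:E)))%E; last first.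
  rewrite -monotone_convergence//.
  - apply: eq_integral => x _; rewrite gE.
    apply/cvg_lim => //; apply: cvgeZl => //.
    have : (fun n => (g_ n x)%:E) @ \oo --> g x by exact: cvg_nnsfun_approx.
    by rewrite gE.
  - by move=> n; apply: emeasurable_funM; exact/measurable_EFinP.
  - by move=> n x _; rewrite mule_ge0// lee_fin.
  - move=> x _ a b ab; rewrite lee_wpmul2l ?lee_fin//.
    exact/lefP/nd_nnsfun_approx.
apply/congr_lim/funext => n.
under [LHS]eq_integral do rewrite fimfunE -fsumEFin//.
under [RHS]eq_integral do rewrite fimfunE -fsumEFin//.
rewrite ge0_integral_fsum//; last 2 first.
  - by move=> r; exact/measurable_EFinP/measurable_funM.
  - by move=> r x _; rewrite EFinM nnfun_muleindic_ge0.
transitivity (\int[m]_x (\sum_(r \in range (g_ n)) ((f x)%:E * (r * \1_(g_ n @^-1` [set r]) x)%:E)))%E; last first.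
  apply: eq_integral => x _; rewrite ge0_mule_fsumr// => r.
  by rewrite EFinM nnfun_muleindic_ge0.
rewrite ge0_integral_fsum//; last 2 first.
  - move=> r; apply: emeasurable_funM; first exact/measurable_EFinP.
    by exact/measurable_EFinP/measurable_funM.
  - by move=> r x _; apply: mule_ge0; [rewrite lee_fin|rewrite EFinM nnfun_muleindic_ge0].
apply: eq_fsbigr => r rg.
have r0 : 0 <= r by move: rg; rewrite inE => -[x _ <-].
have mr : measurable (g_ n @^-1` [set r]) by [].
under [LHS]eq_integral do rewrite EFinM.
rewrite ge0_integralZl//; last exact/measurable_EFinP.
rewrite integral_indic// setIT nuE//.
rewrite integral_mkcond -ge0_integralZl//; last 2 first.
  - by apply/(measurable_restrictT _ _).1 => //; apply: measurable_funTS; exact/measurable_EFinP.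
  - by move=> x _; rewrite erestrict_ge0// => y _; rewrite lee_fin.
apply: eq_integral => x _; rewrite patchE indicE.
by case: ifPn => _; rewrite ?mule0 ?mulr0 ?mule0// mulr1 muleC.
Qed.

End integral_density.

(** For variables on the line, whose distributions do not live on the display
    of the Lebesgue measure. *)
Lemma ge0_integral_distribution_density d (Omega : measurableType d) {R : realType}
    (P : probability Omega R) (Y : {RV P >-> R}) (f : R -> R) :
  measurable_fun setT f -> (forall x, 0 <= f x) ->
  (forall A : set R, measurable A ->
     distribution P Y A = (\int[@lebesgue_measure R]_(x in A) (f x)%:E)%E) ->
  forall g : R -> \bar R, measurable_fun setT g -> (forall x, 0 <= g x)%E ->
  (\int[distribution P Y]_x g x = \int[@lebesgue_measure R]_x ((f x)%:E * g x))%E.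
Proof.
move=> mf f0 YE g mg g0.
have mY : @measurable_fun _ _ Omega (measurableTypeR R) setT Y.
  by move=> _ B mB; exact: (measurable_funP Y measurableT B mB).
pose Y' : {mfun Omega >-> measurableTypeR R} :=
  HB.pack (Y : Omega -> measurableTypeR R) (isMeasurableFun.Build _ _ _ _ _ mY).
rewrite ge0_integral_distribution//.
transitivity (\int[distribution P Y']_x g x)%E.
  by rewrite (ge0_integral_distribution (P := P) Y').
have YE' (A : set (measurableTypeR R)) : measurable A ->
  distribution P Y' A = (\int[@lebesgue_measure R]_(x in A) (f x)%:E)%E by exact: YE.
exact: (@ge0_integral_density _ (measurableTypeR R) R (distribution P Y')
  (@lebesgue_measure R) f mf f0 YE' g mg g0).
Qed.

(** * Independence from the future of a sequence of variables *)

Section independence.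
Context d (Omega : measurableType d) {R : realType} (P : probability Omega R).
Variable tau : nat -> {RV P >-> R}.

Definition future_event (J : {fset nat}) (A : nat -> set R) : set Omega :=
  \bigcap_(i in [set` J]) (tau i @^-1` A i).

(** Finite families of coordinates suffice: they are what the mutual
    independence of [tau] speaks of. *)
Definition indep_future d' (S : measurableType d') (Z : Omega -> S) (m : nat) :=
  forall (C : set S) (J : {fset nat}) (A : nat -> set R),
    measurable C -> (forall i, measurable (A i)) ->
    (forall i, i \in J -> (m <= i)%N) ->
    P (Z @^-1` C `&` future_event J A) =
      (P (Z @^-1` C) * P (future_event J A))%E.

Lemma measurable_future_event (J : {fset nat}) (A : nat -> set R) :
  (forall i, measurable (A i)) -> measurable (future_event J A).
Proof.
move=> mA; apply: fin_bigcap_measurable; first exact: finite_fset.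
by move=> i _; rewrite -[X in measurable X]setTI; exact: measurable_funP.
Qed.

Lemma indep_future_cst d' (S : measurableType d') (z : S) m :
  indep_future (fun=> z) m.
Proof.
move=> C J A mC mA _; rewrite preimage_cst; case: ifPn => _.
  by rewrite setTI probability_setT mul1e.
by rewrite set0I measure0 mul0e.
Qed.

Lemma indep_future_comp d' (S : measurableType d') d'' (S' : measurableType d'')
    (Z : Omega -> S) (phi : S -> S') m :
  measurable_fun setT phi -> indep_future Z m -> indep_future (phi \o Z) m.
Proof.
move=> mphi iZ C J A mC mA JA.
rewrite comp_preimage; apply: iZ => //.
by rewrite -[X in measurable X]setTI; exact: mphi.
Qed.

Hypothesis indep : mutually_independent tau.

Section step.
Context d' (S : measurableType d') (Z : Omega -> S) (m : nat).
Hypotheses (mZ : measurable_fun setT Z) (iZ : indep_future Z m).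

Lemma indep_future_pair (C : set S) (B : set R) : measurable C -> measurable B ->
  P (Z @^-1` C `&` tau m @^-1` B) = (P (Z @^-1` C) * P (tau m @^-1` B))%E.
Proof.
move=> mC mB.
have E : future_event [fset m]%fset (fun=> B) = tau m @^-1` B.
  apply/seteqP; split => [ o Ho | o Bo i /=]; first by apply: (Ho m); rewrite /= inE.
  by rewrite inE => /eqP->.
by rewrite -E iZ// => i; rewrite inE => /eqP->.
Qed.

Let ZT : {mfun Omega >-> (S * R)%type} := HB.pack (fun o => (Z o, tau m o))
  (isMeasurableFun.Build _ _ _ _ (fun o => (Z o, tau m o))
    (measurable_fun_pair mZ (measurable_funP (tau m)))).

Let Z' : {mfun Omega >-> S} := HB.pack Z (isMeasurableFun.Build _ _ _ _ Z mZ).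

(** Once an event of the coordinates above [m] is fixed, the two sides are
    finite measures of [C], which agree on rectangles. *)
Lemma indep_future_step d'' (S' : measurableType d'') (phi : S * R -> S') :
  measurable_fun setT phi ->
  indep_future (fun o => phi (Z o, tau m o)) m.+1.
Proof.
move=> mphi; apply: (@indep_future_comp _ _ _ _ (fun o => (Z o, tau m o)) phi) => //.
move=> C J A mC mA JA; set D := future_event J A.
have mD : measurable D by exact: measurable_future_event.
pose m1 := pushforward (mrestr P mD) ZT.
have mm : measurable_fun setT ZT by exact: measurable_funP.
pose q : {nonneg R} := NngNum (fine_ge0 (measure_ge0 P D)).
pose m2 := mscale q (distribution P ZT).
have qE : q%:num%:E = P D by rewrite /= fineK// fin_num_measure.
pose G : set (set (S * R)) := [set A `*` B | A in measurable & B in measurable].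
have m2E B : m2 B = (P D * P (ZT @^-1` B))%E by rewrite -qE.
suff : m1 C = m2 C by rewrite m2E muleC.
apply: (@measure_unique _ _ _ G (fun=> setT) _ _ _ _ (pushforward (mrestr P mD) ZT) (mscale q (distribution P ZT))) => //.
- by rewrite measurable_prod_measurableType.
- move=> _ _ [A1 mA1 [B1 mB1 <-]] [A2 mA2 [B2 mB2 <-]].
  rewrite -setXI; exists (A1 `&` A2); first exact: measurableI.
  by exists (B1 `&` B2) => //; exact: measurableI.
- by move=> _; exists setT => //; exists setT => //; rewrite setXTT.
- by rewrite bigcup_const//; exists 0%N.
- move=> _ [A1 mA1 [B1 mB1 <-]].
  transitivity (m2 (A1 `*` B1)) => //; rewrite m2E.
  change (P (ZT @^-1` (A1 `*` B1) `&` D) = (P D * P (ZT @^-1` (A1 `*` B1)))%E).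
  have E : ZT @^-1` (A1 `*` B1) = Z @^-1` A1 `&` tau m @^-1` B1 by [].
  rewrite E indep_future_pair//.
  pose A' i := if i == m then B1 else A i.
  have E2 : tau m @^-1` B1 `&` D = future_event (m |` J)%fset A'.
    apply/seteqP; split.
      move=> o [Bo Do] i /=; rewrite !inE /A'; case: eqP => [->//|_ /= iJ].
      exact: Do.
    move=> o Do; split.
      by have := Do m; rewrite /A' eqxx; apply; rewrite /= !inE eqxx.
    move=> i /= iJ; have := Do i; rewrite /A'; case: eqP => [im|_].
      by move: (JA _ iJ); rewrite im ltnn.
    by apply; rewrite /= !inE iJ orbT.
  rewrite -setIA E2 iZ//; last 2 first.
  + by move=> i; rewrite /A'; case: ifP.
  + by move=> i; rewrite !inE => /predU1P[->//|/JA/ltnW].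
  rewrite [RHS]muleCA; congr (_ * _)%E; rewrite [RHS]muleC /D.
  have mJ : m \notin J by apply/negP => /JA; rewrite ltnn.
  rewrite /future_event !indep//; last by move=> i; rewrite /A'; case: ifP.
  rewrite big_fsetU1//= /A' eqxx; congr (_ * _)%E.
  rewrite big_seq_cond [RHS]big_seq_cond; apply: eq_bigr => i /andP[iJ _].
  by case: eqP => // im; move: mJ; rewrite -im iJ.
- move=> _; rewrite /m1 /pushforward/= /mrestr.
  by apply: le_lt_trans (ltry 1); apply: probability_le1; rewrite preimage_setT setTI.
Qed.

(** The law of the pair is the product of the laws. *)
Lemma indep_future_expectation (Phi : S * R -> \bar R) :
  measurable_fun setT Phi -> (forall x, 0 <= Phi x)%E ->
  (\int[P]_o Phi (Z o, tau m o) =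
   \int[P]_o \int[distribution P (tau m)]_x Phi (Z o, x))%E.
Proof.
move=> mPhi Phi0.
transitivity (\int[distribution P ZT]_y Phi y)%E.
  by rewrite (ge0_integral_distribution (P := P) ZT).
rewrite (eq_measure_integral (distribution P Z' \x distribution P (tau m))%E); last first.
  move=> A mA _; apply/esym.
  apply: (@product_measure_unique _ _ _ _ _ (distribution P Z') (distribution P (tau m)) (distribution P ZT)) => //.
  move=> B C mB mC; rewrite /distribution /pushforward /=.
  exact: indep_future_pair.
rewrite fubini_tonelli1//.
rewrite (ge0_integral_distribution (P := P) Z')//.
  by apply: measurable_fun_fubini_tonelli_F.
by move=> y; apply: integral_ge0.
Qed.

End step.
End independence.

(** * The renewal operator *)

Section add_point_commute.
Context {R : realType} {T : R}.
Local Notation RR := (measurableTypeR R).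
Implicit Types (w : config T) (s t r : R).

Lemma add_point_eqc t w w' : eqc w w' -> eqc (add_point t w) (add_point t w').
Proof.
move=> ww' A mA; have [h|h] := pselect (0 < t <= T /\ w [set t] = 0%E).
  have [h1 h2] := h; have h3 : w' [set t] = 0%E by rewrite -ww'.
  by rewrite !add_pointE// ww'.
have h' : ~ (0 < t <= T /\ w' [set t] = 0%E).
  by move=> [h1 h2]; apply: h; split => //; rewrite ww'.
by rewrite (add_pointN h) (add_pointN h') ww'.
Qed.

Lemma add_pointC t r w : t != r ->
  eqc (add_point t (add_point r w)) (add_point r (add_point t w)).
Proof.
move=> tr.
have tr0 : (t \in [set r]) = false by rewrite memNset//= => tr'; rewrite tr' eqxx in tr.
have rt0 : (r \in [set t]) = false by rewrite memNset//= => rt; rewrite rt eqxx in tr.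
move=> A mA; have [ht|ht] := pselect (0 < t <= T /\ w [set t] = 0%E);
  have [hr|hr] := pselect (0 < r <= T /\ w [set r] = 0%E).
- have [ht1 ht2] := ht; have [hr1 hr2] := hr.
  rewrite add_pointE//; last by rewrite add_pointE// ht2 rt0 add0e.
  rewrite [RHS]add_pointE//; last by rewrite add_pointE// hr2 tr0 add0e.
  by rewrite !add_pointE// addeAC.
- rewrite (add_pointN hr) [in RHS]add_pointN// => -[hr1].
  by have [ht1 ht2] := ht; rewrite add_pointE// tr0 adde0 => h; apply: hr.
- rewrite (add_pointN ht) [in LHS]add_pointN// => -[ht1].
  by have [hr1 hr2] := hr; rewrite add_pointE// rt0 adde0 => h; apply: ht.
- by rewrite (add_pointN hr) (add_pointN ht) add_pointN// add_pointN.
Qed.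

Definition past w s := w `]s, +oo[%classic = 0%E.

Definition agree w s w' := forall A : set RR, measurable A ->
  A `<=` `]-oo, s]%classic -> w' A = w A.

Lemma past_atom w s t : past w s -> s < t -> w [set t] = 0%E.
Proof.
move=> ws st; apply/eqP; rewrite eq_le measure_ge0 andbT -ws.
by apply: config_le => // x /= ->; rewrite in_itv/= andbT.
Qed.

Lemma past_add w s t : past w s -> 0 <= s -> s < t -> t <= T -> past (add_point t w) t.
Proof.
move=> ws s0 st tT; rewrite /past add_pointE//; last exact: past_atom ws st.
  rewrite memNset ?adde0 /=; last by rewrite in_itv/= ltxx.
  apply/eqP; rewrite eq_le measure_ge0 andbT -ws.
  by apply: config_le => //; apply: subset_itvr; rewrite bnd_simp ltW.
by rewrite (le_lt_trans s0 st).
Qed.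

Lemma agree_refl w s : agree w s w. Proof. by []. Qed.

Lemma agree_add w s t w' : past w s -> 0 <= s -> s < t -> t <= T ->
  agree (add_point t w) t w' -> agree w s w'.
Proof.
move=> ws s0 st tT h A mA As; rewrite h//.
  rewrite add_pointE//; [|by rewrite (le_lt_trans s0 st)|exact: past_atom ws st].
  rewrite memNset ?adde0// => /As /=; rewrite in_itv/= => ts.
  by move: (lt_le_trans st ts); rewrite ltxx.
by apply: (subset_trans As); apply: subset_itvl; rewrite bnd_simp ltW.
Qed.

End add_point_commute.

Section renewal_operator.
Context {R : realType} {T : R} (f : R -> R).
Local Notation mu := (@lebesgue_measure R).
Local Notation RR := (measurableTypeR R).
Implicit Types (w : config T) (s t r : R).

Hypothesis mf : measurable_fun setT f.
Hypothesis f0 : forall x, 0 <= f x.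
Hypothesis fneg : forall x : R, x < 0 -> f x = 0.
Hypothesis f1 : (\int[mu]_x (f x)%:E = 1)%E.

(** ** Tails and the step density *)

Let mcond (c : RR -> bool) : measurable_fun setT c ->
  measurable_fun setT (fun u : RR => (if c u then f u else 0)%:E).
Proof. by move=> mc; apply/measurable_EFinP; exact: measurable_fun_ifT. Qed.

(** With an open half-line, tails can be cut at a time without regard to end
    points. *)
Lemma tailE x : (tail f x)%:E = (\int[mu]_u (if (x < u)%R then f u else 0)%R%:E)%E.
Proof.
have E : (\int[mu]_(u in `[x, +oo[) (f u)%:E = \int[mu]_u (if (x < u)%R then f u else 0)%R%:E)%E.
  rewrite -integral_itv_obnd_cbnd; last by apply: measurable_funTS; exact/measurable_EFinP.
  rewrite integral_mkcond; apply: eq_integral => u _.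
  by rewrite patchE mem_setE in_itv/= andbT; case: ifP.
rewrite /tail /Rintegral E fineK// ge0_fin_numE; last first.
  by apply: integral_ge0 => u _; rewrite lee_fin; case: ifP.
apply: (@le_lt_trans _ _ (\int[mu]_u (f u)%:E)%E); last by rewrite f1 ltry.
apply: ge0_le_integral => //.
- by move=> u _; rewrite lee_fin; case: ifP.
- by apply: mcond; exact: measurable_fun_ltr.
- exact/measurable_EFinP.
- by move=> u _; rewrite lee_fin; case: ifP.
Qed.

Lemma tail_ge0 x : 0 <= tail f x.
Proof. by rewrite -lee_fin tailE; apply: integral_ge0 => u _; rewrite lee_fin; case: ifP. Qed.

Lemma tail_nincr : {homo tail f : x y /~ x <= y}.
Proof.
move=> y x xy; rewrite -lee_fin !tailE; apply: ge0_le_integral => //.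
- by move=> u _; rewrite lee_fin; case: ifP.
- by apply: mcond; exact: measurable_fun_ltr.
- by apply: mcond; exact: measurable_fun_ltr.
- by move=> u _; rewrite lee_fin; case: ifPn => [yu|_]; [rewrite (le_lt_trans xy yu)|case: ifP].
Qed.

Lemma measurable_tail : measurable_fun setT (tail f).
Proof. by apply: nonincreasing_measurable => // x y xy; exact: tail_nincr. Qed.

Lemma tail_le0 x : x <= 0 -> tail f x = 1.
Proof.
move=> x0; apply: EFin_inj; rewrite tailE -f1.
have [N [mN N0 sN]] : {ae mu, forall u, u != 0%R}.
  exists [set 0%R]; split => //; first by rewrite lebesgue_measure_set1.
  by move=> u /= /negP; rewrite negbK => /eqP.
apply: ae_eq_integral => //.
- by apply: mcond; exact: measurable_fun_ltr.
- exact/measurable_EFinP.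
- exists N; split => // u /= h; apply: sN => /= un0; apply: h => _.
  case: ltP => // ux; rewrite fneg// lt_neqAle un0/=.
  exact: le_trans ux x0.
Qed.

Lemma tail_le1 x : tail f x <= 1.
Proof.
have [x0|x0] := leP x 0; first by rewrite tail_le0.
by rewrite -(tail_le0 (lexx 0)) tail_nincr// ltW.
Qed.

(** The density at [t] of the arrival that follows the one at [s], restricted
    to the arrivals up to [T]. *)
Definition next_density s t := if (s < t) && (t <= T) then f (t - s) else 0.

Lemma next_density_ge0 s t : 0 <= next_density s t.
Proof. by rewrite /next_density; case: ifP. Qed.

Lemma measurable_next_density : measurable_fun setT (fun p : RR * RR => next_density p.1 p.2).
Proof.
apply: measurable_fun_ifT => //.
- apply: measurable_and.
    by apply: measurable_fun_ltr; [exact: measurable_fst|exact: measurable_snd].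
  by apply: measurable_fun_ler => //; exact: measurable_snd.
- apply: (measurableT_comp mf).
  by apply: measurable_funB; [exact: measurable_snd|exact: measurable_fst].
Qed.

Lemma measurable_next_density2 d (X : measurableType d) (a b : X -> R) :
  measurable_fun setT a -> measurable_fun setT b ->
  measurable_fun setT (fun x => (next_density (a x) (b x))%:E).
Proof.
move=> ma mb; apply/measurable_EFinP.
apply: (measurableT_comp measurable_next_density (g := fun x => (a x, b x))).
exact: measurable_fun_pair.
Qed.

Lemma tail_split s t : s <= t -> t <= T ->
  (\int[mu]_r (if (t < r)%R then next_density s r else 0)%R%:E + (tail f (T - s))%:E
   = (tail f (t - s))%:E)%E.
Proof.
move=> st tT.
have E x : (tail f (x - s))%:E = (\int[mu]_r (if (x < r)%R then f (r - s) else 0)%R%:E)%E.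
  rewrite tailE -(ge0_integral_shift s); first last.
  - by move=> u; rewrite lee_fin; case: ifP.
  - by apply: mcond; exact: measurable_fun_ltr.
  by apply: eq_integral => r _; rewrite ltrD2r.
have mfs : measurable_fun setT (fun r : RR => f (r - s)).
  by apply: (measurableT_comp mf); exact: measurable_funB.
rewrite !E -ge0_integralD//; first last.
- by apply/measurable_EFinP; apply: measurable_fun_ifT => //; exact: measurable_fun_ltr.
- by move=> r _; rewrite lee_fin; case: ifP.
- apply/measurable_EFinP; apply: measurable_fun_ifT => //; first exact: measurable_fun_ltr.
  by apply/measurable_EFinP; apply: measurable_next_density2.
- by move=> r _; rewrite lee_fin; case: ifP => // _; exact: next_density_ge0.
apply: eq_integral => r _; rewrite -EFinD; congr _%:E.
rewrite /next_density; case: (ltP t r) => tr.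
  rewrite (le_lt_trans st tr)/=; case: (leP r T) => rT; first by rewrite addr0.
  by rewrite add0r.
by rewrite ltNge (le_trans tr tT)/= addr0.
Qed.

Lemma next_density_mass s : (\int[mu]_r (next_density s r)%:E + (tail f (T - s))%:E = 1)%E.
Proof.
have [sT|Ts] := leP s T.
  have := tail_split (lexx s) sT; rewrite subrr (tail_le0 (lexx 0)) => <-.
  congr (_ + _)%E; apply: eq_integral => r _; congr _%:E.
  by rewrite /next_density; case: ltP.
rewrite tail_le0; last by rewrite subr_le0 ltW.
rewrite integral0_eq ?add0e// => r _; rewrite /next_density.
by case: ltP => //= sr; rewrite leNgt (lt_trans Ts sr).
Qed.

(** ** The expectation of a functional given the past *)

(** The expectation of [Psi], on the event that exactly [k] points are still
    to come, given that [w] is the configuration of the points seen so far and [s]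
    the last one. *)
Fixpoint future_part (k : nat) (Psi : config T -> \bar R) w s : \bar R :=
  if k is k'.+1 then (\int[mu]_t ((next_density s t)%:E * future_part k' Psi (add_point t w) t))%E
  else ((tail f (T - s))%:E * Psi w)%E.

(** The expectation of [Psi] given the past, as almost surely only finitely
    many arrivals occur before [T]. *)
Definition future_mean (Psi : config T -> \bar R) w s : \bar R := (\sum_(k <oo) future_part k Psi w s)%E.

Lemma future_part_ge0 k Psi w s : (forall w, 0 <= Psi w)%E -> (0 <= future_part k Psi w s)%E.
Proof.
move=> Psi0; elim: k w s => [|k IH] w s /=.
  by rewrite mule_ge0// lee_fin tail_ge0.
by apply: integral_ge0 => t _; rewrite mule_ge0// lee_fin next_density_ge0.
Qed.

Lemma future_mean_ge0 Psi w s : (forall w, 0 <= Psi w)%E -> (0 <= future_mean Psi w s)%E.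
Proof. by move=> Psi0; apply: nneseries_ge0 => k _ _; exact: future_part_ge0. Qed.

Lemma measurable_future_part k d (Y : measurableType d) (Phi : Y * config T -> \bar R) :
  measurable_fun setT Phi -> (forall x, 0 <= Phi x)%E ->
  measurable_fun setT
    (fun p : Y * (config T * RR) => future_part k (fun w => Phi (p.1, w)) p.2.1 p.2.2).
Proof.
move=> mPhi Phi0; elim: k => [|k IH].
  apply: emeasurable_funM.
    apply/measurable_EFinP; apply: (measurableT_comp measurable_tail).
    apply: measurable_funB => //.
    exact: (measurableT_comp measurable_snd measurable_snd).
  apply: (measurableT_comp mPhi); apply: measurable_fun_pair.
    exact: measurable_fst.
  exact: (measurableT_comp measurable_fst measurable_snd).
pose h (q : (Y * (config T * RR)) * RR) : \bar R :=
  ((next_density q.1.2.2 q.2)%:E * future_part k (fun w => Phi (q.1.1, w)) (add_point q.2 q.1.2.1) q.2)%E.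
apply: (measurable_fun_fubini_tonelli_F (m2 := mu) h).
- apply: emeasurable_funM.
    apply: measurable_next_density2; last exact: measurable_snd.
    apply: (measurableT_comp measurable_snd).
    exact: (measurableT_comp measurable_snd measurable_fst).
  apply: (measurableT_comp IH (g := fun q : (Y * (config T * RR)) * RR =>
    (q.1.1, (add_point q.2 q.1.2.1, q.2)))).
  apply: measurable_fun_pair; first exact: (measurableT_comp measurable_fst measurable_fst).
  apply: measurable_fun_pair; last exact: measurable_snd.
  apply: (measurableT_comp measurable_add_point (g := fun q : (Y * (config T * RR)) * RR =>
    (q.2, q.1.2.1))).
  apply: measurable_fun_pair; first exact: measurable_snd.
  apply: (measurableT_comp measurable_fst).
  exact: (measurableT_comp measurable_snd measurable_fst).
- move=> q; rewrite mule_ge0// ?lee_fin ?next_density_ge0//.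
  by apply: future_part_ge0.
Qed.

Lemma measurable_future_mean d (X : measurableType d) (Phi : X * config T -> \bar R)
    (b : X -> config T) (c : X -> R) :
  measurable_fun setT Phi -> (forall x, 0 <= Phi x)%E ->
  measurable_fun setT b -> measurable_fun setT c ->
  measurable_fun setT (fun x => future_mean (fun w => Phi (x, w)) (b x) (c x)).
Proof.
move=> mPhi Phi0 mb mc; apply: ge0_emeasurable_sum => [k x _ _|k _].
  exact: future_part_ge0.
apply: (measurableT_comp (measurable_future_part k mPhi Phi0) (g := fun x => (x, (b x, c x)))).
by apply: measurable_fun_pair => //; exact: measurable_fun_pair.
Qed.

Section one_functional.
Variable Psi : config T -> \bar R.
Hypotheses (mPsi : measurable_fun setT Psi) (Psi0 : forall w, (0 <= Psi w)%E).

Lemma measurable_future_part1 k d (X : measurableType d) (b : X -> config T) (c : X -> R) :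
  measurable_fun setT b -> measurable_fun setT c ->
  measurable_fun setT (fun x => future_part k Psi (b x) (c x)).
Proof.
move=> mb mc.
have mP : measurable_fun setT (fun p : unit * config T => Psi p.2).
  exact: (measurableT_comp mPsi measurable_snd).
have h := @measurable_future_part k _ _ _ mP (fun x => Psi0 x.2).
apply: (measurableT_comp h (g := fun x => (tt, (b x, c x)))).
by apply: measurable_fun_pair => //; exact: measurable_fun_pair.
Qed.

Lemma measurable_future_mean1 d (X : measurableType d) (b : X -> config T) (c : X -> R) :
  measurable_fun setT b -> measurable_fun setT c ->
  measurable_fun setT (fun x => future_mean Psi (b x) (c x)).
Proof.
move=> mb mc; apply: ge0_emeasurable_sum => [k x _ _|k _]; first exact: future_part_ge0.
exact: measurable_future_part1.
Qed.

Lemma measurable_add1 w : measurable_fun setT (fun t : RR => add_point t w).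
Proof.
apply: (measurableT_comp measurable_add_point (g := fun t : RR => (t, w))).
exact: measurable_fun_pair.
Qed.

Lemma measurable_future_step k w s :
  measurable_fun setT (fun t : RR => ((next_density s t)%:E * future_part k Psi (add_point t w) t)%E).
Proof.
apply: emeasurable_funM; first exact: measurable_next_density2.
by apply: measurable_future_part1 => //; exact: measurable_add1.
Qed.

Lemma future_mean_rec w s : future_mean Psi w s =
  ((tail f (T - s))%:E * Psi w + \int[mu]_t ((next_density s t)%:E * future_mean Psi (add_point t w) t))%E.
Proof.
rewrite {1}/future_mean nneseries_recl//; last by move=> k _; exact: future_part_ge0.
congr (_ + _)%E.
rewrite -[in LHS](@nneseries_addn _ _ 1)//; last by move=> k; exact: future_part_ge0.
transitivity (\sum_(k <oo) \int[mu]_t ((next_density s t)%:E * future_part k Psi (add_point t w) t))%E.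
  by apply: eq_eseriesr => k _; rewrite addn1.
rewrite -integral_nneseries//; last 2 first.
- by move=> k; exact: measurable_future_step.
- by move=> k t _; rewrite mule_ge0 ?future_part_ge0// lee_fin next_density_ge0.
by apply: eq_integral => t _; rewrite nneseriesZl// => k _; exact: future_part_ge0.
Qed.

Lemma future_part_eqc k w w' s : eqc w w' -> future_part k Psi w s = future_part k Psi w' s.
Proof.
elim: k w w' s => [|k IH] w w' s ww' /=; first by rewrite (eqc_ereal mPsi ww').
apply: eq_integral => t _; congr (_ * _)%E; apply: IH.
exact: add_point_eqc.
Qed.

Lemma future_mean_eqc w w' s : eqc w w' -> future_mean Psi w s = future_mean Psi w' s.
Proof. by move=> ww'; apply: eq_eseriesr => k _; exact: future_part_eqc. Qed.

Lemma future_part_add k t w s : t <= s ->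
  future_part k (fun w => Psi (add_point t w)) w s = future_part k Psi (add_point t w) s.
Proof.
elim: k w s => [//|k IH] w s ts /=.
apply: eq_integral => r _; rewrite /next_density; case: ifPn => [/andP[sr rT]|_]; last by rewrite !mul0e.
congr (_ * _)%E; rewrite IH ?(le_trans ts (ltW sr))//.
by apply: future_part_eqc; apply: add_pointC; rewrite lt_eqF// (le_lt_trans ts sr).
Qed.

Lemma future_mean_add t w s : t <= s ->
  future_mean (fun w => Psi (add_point t w)) w s = future_mean Psi (add_point t w) s.
Proof. by move=> ts; apply: eq_eseriesr => k _; exact: future_part_add. Qed.

Lemma future_partZ k (c : R) w s : 0 <= c ->
  future_part k (fun w => c%:E * Psi w)%E w s = (c%:E * future_part k Psi w s)%E.
Proof.
move=> c0; elim: k w s => [|k IH] w s /=; first by rewrite muleCA.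
under eq_integral do rewrite IH muleCA.
rewrite ge0_integralZl_EFin//; first by move=> t _; rewrite mule_ge0 ?future_part_ge0// lee_fin next_density_ge0.
exact: measurable_future_step.
Qed.

Lemma future_meanZ (c : R) w s : 0 <= c ->
  future_mean (fun w => c%:E * Psi w)%E w s = (c%:E * future_mean Psi w s)%E.
Proof.
move=> c0; rewrite /future_mean -nneseriesZl//; last by move=> k _; exact: future_part_ge0.
by apply: eq_eseriesr => k _; rewrite future_partZ.
Qed.

(** It makes no difference whether [t] is added before or after the points to
    come. This is the source of the Papangelou formula. *)
Lemma future_mean_add_split w t : 0 < t <= T -> w [set t] = 0%E ->
  ((tail f (T - t))%:E * Psi (add_point t w) +
   \int[mu]_r ((next_density t r)%:E * future_mean (fun w => Psi (add_point t w)) (add_point r w) r) =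
   future_mean Psi (add_point t w) t)%E.
Proof.
move=> tT wt; rewrite future_mean_rec; congr (_ + _)%E; apply: eq_integral => r _.
rewrite /next_density; case: ifPn => [/andP[tr rT]|_]; last by rewrite !mul0e.
congr (_ * _)%E; rewrite future_mean_add ?(ltW tr)//.
by apply: future_mean_eqc; apply: add_pointC; rewrite lt_eqF.
Qed.

End one_functional.

(** The points to come are all after [s], so that only configurations with the
    same past enter the integrals. *)
Lemma future_part_local k (Psi Psi' : config T -> \bar R) w s : 0 <= s -> past w s ->
  (forall w', agree w s w' -> Psi w' = Psi' w') -> future_part k Psi w s = future_part k Psi' w s.
Proof.
elim: k w s => [|k IH] w s s0 ws h /=; first by rewrite h//; exact: agree_refl.
apply: eq_integral => t _; rewrite /next_density; case: ifPn => [/andP[st tT]|_]; last by rewrite !mul0e.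
congr (_ * _)%E; apply: IH; first exact: le_trans s0 (ltW st).
  exact: past_add ws _ _ _.
by move=> w' h'; apply: h; exact: agree_add h'.
Qed.

Lemma future_mean_local (Psi Psi' : config T -> \bar R) w s : 0 <= s -> past w s ->
  (forall w', agree w s w' -> Psi w' = Psi' w') -> future_mean Psi w s = future_mean Psi' w s.
Proof. by move=> s0 ws h; apply: eq_eseriesr => k _; exact: future_part_local. Qed.

Lemma future_part_le k (Psi Psi' : config T -> \bar R) w s :
  measurable_fun setT Psi -> measurable_fun setT Psi' ->
  (forall w, 0 <= Psi w)%E -> (forall w, Psi w <= Psi' w)%E ->
  (future_part k Psi w s <= future_part k Psi' w s)%E.
Proof.
move=> mP mP' P0 PP'; have P'0 w' : (0 <= Psi' w')%E by exact: le_trans (P0 _) (PP' _).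
elim: k w s => [|k IH] w s /=; first by rewrite lee_wpmul2l// lee_fin tail_ge0.
apply: ge0_le_integral => //.
- by move=> t _; rewrite mule_ge0 ?future_part_ge0// lee_fin next_density_ge0.
- exact: measurable_future_step.
- exact: measurable_future_step.
- by move=> t _; rewrite lee_wpmul2l ?lee_fin ?next_density_ge0.
Qed.

Lemma future_mean_le (Psi Psi' : config T -> \bar R) w s :
  measurable_fun setT Psi -> measurable_fun setT Psi' ->
  (forall w, 0 <= Psi w)%E -> (forall w, Psi w <= Psi' w)%E ->
  (future_mean Psi w s <= future_mean Psi' w s)%E.
Proof.
move=> mP mP' P0 PP'; apply: lee_nneseries => [k _ _|k _]; first exact: future_part_ge0.
exact: future_part_le.
Qed.

(** ** Total mass *)

Let one : config T -> \bar R := fun=> 1%E.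
Let mone : measurable_fun setT one. Proof. exact: measurable_cst. Qed.
Let S m w s : \bar R := (\sum_(0 <= k < m) future_part k one w s)%E.

Let Sm m w : measurable_fun setT (fun t : RR => S m (add_point t w) t).
Proof.
apply: emeasurable_sum => k; apply: measurable_future_part1 => //.
exact: measurable_add1.
Qed.

Let S0 m w s : (0 <= S m w s)%E.
Proof. by apply: sume_ge0 => k _; exact: future_part_ge0. Qed.

Let SS m w s : S m.+1 w s =
  ((tail f (T - s))%:E + \int[mu]_t ((next_density s t)%:E * S m (add_point t w) t))%E.
Proof.
rewrite /S big_nat_recl//= mule1; congr (_ + _)%E.
rewrite -ge0_integral_sum//; last 2 first.
- by move=> k; exact: measurable_future_step.
- by move=> k t _; rewrite mule_ge0 ?future_part_ge0// lee_fin next_density_ge0.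
apply: eq_integral => t _; rewrite ge0_sume_distrr// => k _; exact: future_part_ge0.
Qed.

Let S_le1 m w s : (S m w s <= 1)%E.
Proof.
elim: m w s => [|m IH] w s; first by rewrite /S big_geq// lee01.
rewrite SS -(next_density_mass s) addeC; apply: leeD => //.
apply: ge0_le_integral => //.
- by move=> t _; rewrite mule_ge0 ?S0// lee_fin next_density_ge0.
- by apply: emeasurable_funM; [exact: measurable_next_density2|exact: Sm].
- exact: measurable_next_density2.
- by move=> t _; rewrite -[leRHS]mule1 lee_wpmul2l ?lee_fin ?next_density_ge0.
Qed.

Lemma future_mean1_le1 w s : (future_mean one w s <= 1)%E.
Proof.
rewrite /future_mean; apply: lime_le; first by apply: is_cvg_nneseries => k _ _; exact: future_part_ge0.
by near=> m; exact: S_le1.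
Unshelve. all: by end_near. Qed.

Lemma next_density_mass_le s : 0 <= s -> s <= T ->
  (\int[mu]_r (next_density s r)%:E <= (1 - tail f T)%:E)%E.
Proof.
move=> s0 sT; have := next_density_mass s.
have : (\int[mu]_r (next_density s r)%:E)%E \is a fin_num.
  rewrite ge0_fin_numE; last by apply: integral_ge0 => t _; rewrite lee_fin next_density_ge0.
  apply: (@le_lt_trans _ _ 1%E); last exact: ltry.
  by rewrite -(next_density_mass s) leeDl// lee_fin tail_ge0.
move=> /fineK <- /eqP; rewrite -EFinD eqe => /eqP h.
rewrite lee_fin -h lerBrDr lerD2l tail_nincr//.
by rewrite gerBl.
Qed.

Let S_ge m w s : 0 <= s -> s <= T -> ((1 - (1 - tail f T) ^+ m)%:E <= S m w s)%E.
Proof.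
elim: m w s => [|m IH] w s s0 sT; first by rewrite expr0 subrr S0.
pose q := (1 - tail f T) ^+ m.
have q0 : 0 <= q by rewrite exprn_ge0// subr_ge0 tail_le1.
have q1 : q <= 1 by rewrite exprn_ile1// ?subr_ge0 ?tail_le1// gerBl tail_ge0.
have /leeD2l : ((1 - q)%:E * \int[mu]_t (next_density s t)%:E <=
   \int[mu]_t ((next_density s t)%:E * S m (add_point t w) t))%E.
  rewrite -ge0_integralZl_EFin//; last 3 first.
  - by move=> t _; rewrite lee_fin next_density_ge0.
  - exact: measurable_next_density2.
  - by rewrite subr_ge0.
  apply: ge0_le_integral => //.
  - by move=> t _; rewrite mule_ge0// lee_fin ?next_density_ge0// subr_ge0.
  - by apply: emeasurable_funM => //; exact: measurable_next_density2.
  - by apply: emeasurable_funM; [exact: measurable_next_density2|exact: Sm].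
  - move=> t _; rewrite muleC /next_density; case: ifPn => [/andP[st tT]|_]; last by rewrite !mul0e.
    by rewrite lee_wpmul2l ?lee_fin//; apply: IH => //; exact: le_trans s0 (ltW st).
move=> /(_ (tail f (T - s))%:E); rewrite -SS; apply: le_trans.
have := next_density_mass s; have := next_density_mass_le s0 sT.
have : (\int[mu]_r (next_density s r)%:E)%E \is a fin_num.
  rewrite ge0_fin_numE; last by apply: integral_ge0 => t _; rewrite lee_fin next_density_ge0.
  exact: le_lt_trans (next_density_mass_le s0 sT) (ltry _).
move=> /fineK <-; set K := fine _; rewrite lee_fin => K1 /eqP.
rewrite -EFinD eqe => /eqP h; rewrite -EFinM -EFinD lee_fin.
have -> : tail f (T - s) = 1 - K by lra.
rewrite exprS -/q; nra.
Qed.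

Hypothesis tailT : 0 < tail f T.

(** As each spacing exceeds [T] with probability [tail f T], the probability
    that [m] more arrivals occur before [T] is at most [(1 - tail f T) ^+ m]. *)
Lemma future_mean1 w s : 0 <= s -> s <= T -> future_mean one w s = 1%E.
Proof.
move=> s0 sT; apply/eqP; rewrite eq_le future_mean1_le1/=.
have c1 : (fun m => (1 - (1 - tail f T) ^+ m)%:E) @ \oo --> 1%E.
  apply: cvg_EFin; first by near=> m.
  rewrite -[X in _ --> X]subr0; apply: cvgB; first exact: cvg_cst.
  apply: cvg_expr; rewrite ger0_norm ?subr_ge0 ?tail_le1//.
  by rewrite gtrBl.
rewrite -(cvg_lim _ c1)//; apply: lee_lim.
- by apply/cvg_ex; exists 1%E.
- by apply: is_cvg_nneseries => k _ _; exact: future_part_ge0.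
- by near=> m; exact: S_ge.
Unshelve. all: by end_near. Qed.

End renewal_operator.

Arguments next_density {R} T f s t.

(** * The conditional variance of one step *)

Section step_variance.
Context {R : realType}.
Local Notation mu := (@lebesgue_measure R).
Local Notation RR := (measurableTypeR R).

Definition right_mass (psi : R -> R) (t : R) : R :=
  fine (\int[mu]_r (if (t < r)%R then psi r else 0)%:E)%E.

Section right_mass_lemmas.
Variable psi : R -> R.
Hypotheses (mpsi : measurable_fun setT psi) (psi0 : forall t, 0 <= psi t).
Hypothesis psioo : (\int[mu]_t (psi t)%:E < +oo)%E.

Let mcond (c : RR -> bool) : measurable_fun setT c ->
  measurable_fun setT (fun u : RR => (if c u then psi u else 0)%:E).
Proof. by move=> mc; apply/measurable_EFinP; exact: measurable_fun_ifT. Qed.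

Lemma right_massE t : (right_mass psi t)%:E = (\int[mu]_r (if (t < r)%R then psi r else 0)%R%:E)%E.
Proof.
rewrite fineK// ge0_fin_numE; last by apply: integral_ge0 => r _; rewrite lee_fin; case: ifP.
apply: le_lt_trans psioo; apply: ge0_le_integral => //.
- by move=> u _; rewrite lee_fin; case: ifP.
- by apply: mcond; exact: measurable_fun_ltr.
- exact/measurable_EFinP.
- by move=> u _; rewrite lee_fin; case: ifP.
Qed.

Lemma right_mass_ge0 t : 0 <= right_mass psi t.
Proof. by rewrite -lee_fin right_massE; apply: integral_ge0 => r _; rewrite lee_fin; case: ifP. Qed.

Lemma measurable_right_mass : measurable_fun setT (right_mass psi).
Proof.
apply/measurable_EFinP.
rewrite (_ : _ \o _ = fun t => \int[mu]_r (if (t < r)%R then psi r else 0)%R%:E)%E; last first.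
  by apply/funext => t /=; rewrite right_massE.
pose h (q : RR * RR) : \bar R := (if (q.1 < q.2)%R then psi q.2 else 0)%R%:E.
apply: (measurable_fun_fubini_tonelli_F (m2 := mu) h).
- apply/measurable_EFinP; apply: measurable_fun_ifT => //.
    by apply: measurable_fun_ltr; [exact: measurable_fst|exact: measurable_snd].
  exact: (measurableT_comp mpsi measurable_snd).
- by move=> q; rewrite lee_fin; case: ifP.
Qed.

(** Both orders of two points contribute equally to the square of the mass. *)
Lemma integral_right_mass :
  (\int[mu]_t (2 * (psi t * right_mass psi t))%:E = (\int[mu]_t (psi t)%:E) ^+ 2)%E.
Proof.
pose h (q : RR * RR) : \bar R := (if (q.1 < q.2)%R then psi q.1 * psi q.2 else 0)%R%:E.
have mh : measurable_fun setT h.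
  apply/measurable_EFinP; apply: measurable_fun_ifT => //.
    by apply: measurable_fun_ltr; [exact: measurable_fst|exact: measurable_snd].
  apply: measurable_funM; first exact: (measurableT_comp mpsi measurable_fst).
  exact: (measurableT_comp mpsi measurable_snd).
have h0 q : (0 <= h q)%E by rewrite lee_fin; case: ifP => // _; exact: mulr_ge0.
have mpE : measurable_fun setT (fun t => (psi t)%:E) by exact/measurable_EFinP.
have E1 : (\int[mu]_t (psi t * right_mass psi t)%:E = \int[mu]_t \int[mu]_r h (t, r))%E.
  apply: eq_integral => t _; rewrite EFinM right_massE -ge0_integralZl//; last 3 first.
  - by apply: mcond; exact: measurable_fun_ltr.
  - by move=> r _; rewrite lee_fin; case: ifP.
  - by rewrite lee_fin.
  by apply: eq_integral => r _; rewrite /h/= -EFinM; case: ifP => // _; rewrite mulr0.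
have E2 : (\int[mu]_t (psi t * right_mass psi t)%:E = \int[mu]_t \int[mu]_r h (r, t))%E.
  by rewrite E1; exact: (fubini_tonelli (m1 := mu) (m2 := mu) h).
have mF : measurable_fun setT (fun t : RR => \int[mu]_r h (t, r))%E.
  exact: (measurable_fun_fubini_tonelli_F (m2 := mu) h).
have mG : measurable_fun setT (fun t : RR => \int[mu]_r h (r, t))%E.
  exact: (measurable_fun_fubini_tonelli_G (m1 := mu) h).
have -> : (\int[mu]_t (2 * (psi t * right_mass psi t))%:E =
  \int[mu]_t (\int[mu]_r h (t, r) + \int[mu]_r h (r, t)))%E.
  rewrite ge0_integralD//; last 2 first.
  - by move=> t _; exact: integral_ge0.
  - by move=> t _; exact: integral_ge0.
  rewrite -E1 -E2 -ge0_integralD//; last 4 first.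
  - by move=> t _; rewrite lee_fin mulr_ge0// right_mass_ge0.
  - by apply/measurable_EFinP/measurable_funM => //; exact: measurable_right_mass.
  - by move=> t _; rewrite lee_fin mulr_ge0// right_mass_ge0.
  - by apply/measurable_EFinP/measurable_funM => //; exact: measurable_right_mass.
  by apply: eq_integral => t _; rewrite -EFinD; congr _%:E; rewrite mulr_natl mulr2n.
rewrite expe2 -ge0_integralZl//; last 2 first.
- by move=> t _; rewrite lee_fin.
- by apply: integral_ge0 => t _; rewrite lee_fin.
apply: eq_integral => t _.
rewrite muleC -ge0_integralZl//; last 2 first.
- by move=> r _; rewrite lee_fin.
- by rewrite lee_fin.
rewrite -ge0_integralD//; last 2 first.
- by apply: measurable_fun_pair2.
- by apply: measurable_fun_pair1.
apply: ae_eq_integral => //.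
- by apply: emeasurable_funD; [exact: measurable_fun_pair2|exact: measurable_fun_pair1].
- by apply: emeasurable_funM => //; exact: measurable_cst.
exists [set t]; split; [by []|exact: lebesgue_measure_set1|].
move=> r /= hr; apply: contrapT => /eqP rt; apply: hr => _.
by rewrite /h/=; case: ltgtP rt => //= _ _; rewrite ?adde0 ?add0e -EFinM// mulrC.
Qed.

End right_mass_lemmas.

Section abstract_step.
Variables (phi A : R -> R) (b : R).
Hypotheses (mphi : measurable_fun setT phi) (phi0 : forall t, 0 <= phi t).
Hypothesis phioo : (\int[mu]_t (phi t)%:E < +oo)%E.
Hypotheses (mA : measurable_fun setT A) (b0 : 0 < b).
Hypothesis A1 : forall t, A t <= 1.
Hypothesis A0 : forall t, phi t != 0 -> 0 < A t.
(** [A] is the survival function of [phi], through the derivative of [1 / A]. *)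
Hypothesis AE : forall t, phi t != 0 ->
  (\int[mu]_r (if (r < t)%R then phi r / A r ^+ 2 else 0)%:E = ((A t)^-1 - 1)%:E)%E.
Hypothesis AEoo : (\int[mu]_r (phi r / A r ^+ 2)%:E = (b^-1 - 1)%:E)%E.

Variables (g : R -> R) (B ginf : R).
Hypotheses (mg : measurable_fun setT g) (g0 : forall t, 0 <= g t) (gB : forall t, g t <= B).
Hypothesis ginf0 : 0 <= ginf.

Let psi t := phi t * g t.
Let mpsi : measurable_fun setT psi. Proof. exact: measurable_funM. Qed.
Let psi0 t : 0 <= psi t. Proof. exact: mulr_ge0. Qed.
Let phiE : measurable_fun setT (fun t => (phi t)%:E). Proof. exact/measurable_EFinP. Qed.
Let psioo : (\int[mu]_t (psi t)%:E < +oo)%E.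
Proof.
have B0 : 0 <= B by exact: le_trans (g0 0) (gB 0).
apply: (@le_lt_trans _ _ (B%:E * \int[mu]_t (phi t)%:E)%E); last by rewrite lte_mul_pinfty.
rewrite -ge0_integralZl_EFin//; last by move=> t _; rewrite lee_fin.
apply: ge0_le_integral => //.
- by move=> t _; rewrite lee_fin.
- exact/measurable_EFinP.
- by apply: emeasurable_funM => //; exact: measurable_cst.
- by move=> t _; rewrite -EFinM lee_fin /psi [leRHS]mulrC ler_wpM2l.
Qed.

Definition step_rest t := b * ginf + right_mass psi t.
Definition step_mean := b * ginf + fine (\int[mu]_t (psi t)%:E)%E.

Let h := b * ginf.
Let h0 : 0 <= h. Proof. by rewrite mulr_ge0// ltW. Qed.

Lemma measurable_step_rest : measurable_fun setT step_rest.
Proof. by apply: measurable_funD => //; exact: measurable_right_mass. Qed.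

Lemma step_rest_ge0 t : 0 <= step_rest t.
Proof. by rewrite addr_ge0// right_mass_ge0. Qed.

Let mH := measurable_step_rest.

Let fin_psi : (\int[mu]_t (psi t)%:E)%E = (fine (\int[mu]_t (psi t)%:E)%E)%:E.
Proof. by rewrite fineK// ge0_fin_numE//; apply: integral_ge0 => t _; rewrite lee_fin. Qed.

(** Up to sign, [2 * psi * step_rest] is the derivative of [step_rest ^ 2]. *)
Let H2tot : (\int[mu]_t (2 * (psi t * step_rest t))%:E + (h ^+ 2)%:E = (step_mean ^+ 2)%:E)%E.
Proof.
have -> : (\int[mu]_t (2 * (psi t * step_rest t))%:E =
   \int[mu]_t ((2 * h)%:E * (psi t)%:E + (2 * (psi t * right_mass psi t))%:E))%E.
  by apply: eq_integral => t _; rewrite -EFinM -EFinD /step_rest -/h; congr _%:E; ring.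
rewrite ge0_integralD//; last 4 first.
- by move=> t _; rewrite -EFinM lee_fin mulr_ge0// mulr_ge0.
- by apply: emeasurable_funM; [exact: measurable_cst|exact/measurable_EFinP].
- by move=> t _; rewrite lee_fin mulr_ge0// mulr_ge0// right_mass_ge0.
- by apply/measurable_EFinP; do 2 apply: measurable_funM => //; exact: measurable_right_mass.
rewrite integral_right_mass// ge0_integralZl_EFin//; last 3 first.
- by move=> t _; rewrite lee_fin.
- exact/measurable_EFinP.
- by rewrite mulr_ge0.
rewrite fin_psi -EFin_expe -EFinM -!EFinD; congr _%:E.
by rewrite /step_mean fin_psi/= -/h; ring.
Qed.

Let H2x x : (\int[mu]_t (if (x < t)%R then 2 * (psi t * step_rest t) else 0)%:E + (h ^+ 2)%:E
  = (step_rest x ^+ 2)%:E)%E.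
Proof.
pose px t := if x < t then psi t else 0.
have mpx : measurable_fun setT px.
  by apply: measurable_fun_ifT => //; exact: measurable_fun_ltr.
have px0 t : 0 <= px t by rewrite /px; case: ifP.
have Epx : (\int[mu]_t (px t)%:E = (right_mass psi x)%:E)%E by rewrite right_massE.
have pxoo : (\int[mu]_t (px t)%:E < +oo)%E by rewrite Epx ltry.
have -> : (\int[mu]_t (if (x < t)%R then 2 * (psi t * step_rest t) else 0)%:E =
   \int[mu]_t ((2 * h)%:E * (px t)%:E + (2 * (px t * right_mass px t))%:E))%E.
  apply: eq_integral => t _; rewrite -EFinM -EFinD; congr _%:E.
  rewrite /px; case: ifPn => xt; last by rewrite mul0r !mulr0 addr0.
  have -> : right_mass (fun t => if x < t then psi t else 0) t = right_mass psi t.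
    congr fine; apply: eq_integral => r _; case: ltP => // tr.
    by rewrite (lt_trans xt tr).
  by rewrite /step_rest -/h; ring.
rewrite ge0_integralD//; last 4 first.
- by move=> t _; rewrite -EFinM lee_fin mulr_ge0// mulr_ge0.
- by apply: emeasurable_funM; [exact: measurable_cst|exact/measurable_EFinP].
- by move=> t _; rewrite lee_fin mulr_ge0// mulr_ge0// right_mass_ge0.
- by apply/measurable_EFinP; do 2 apply: measurable_funM => //; exact: measurable_right_mass.
rewrite integral_right_mass// ge0_integralZl_EFin//; last 3 first.
- by move=> t _; rewrite lee_fin.
- exact/measurable_EFinP.
- by rewrite mulr_ge0.
rewrite Epx -EFin_expe -EFinM -!EFinD; congr _%:E.
by rewrite /step_rest -/h; ring.
Qed.

Let mAV : measurable_fun setT (fun t => (A t)^-1).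
Proof. exact: measurable_funV. Qed.

Definition step_rest_mean t := step_rest t / A t.

Lemma measurable_step_rest_mean : measurable_fun setT step_rest_mean.
Proof. exact: measurable_funM. Qed.

Let J := (\int[mu]_t (2 * (psi t * step_rest_mean t))%:E)%E.

Let phiA0 t : 0 <= phi t / A t ^+ 2.
Proof. by rewrite mulr_ge0// invr_ge0 sqr_ge0. Qed.

Let mphiA : measurable_fun setT (fun t => phi t / A t ^+ 2).
Proof.
apply: measurable_funM => //.
rewrite (_ : (fun _ => _) = fun t => (A t)^-1 ^+ 2); last by apply/funext => t; rewrite exprVn.
exact: measurable_funX.
Qed.

Let m2psiH : measurable_fun setT (fun t => 2 * (psi t * step_rest t)).
Proof. by do 2 apply: measurable_funM => //. Qed.

Let psiH0 t : 0 <= 2 * (psi t * step_rest t).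
Proof. by rewrite mulr_ge0// mulr_ge0// step_rest_ge0. Qed.

(** In [J], [1 / A] is written as the integral of its derivative, and the two
    integrals are exchanged. *)
Let JE : (J + (b * ginf ^+ 2)%:E = (step_mean ^+ 2)%:E + \int[mu]_t (phi t * step_rest_mean t ^+ 2)%:E)%E.
Proof.
pose k (q : RR * RR) : \bar R :=
  ((if (q.2 < q.1)%R then phi q.2 / A q.2 ^+ 2 else 0) * (2 * (psi q.1 * step_rest q.1)))%:E.
have mk : measurable_fun setT k.
  apply/measurable_EFinP; apply: measurable_funM.
    apply: measurable_fun_ifT => //.
      by apply: measurable_fun_ltr; [exact: measurable_snd|exact: measurable_fst].
    exact: (measurableT_comp mphiA measurable_snd).
  exact: (measurableT_comp m2psiH measurable_fst).
have k0 q : (0 <= k q)%E by rewrite lee_fin mulr_ge0//; case: ifP.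
have mkF : measurable_fun setT (fun t : RR => \int[mu]_r k (t, r))%E.
  exact: (measurable_fun_fubini_tonelli_F (m2 := mu) k).
have J1 : J = (\int[mu]_t ((2 * (psi t * step_rest t))%:E + \int[mu]_r k (t, r)))%E.
  apply: eq_integral => t _; have [p0|p0] := eqVneq (phi t) 0.
    rewrite integral0_eq; last by move=> r _; rewrite /k/= /psi p0 !(mul0r, mulr0).
    by rewrite /psi p0 !(mul0r, mulr0) adde0.
  have -> : (\int[mu]_r k (t, r) = (2 * (psi t * step_rest t))%:E * ((A t)^-1 - 1)%:E)%E.
    rewrite -AE// -ge0_integralZl//; last 3 first.
    - apply/measurable_EFinP; apply: measurable_fun_ifT => //; exact: measurable_fun_ltr.
    - by move=> r _; rewrite lee_fin; case: ifP.
    - by rewrite lee_fin.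
    by apply: eq_integral => r _; rewrite /k/= -EFinM mulrC.
  by rewrite -EFinM -EFinD /step_rest_mean; congr _%:E; ring.
have J2 : J = (\int[mu]_t (2 * (psi t * step_rest t))%:E + \int[mu]_r \int[mu]_t k (t, r))%E.
  rewrite -(fubini_tonelli (m1 := mu) (m2 := mu) k mk k0) J1.
  apply: ge0_integralD; first exact: measurableT.
  - by move=> t _; rewrite lee_fin; exact: psiH0.
  - by apply/measurable_EFinP; exact: m2psiH.
  - by move=> t _; apply: integral_ge0 => r _; exact: k0.
  - exact: mkF.
have E3 : (\int[mu]_r \int[mu]_t k (t, r) + (h ^+ 2 * (b^-1 - 1))%:E =
    \int[mu]_t (phi t * step_rest_mean t ^+ 2)%:E)%E.
  rewrite EFinM -AEoo -ge0_integralZl_EFin//; last 3 first.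
  - by move=> r _; rewrite lee_fin.
  - exact/measurable_EFinP.
  - exact: sqr_ge0.
  transitivity (\int[mu]_r (\int[mu]_t k (t, r) +
      (h ^+ 2)%:E * (phi r / A r ^+ 2)%:E))%E.
    apply/esym; apply: ge0_integralD; first exact: measurableT.
    - by move=> r _; apply: integral_ge0 => t _; exact: k0.
    - exact: (measurable_fun_fubini_tonelli_G (m1 := mu) k).
    - by move=> r _; rewrite mule_ge0// lee_fin// sqr_ge0.
    - by apply: emeasurable_funM; [exact: measurable_cst|exact/measurable_EFinP].
  apply: eq_integral => r _.
  have -> : (\int[mu]_t k (t, r) = (phi r / A r ^+ 2)%:E *
      \int[mu]_t (if (r < t)%R then 2 * (psi t * step_rest t) else 0)%:E)%E.
    rewrite -ge0_integralZl//; last 3 first.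
    - by apply/measurable_EFinP; apply: measurable_fun_ifT => //; exact: measurable_fun_ltr.
    - by move=> t _; rewrite lee_fin; case: ifP.
    - by rewrite lee_fin.
    apply: eq_integral => t _; rewrite /k/= -EFinM; congr _%:E.
    by case: ifP => _; rewrite ?mul0r ?mulr0.
  rewrite (muleC _ (phi r / A r ^+ 2)%:E) -ge0_muleDr; last 2 first.
  - by apply: integral_ge0 => t _; rewrite lee_fin; case: ifP.
  - by rewrite lee_fin sqr_ge0.
  by rewrite H2x -EFinM /step_rest_mean; congr _%:E; rewrite expr_div_n; ring.
rewrite -E3 J2 -H2tot.
have bb : b * ginf ^+ 2 = h ^+ 2 + h ^+ 2 * (b^-1 - 1).
  by rewrite /h; field; rewrite gt_eqF.
by rewrite bb EFinD addeACA.
Qed.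

(** For a variable that takes the value [g t] if a random time, with density
    [phi] and survival function [A], is [t], and the value [ginf] with the
    remaining mass [b]: its expectation is [step_mean], and [step_rest_mean t] is
    its expectation given that the time is after [t]. The two sides differ by the
    integral of [phi * step_rest_mean ^ 2 - 2 * phi * g * step_rest_mean], the
    derivative of [step_rest ^ 2 / A]. *)
Lemma step_variance :
  (\int[mu]_t (phi t * (g t - step_rest_mean t) ^+ 2)%:E + (step_mean ^+ 2)%:E =
   \int[mu]_t (phi t * g t ^+ 2)%:E + (b * ginf ^+ 2)%:E)%E.
Proof.
have mm := measurable_step_rest_mean.
have m0 t : phi t != 0 -> 0 <= step_rest_mean t.
  by move=> /A0 At; rewrite mulr_ge0 ?step_rest_ge0// invr_ge0 ltW.
have J0 t : 0 <= 2 * (psi t * step_rest_mean t).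
  rewrite mulr_ge0//; have [p0|/m0 mt] := eqVneq (phi t) 0; first by rewrite /psi p0 !mul0r.
  exact: mulr_ge0.
have E1 : (\int[mu]_t (phi t * (g t - step_rest_mean t) ^+ 2)%:E + J =
   \int[mu]_t (phi t * g t ^+ 2)%:E + \int[mu]_t (phi t * step_rest_mean t ^+ 2)%:E)%E.
  rewrite /J -!ge0_integralD//.
  - by apply: eq_integral => t _; rewrite -!EFinD /psi; congr _%:E; ring.
  - by move=> t _; rewrite lee_fin mulr_ge0// sqr_ge0.
  - by apply/measurable_EFinP; apply: measurable_funM => //; exact: measurable_funX.
  - by move=> t _; rewrite lee_fin mulr_ge0// sqr_ge0.
  - by apply/measurable_EFinP; apply: measurable_funM => //; exact: measurable_funX.
  - by move=> t _; rewrite lee_fin mulr_ge0// sqr_ge0.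
  - by apply/measurable_EFinP; apply: measurable_funM => //; apply: measurable_funX; exact: measurable_funB.
  - by move=> t _; rewrite lee_fin J0.
  - by apply/measurable_EFinP; do 2 apply: measurable_funM => //.
have Jfin : J \is a fin_num.
  rewrite ge0_fin_numE; last by apply: integral_ge0 => t _; rewrite lee_fin.
  apply: (@le_lt_trans _ _ (\int[mu]_t ((2 * step_mean * B)%:E * (phi t / A t ^+ 2)%:E))%E); last first.
    rewrite ge0_integralZl_EFin//.
    - by rewrite AEoo -EFinM ltry.
    - by move=> t _; rewrite lee_fin.
    - exact/measurable_EFinP.
    - rewrite mulr_ge0// ?(le_trans (g0 0) (gB 0))// mulr_ge0// addr_ge0//.
      by rewrite fine_ge0//; apply: integral_ge0 => t _; rewrite lee_fin.
  apply: ge0_le_integral => //.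
  - by move=> t _; rewrite lee_fin.
  - by apply/measurable_EFinP; do 2 apply: measurable_funM => //.
  - by apply: emeasurable_funM; [exact: measurable_cst|exact/measurable_EFinP].
  move=> t _; rewrite -EFinM lee_fin; have [p0|p0] := eqVneq (phi t) 0.
    by rewrite /psi p0 !(mul0r, mulr0).
  have At := A0 p0.
  have Ht : step_rest t <= step_mean.
    rewrite lerD2l -lee_fin right_massE// fineK; last first.
      by rewrite ge0_fin_numE//; apply: integral_ge0 => t' _; rewrite lee_fin.
    apply: ge0_le_integral => //.
    - by move=> r _; rewrite lee_fin; case: ifP.
    - by apply/measurable_EFinP; apply: measurable_fun_ifT => //; exact: measurable_fun_ltr.
    - exact/measurable_EFinP.
    - by move=> r _; rewrite lee_fin; case: ifP.
  rewrite /step_rest_mean /psi.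
  have -> : 2 * step_mean * B * (phi t / A t ^+ 2) = (2 * phi t / A t) * (B * step_mean / A t).
    by field; rewrite gt_eqF.
  have -> : 2 * (phi t * g t * (step_rest t / A t)) = (2 * phi t / A t) * (g t * step_rest t).
    by field; rewrite gt_eqF.
  rewrite ler_wpM2l//.
    by rewrite mulr_ge0 ?invr_ge0 ?(ltW At)// mulr_ge0.
  rewrite ler_pdivlMr//; apply: (@le_trans _ _ (g t * step_rest t)).
    by rewrite ler_piMr// mulr_ge0// step_rest_ge0.
  by apply: ler_pM => //; exact: step_rest_ge0.
apply: (@addIe_fin _ J) => //.
rewrite [LHS]addeAC E1 -[LHS]addeA.
rewrite (addeC (\int[mu]_t (phi t * step_rest_mean t ^+ 2)%:E)%E) -JE (addeC J).
by rewrite [LHS]addeA.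
Qed.

End abstract_step.
End step_variance.

(** * The survival function of the spacings *)

Section survival.
Context {R : realType} (T : R) (f : R -> R).
Local Notation mu := (@lebesgue_measure R).
Local Notation RR := (measurableTypeR R).

Hypothesis mf : measurable_fun setT f.
Hypothesis f0 : forall x, 0 <= f x.
Hypothesis fneg : forall x : R, x < 0 -> f x = 0.
Hypothesis f1 : (\int[mu]_x (f x)%:E = 1)%E.
Hypothesis cf : {within `[0, +oo[, continuous f}.
Hypothesis tailT : 0 < tail f T.

Let fint : mu.-integrable setT (EFin \o f).
Proof.
apply/integrableP; split; first exact/measurable_EFinP.
have -> : (\int[mu]_x `|(EFin \o f) x| = \int[mu]_x (f x)%:E)%E.
  by apply: eq_integral => x _ /=; rewrite ger0_norm.
by rewrite f1 ltry.
Qed.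

Let finti (i : interval R) : mu.-integrable [set` i] (EFin \o f).
Proof. by apply: integrableS fint. Qed.

Lemma tail_cdf x : tail f x = 1 - \int[mu]_(t in `[-1, x]) f t.
Proof.
apply: EFin_inj; rewrite EFinB [in RHS]fineK; last first.
  by apply: integrable_fin_num => //; apply: integrableS fint.
have h : ((tail f x)%:E + \int[mu]_(t in `[(-1)%R, x]) (f t)%:E = 1)%E.
  rewrite tailE// -f1 [X in (_ + X)%E]integral_mkcond -ge0_integralD//; last 4 first.
  - by move=> u _; rewrite lee_fin; case: ifP.
  - by apply/measurable_EFinP; apply: measurable_fun_ifT => //; exact: measurable_fun_ltr.
  - by move=> u _; rewrite erestrict_ge0// => y _; rewrite lee_fin.
  - by apply/(measurable_restrictT _ _).1 => //; apply: measurable_funTS; exact/measurable_EFinP.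
  apply: eq_integral => u _; rewrite patchE mem_setE in_itv/=.
  have [xu|ux] := ltP x u; first by rewrite andbF adde0.
  rewrite andbT add0e; case: leP => // u1.
  by rewrite fneg// (lt_trans u1)// oppr_lt0.
rewrite -h addeK//; apply: integrable_fin_num => //; exact: integrableS fint.
Qed.

Let cdf (x : R) := \int[mu]_(t in `[-1, x]) f t.

Let tailfE : tail f = fun x => 1 - cdf x.
Proof. by apply/funext => x; rewrite tail_cdf. Qed.

Let cf0 : forall x : R, 0 < x -> {for x, continuous f}.
Proof.
move: cf => /continuous_within_itvcyP[h _] x x0; apply: h.
by rewrite in_itv/= andbT.
Qed.

Lemma continuous_tail (x : R) : 0 <= x -> {for x, continuous (tail f)}.
Proof.
move=> x0; rewrite tailfE; apply: continuousB; first exact: cvg_cst.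
have x1 : -1 < x + 1 by lra.
have := @parameterized_integral_continuous R (-1) (x + 1) f (ltW x1).
move=> /(_ (finti _)).
move=> /(continuous_within_itvP _ x1)[h _ _]; apply: h.
by rewrite in_itv/= ltrDl ltr01 andbT (lt_le_trans _ x0)// oppr_lt0.
Qed.

Lemma is_derive_tail (x : R) : 0 < x -> is_derive x 1 (tail f) (- f x).
Proof.
move=> x0; rewrite tailfE.
have xx : x < x + 1 by rewrite ltrDl.
have x1 : -1 < x by rewrite (lt_trans _ x0)// oppr_lt0.
have [h1 h2] := @continuous_FTC1_closed R f (-1) x (x + 1) xx
   (finti _) x1 (cf0 x0).
have dF : is_derive x 1 cdf (f x).
  by constructor; [exact: h1|rewrite -derive1E; exact: h2].
rewrite -[X in is_derive _ _ _ X]add0r.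
exact: is_deriveB.
Qed.

Let tail_gt0 x : x <= T -> 0 < tail f x.
Proof. by move=> xT; apply: (lt_le_trans tailT); exact: tail_nincr. Qed.

(** The derivative of [1 / tail f] is [f / tail f ^+ 2]. *)
Lemma integral_inv_tail L : 0 < L -> L <= T ->
  (\int[mu]_(x in `[0%R, L]) (f x / tail f x ^+ 2)%:E = ((tail f L)^-1 - 1)%:E)%E.
Proof.
move=> L0 LT.
have tc x : 0 <= x -> x <= L -> {for x, continuous (fun x => (tail f x)^-1)}.
  move=> x0 xL; apply: continuousV; last exact: continuous_tail.
  by rewrite gt_eqF// tail_gt0// (le_trans xL).
have tc2 x : 0 <= x -> x <= L -> {for x, continuous (fun x => (tail f x ^+ 2)^-1)}.
  move=> x0 xL; apply: continuousV; first by rewrite expf_neq0// gt_eqF// tail_gt0// (le_trans xL).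
  exact: (continuousM (continuous_tail x0) (continuous_tail x0)).
have -> : (tail f L)^-1 - 1 = (tail f L)^-1 - (tail f 0)^-1 by rewrite (tail_le0 mf f0 fneg f1 (lexx 0)) invr1.
rewrite EFinB; apply: (@continuous_FTC2 R _ (fun x => (tail f x)^-1)) => //.
- apply/continuous_within_itvP => //; split.
  + move=> x; rewrite in_itv/= => /andP[x0 xL].
    apply: (@cvgM R R (nbhs x) _ f (fun x => (tail f x ^+ 2)^-1)); first exact: cf0.
    by apply: tc2; exact: ltW.
  + move: cf => /continuous_within_itvcyP[_ f00].
    apply: cvgM => //; apply: cvg_at_right_filter.
    by apply: tc2 => //; exact: ltW.
  + apply: cvg_at_left_filter; apply: (@cvgM R R (nbhs L) _ f (fun x => (tail f x ^+ 2)^-1)); first exact: cf0.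
    by apply: tc2 => //; exact: ltW.
- split.
  + move=> x; rewrite in_itv/= => /andP[x0 xL].
    apply: derivableV; first by rewrite gt_eqF// tail_gt0// (le_trans (ltW xL)).
    by have := is_derive_tail x0; case.
  + by apply: cvg_at_right_filter; apply: tc => //; exact: ltW.
  + by apply: cvg_at_left_filter; apply: tc => //; exact: ltW.
- move=> x; rewrite in_itv/= => /andP[x0 xL].
  have tn0 : tail f x != 0 by rewrite gt_eqF// tail_gt0// (le_trans (ltW xL)).
  rewrite derive1E; have D := is_deriveV tn0 (is_derive_tail x0).
  by rewrite (@derive_val _ _ _ _ _ _ _ D) scaleNr scalerN opprK /GRing.scale/= mulrC.
Qed.

Lemma next_density_inv_tail s t : 0 <= s -> s <= t -> t <= T ->
  (\int[mu]_r (if (r < t)%R then next_density T f s r / tail f (r - s) ^+ 2 else 0)%:E =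
   ((tail f (t - s))^-1 - 1)%:E)%E.
Proof.
move=> s0; rewrite le_eqVlt => /predU1P[-> tT|st tT].
  rewrite subrr (tail_le0 mf f0 fneg f1 (lexx 0)) invr1 subrr integral0_eq// => r _.
  by case: ifP => // rt; rewrite /next_density ltNge ltW// mul0r.
have ts0 : 0 < t - s by rewrite subr_gt0.
have tsT : t - s <= T by rewrite (le_trans _ tT)// gerBl.
rewrite -integral_inv_tail//.
have mg : measurable_fun setT (fun x : RR => f x / tail f x ^+ 2).
  apply: measurable_funM => //; apply: measurable_funV.
  by apply: measurable_funX; exact: measurable_tail.
pose g x := (if (0 < x < t - s)%R then f x / tail f x ^+ 2 else 0)%R%:E.
have mcond : measurable_fun setT (fun x : RR => 0 < x < t - s).
  by apply: measurable_and; exact: measurable_fun_ltr.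
transitivity (\int[mu]_r g (r - s)%R)%E.
  apply: eq_integral => r _; rewrite /g /next_density; congr _%:E.
  rewrite subr_gt0 ltrD2r; case: (ltP s r) => sr /=; last by rewrite mul0r; case: ifP.
  by case: (ltP r t) => // rt; rewrite (le_trans (ltW rt) tT).
rewrite ge0_integral_shift; last 2 first.
- by apply/measurable_EFinP; exact: measurable_fun_ifT.
- by move=> x; rewrite /g lee_fin; case: ifP => // _; rewrite mulr_ge0// invr_ge0 sqr_ge0.
rewrite -integral_itv_obnd_cbnd; last by apply: measurable_funTS; exact/measurable_EFinP.
rewrite -integral_itv_bndo_bndc; last by apply: measurable_funTS; exact/measurable_EFinP.
rewrite [RHS]integral_mkcond; apply: eq_integral => x _.
by rewrite patchE mem_setE in_itv/= /g; case: ifP.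
Qed.

Section next_density_step.
Variables (s : R) (g : R -> R) (B ginf : R).
Hypotheses (s0 : 0 <= s) (sT : s <= T).
Hypotheses (mg : measurable_fun setT g) (g0 : forall t, 0 <= g t) (gB : forall t, g t <= B).
Hypothesis ginf0 : 0 <= ginf.

Lemma next_density_step_variance :
  let m := step_rest_mean (next_density T f s) (fun t => tail f (t - s)) (tail f (T - s)) g ginf in
  (\int[mu]_t (next_density T f s t * (g t - m t) ^+ 2)%:E +
     ((step_mean (next_density T f s) (tail f (T - s)) g ginf) ^+ 2)%:E =
   \int[mu]_t (next_density T f s t * g t ^+ 2)%:E + (tail f (T - s) * ginf ^+ 2)%:E)%E.
Proof.
have k0 t : 0 <= next_density T f s t by exact: next_density_ge0.
have kn t : next_density T f s t != 0 -> s < t /\ t <= T.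
  by rewrite /next_density; case: ifP => [/andP[]//|]; rewrite eqxx.
have mk : measurable_fun setT (next_density T f s).
  by apply/measurable_EFinP; exact: measurable_next_density2.
have mA : measurable_fun setT (fun t : RR => tail f (t - s)).
  by apply: (measurableT_comp (measurable_tail mf f0 f1)); exact: measurable_funB.
have tT0 : 0 < tail f (T - s) by apply: tail_gt0; rewrite gerBl.
apply: (@step_variance _ _ _ _ mk k0 _ mA tT0 _ _ _ _ g B ginf mg g0 gB ginf0).
- apply: (@le_lt_trans _ _ (1 - tail f T)%:E); last exact: ltry.
  exact: next_density_mass_le.
- by move=> t; exact: tail_le1.
- by move=> t /kn[st tT]; apply: tail_gt0; rewrite (le_trans _ tT)// gerBl.
- by move=> t /kn[st tT]; apply: next_density_inv_tail => //; exact: ltW.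
- rewrite -(next_density_inv_tail s0 sT (lexx T)).
  have [N [mN N0 sN]] : {ae mu, forall u, u != T}.
    exists [set T]; split; [by []|exact: lebesgue_measure_set1|].
    by move=> u /= /negP; rewrite negbK => /eqP.
  have mkA : measurable_fun setT (fun r => next_density T f s r / tail f (r - s) ^+ 2).
    by apply: measurable_funM => //; apply: measurable_funV; exact: measurable_funX.
  apply: ae_eq_integral => //.
  + exact/measurable_EFinP.
  + by apply/measurable_EFinP; apply: measurable_fun_ifT => //; exact: measurable_fun_ltr.
  + exists N; split => // u /= h; apply: sN => /= uT; apply: h => _.
    case: ltP => // Tu; rewrite /next_density [u <= T]leNgt.
    by rewrite (_ : T < u) ?andbF ?mul0r// lt_neqAle eq_sym uT.
Qed.

End next_density_step.
End survival.

(** * The renewal chain *)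

Section next_density_shift.
Context {R : realType} {T : R} (f : R -> R).
Local Notation mu := (@lebesgue_measure R).
Local Notation RR := (measurableTypeR R).
Hypothesis mf : measurable_fun setT f.
Hypothesis f0 : forall x, 0 <= f x.
Hypothesis fneg : forall x : R, x < 0 -> f x = 0.

Lemma integral_next_density (s : R) (g : R -> \bar R) :
  measurable_fun setT g -> (forall t, 0 <= g t)%E ->
  (\int[mu]_x ((f x)%:E * (if (s + x <= T)%R then g (s + x)%R else 0)) =
   \int[mu]_t ((next_density T f s t)%:E * g t))%E.
Proof.
move=> mg g0.
have mc : measurable_fun setT (fun t : RR => if (t <= T)%R then g t else 0%E).
  by apply: measurable_fun_ifT => //; exact: measurable_fun_ler.
pose h (x : R) := ((f x)%:E * (if (s + x <= T)%R then g (s + x)%R else 0))%E.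
have mh : measurable_fun setT h.
  apply: emeasurable_funM; first exact/measurable_EFinP.
  by apply: (measurableT_comp mc (g := fun x : RR => s + x)); exact: measurable_funD.
have h0 x : (0 <= h x)%E.
  by rewrite /h mule_ge0 ?lee_fin//; case: ifP.
rewrite -[LHS]/(\int[mu]_x h x)%E -(ge0_integral_shift s mh h0).
have ms : measurable_fun setT (fun t : RR => t - s) by exact: measurable_funB.
apply: ae_eq_integral => //.
- exact: (measurableT_comp mh ms).
- by apply: emeasurable_funM => //; exact: measurable_next_density2.
exists [set s]; split; [by []|exact: lebesgue_measure_set1|].
move=> t /= ht; apply: contrapT => /eqP ts; apply: ht => _.
rewrite /h /next_density (addrC s) subrK; case: (leP t T) => tT; last by rewrite andbF mule0 mul0e.
rewrite andbT; case: (ltgtP s t) ts => // ts _.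
by rewrite fneg ?subr_lt0// !mul0e.
Qed.

End next_density_shift.

Section renewal_chain.
Context {R : realType} {T : R} (f : R -> R).
Local Notation mu := (@lebesgue_measure R).
Local Notation RR := (measurableTypeR R).

Hypothesis mf : measurable_fun setT f.
Hypothesis f0 : forall x, 0 <= f x.
Hypothesis fneg : forall x : R, x < 0 -> f x = 0.
Hypothesis f1 : (\int[mu]_x (f x)%:E = 1)%E.

Context d (Omega : measurableType d) (P : probability Omega R).
Variables (N : {RV P >-> config T}) (tau : nat -> {RV P >-> R}).
Hypothesis indep : mutually_independent tau.
Hypothesis dens : forall i A, measurable A ->
  distribution P (tau i) A = (\int[mu]_(u in A) (f u)%:E)%E.

Definition arrival (n : nat) (o : Omega) : R := \sum_(i < n) tau i o.

Definition no_points : config T := Config (is_config0 T).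

Definition chain_next (y : (config T * R) * R) : config T * R :=
  (add_point (y.1.2 + y.2) y.1.1, y.1.2 + y.2).

(** The past at the [n]-th arrival, with the time of that arrival: a Markov
    chain whose last state before [T] contains the whole configuration. *)
Fixpoint chain (n : nat) (o : Omega) : config T * R :=
  if n is k.+1 then chain_next (chain k o, tau k o) else (no_points, 0).

Lemma chain_arrival n o : (chain n o).2 = arrival n o.
Proof.
elim: n => [|n IH] /=; first by rewrite /arrival big_ord0.
by rewrite IH /arrival big_ord_recr.
Qed.

Lemma measurable_chain_next : measurable_fun setT chain_next.
Proof.
have m12 : measurable_fun setT (fun y : (config T * R) * R => y.1.2 + y.2).
  apply: measurable_funD; last exact: measurable_snd.
  exact: (measurableT_comp measurable_snd measurable_fst).
apply: measurable_fun_pair => //.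
apply: (measurableT_comp measurable_add_point
  (g := fun y : (config T * R) * R => (y.1.2 + y.2 : RR, y.1.1))).
apply: measurable_fun_pair => //.
exact: (measurableT_comp measurable_fst measurable_fst).
Qed.

Lemma measurable_chain n : measurable_fun setT (chain n).
Proof.
elim: n => [|n IH] /=; first exact: measurable_cst.
apply: (measurableT_comp measurable_chain_next (g := fun o => (chain n o, tau n o))).
by apply: measurable_fun_pair => //; exact: measurable_funP.
Qed.

Lemma measurable_chain1 n : measurable_fun setT (fun o => (chain n o).1).
Proof. exact: (measurableT_comp measurable_fst (measurable_chain n)). Qed.

Lemma measurable_chain2 n : measurable_fun setT (fun o => (chain n o).2).
Proof. exact: (measurableT_comp measurable_snd (measurable_chain n)). Qed.

(** The states up to an arrival are functions of the spacings before it. *)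
Lemma indep_chain_from n k :
  indep_future tau (fun o => (chain n o, chain (n + k) o)) (n + k).
Proof.
have base m : indep_future tau (chain m) m.
  elim: m => [|m IH]; first exact: indep_future_cst.
  exact: (indep_future_step indep (measurable_chain m) IH measurable_chain_next).
elim: k => [|k IH].
  rewrite addn0.
  apply: (@indep_future_comp _ _ _ _ _ _ _ _ _ (chain n) (fun z => (z, z))) => //.
  by apply: measurable_fun_pair.
rewrite addnS.
have mm : measurable_fun setT (fun o => (chain n o, chain (n + k) o)).
  by apply: measurable_fun_pair; exact: measurable_chain.
pose phi (y : ((config T * R) * (config T * R)) * R) :=
  (y.1.1, chain_next (y.1.2, y.2)).
have mphi : measurable_fun setT phi.
  apply: measurable_fun_pair.
    exact: (measurableT_comp measurable_fst measurable_fst).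
  apply: (measurableT_comp measurable_chain_next
    (g := fun y : ((config T * R) * (config T * R)) * R => (y.1.2, y.2))).
  apply: measurable_fun_pair; last exact: measurable_snd.
  exact: (measurableT_comp measurable_snd measurable_fst).
exact: (indep_future_step indep mm IH mphi).
Qed.

Let expectation_step n k (h : (((config T * R) * (config T * R)) * R) -> \bar R) :
  measurable_fun setT h -> (forall x, 0 <= h x)%E ->
  (\int[P]_o h ((chain n o, chain (n + k) o), tau (n + k) o) =
   \int[P]_o \int[mu]_x ((f x)%:E * h ((chain n o, chain (n + k) o), x)))%E.
Proof.
move=> mh h0.
have mm : measurable_fun setT (fun o => (chain n o, chain (n + k) o)).
  by apply: measurable_fun_pair; exact: measurable_chain.
rewrite (indep_future_expectation mm (@indep_chain_from n k) mh h0).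
apply: eq_integral => o _.
apply: (ge0_integral_distribution_density mf f0 (@dens (n + k)%N)) => //.
exact: (measurable_fun_pair2 _ mh).
Qed.

(** The functional also sees the state at an earlier arrival, which is where
    one conditions in the Markov property. *)
Lemma chain_step n k (Psi : (config T * R) * (config T * R) -> \bar R) :
  measurable_fun setT Psi -> (forall x, 0 <= Psi x)%E ->
  (\int[P]_o (if ((chain (n + k).+1 o).2 <= T)%R then Psi (chain n o, chain (n + k).+1 o) else 0) =
   \int[P]_o (if ((chain (n + k) o).2 <= T)%R then
      \int[mu]_t ((next_density T f (chain (n + k) o).2 t)%:E *
        Psi (chain n o, (add_point t (chain (n + k) o).1, t))) else 0))%E.
Proof.
move=> mPsi Psi0.
pose h (y : ((config T * R) * (config T * R)) * R) : \bar R :=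
  if (y.1.2.2 + y.2 <= T)%R then Psi (y.1.1, chain_next (y.1.2, y.2)) else 0%E.
have mh : measurable_fun setT h.
  apply: measurable_fun_ifT => //.
    apply: measurable_fun_ler => //; apply: measurable_funD; last exact: measurable_snd.
    apply: (measurableT_comp measurable_snd).
    exact: (measurableT_comp measurable_snd measurable_fst).
  apply: (measurableT_comp mPsi (g := fun y : ((config T * R) * (config T * R)) * R =>
    (y.1.1, chain_next (y.1.2, y.2)))).
  apply: measurable_fun_pair; first exact: (measurableT_comp measurable_fst measurable_fst).
  apply: (measurableT_comp measurable_chain_next
    (g := fun y : ((config T * R) * (config T * R)) * R => (y.1.2, y.2))).
  apply: measurable_fun_pair; last exact: measurable_snd.
  exact: (measurableT_comp measurable_snd measurable_fst).
have h0 y : (0 <= h y)%E by rewrite /h; case: ifP.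
rewrite -[LHS]/(\int[P]_o h ((chain n o, chain (n + k) o), tau (n + k) o))%E.
rewrite expectation_step//; apply: eq_integral => o _.
set z := chain (n + k) o; set z0 := chain n o.
have -> : (if (z.2 <= T)%R then \int[mu]_t ((next_density T f z.2 t)%:E * Psi (z0, (add_point t z.1, t))) else 0)%E =
  (\int[mu]_t ((next_density T f z.2 t)%:E * Psi (z0, (add_point t z.1, t))))%E.
  case: ifPn => //; rewrite -ltNge => zT.
  rewrite integral0_eq// => t _; rewrite /next_density; case: ifPn => [/andP[zt tT]|_]; last by rewrite mul0e.
  by move: (lt_trans zT (lt_le_trans zt tT)); rewrite ltxx.
rewrite -(integral_next_density mf f0 fneg)//.
apply: (measurableT_comp mPsi (g := fun t : RR => (z0, (add_point t z.1, t)))).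
apply: measurable_fun_pair => //; apply: measurable_fun_pair => //.
exact: measurable_add1.
Qed.

(** The configuration is complete when the next spacing leads beyond [T]. *)
Lemma chain_stop n k (Psi : (config T * R) * config T -> \bar R) :
  measurable_fun setT Psi -> (forall x, 0 <= Psi x)%E ->
  (\int[P]_o (if ((chain (n + k) o).2 <= T)%R && (T < (chain (n + k).+1 o).2)%R
      then Psi (chain n o, (chain (n + k) o).1) else 0) =
   \int[P]_o (if ((chain (n + k) o).2 <= T)%R then
      (tail f (T - (chain (n + k) o).2))%:E * Psi (chain n o, (chain (n + k) o).1) else 0))%E.
Proof.
move=> mPsi Psi0.
pose h (y : ((config T * R) * (config T * R)) * R) : \bar R :=
  if (y.1.2.2 <= T)%R && (T < y.1.2.2 + y.2)%R then Psi (y.1.1, y.1.2.1) else 0%E.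
have m122 : measurable_fun setT (fun y : ((config T * R) * (config T * R)) * R => y.1.2.2).
  apply: (measurableT_comp measurable_snd).
  exact: (measurableT_comp measurable_snd measurable_fst).
have mh : measurable_fun setT h.
  apply: measurable_fun_ifT => //.
    apply: measurable_and; first exact: measurable_fun_ler.
    apply: measurable_fun_ltr => //; apply: measurable_funD => //; exact: measurable_snd.
  apply: (measurableT_comp mPsi (g := fun y : ((config T * R) * (config T * R)) * R =>
    (y.1.1, y.1.2.1))).
  apply: measurable_fun_pair; first exact: (measurableT_comp measurable_fst measurable_fst).
  apply: (measurableT_comp measurable_fst).
  exact: (measurableT_comp measurable_snd measurable_fst).
have h0 y : (0 <= h y)%E by rewrite /h; case: ifP.
rewrite -[LHS]/(\int[P]_o h ((chain n o, chain (n + k) o), tau (n + k) o))%E.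
rewrite expectation_step//; apply: eq_integral => o _.
rewrite /h/=; case: ifPn => zT; last first.
  by rewrite integral0_eq// => x _; rewrite mule0.
rewrite (tailE mf f0 f1) -ge0_integralZr//.
- apply: eq_integral => x _; rewrite ltrBlDl /=.
  by case: ifP => _; rewrite ?mule0 ?mul0e.
- apply/measurable_EFinP; apply: measurable_fun_ifT => //; exact: measurable_fun_ltr.
- by move=> x _; rewrite lee_fin; case: ifP.
Qed.

Lemma chain_future_part n (Phi : (config T * R) * config T -> \bar R) k m :
  measurable_fun setT Phi -> (forall x, 0 <= Phi x)%E ->
  (\int[P]_o (if ((chain (n + m) o).2 <= T)%R then
       future_part f k (fun w => Phi (chain n o, w)) (chain (n + m) o).1 (chain (n + m) o).2 else 0) =
   \int[P]_o (if ((chain (n + m + k) o).2 <= T)%R then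
      (tail f (T - (chain (n + m + k) o).2))%:E * Phi (chain n o, (chain (n + m + k) o).1) else 0))%E.
Proof.
move=> mPhi Phi0; elim: k m => [|k IH] m; first by rewrite addn0.
rewrite -addSnnS -addnS -IH addnS.
pose Psi (y : (config T * R) * (config T * R)) :=
  future_part f k (fun w => Phi (y.1, w)) y.2.1 y.2.2.
rewrite -[RHS]/(\int[P]_o (if ((chain (n + m).+1 o).2 <= T)%R then
  Psi (chain n o, chain (n + m).+1 o) else 0))%E.
rewrite chain_step//.
- exact: measurable_future_part.
- by move=> y; exact: future_part_ge0.
Qed.

(** ** Paths *)

Hypothesis NE : {ae P, forall o : Omega, forall A : set RR, measurable A ->
  N o A = (\sum_(1 <= n <oo) \d_(arrival n o) (A `&` `[0%R, T]))%E}.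

Definition good_path o := (forall i, 0 <= tau i o) /\
  (forall A : set RR, measurable A ->
    N o A = (\sum_(1 <= n <oo) \d_(arrival n o) (A `&` `[0%R, T]))%E).

Lemma ae_good_path : {ae P, forall o, good_path o}.
Proof.
have tau0 : {ae P, forall o, forall i, 0 <= tau i o}.
  apply: ae_foralln => i.
  exists (tau i @^-1` `]-oo, 0%R[); split.
  - by rewrite -[X in measurable X]setTI; exact: measurable_funP.
  - rewrite -[LHS]/(distribution P (tau i) `]-oo, 0%R[%classic) dens//.
    by rewrite integral0_eq// => x /=; rewrite in_itv/= => x0; rewrite fneg.
  - by move=> o /= /negP; rewrite -ltNge in_itv.
by apply: filterS2 tau0 NE => o h1 h2; split.
Qed.

End renewal_chain.

Arguments chain {R} T {d Omega P} tau n o.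

(** * Paths of the renewal process *)

Section paths.
Context {R : realType} {T : R}.
Local Notation mu := (@lebesgue_measure R).
Local Notation RR := (measurableTypeR R).
Hypothesis T0 : 0 <= T.

Context d (Omega : measurableType d) (P : probability Omega R).
Variables (N : {RV P >-> config T}) (tau : nat -> {RV P >-> R}).
Variable o : Omega.
Hypothesis good : good_path N tau o.

Local Notation S n := (arrival tau n o).

Lemma arrival0 : S 0 = 0. Proof. by rewrite /arrival big_ord0. Qed.

Lemma arrivalS n : S n.+1 = S n + tau n o.
Proof. by rewrite /arrival big_ord_recr. Qed.

Lemma arrival_le m n : (m <= n)%N -> S m <= S n.
Proof.
move=> /subnK <-; elim: (n - m)%N => [//|k IH].
by rewrite addSn arrivalS (le_trans IH)// lerDl; have [h _] := good; exact: h.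
Qed.

Lemma arrival_ge0 n : 0 <= S n.
Proof. by rewrite -arrival0 arrival_le. Qed.

Definition arrival_count (A : set R) n : nat := \sum_(i < n) (S i.+1 \in A).

Local Notation cnt := arrival_count.

Lemma arrival_countS A n : cnt A n.+1 = (cnt A n + (S n.+1 \in A))%N.
Proof. by rewrite /arrival_count big_ord_recr. Qed.

Lemma arrival_count_le A m n : (m <= n)%N -> (cnt A m <= cnt A n)%N.
Proof.
move=> /subnK <-; elim: (n - m)%N => [//|k IH].
by rewrite addSn arrival_countS (leq_trans IH)// leq_addr.
Qed.

Lemma arrival_count_max A n : (cnt A n <= n)%N.
Proof.
elim: n => [|n IH]; first by rewrite /arrival_count big_ord0.
by rewrite arrival_countS -addn1 leq_add//; case: (_ \in _).
Qed.

(** Otherwise infinitely many points, counted with multiplicity, would lie in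
    [0, T]. *)
Lemma arrival_unbounded : exists n, T < S n.
Proof.
apply: contrapT => /forallNP h.
have {}h n : S n <= T by rewrite leNgt; apply/negP; exact: h.
have [_ NE] := good.
have [k Nk] := config_nat (N o) (measurable_itv `[0%R, T]).
have : (\sum_(1 <= n < k.+2) \d_(S n) (`[0%R, T]%classic `&` `[0%R, T]%classic) <= (k%:R%:E : \bar R))%E.
  rewrite -Nk NE; last exact: measurable_itv.
  by apply: nneseries_lim_ge => n _ _; rewrite diracE lee_fin.
rewrite (eq_bigr (fun=> 1%E)); last first.
  by move=> n _; rewrite setIid diracE mem_set//= in_itv/= arrival_ge0 h.
by rewrite sumEFin sumr_const_nat lee_fin ler_nat subn1 ltnn.
Qed.

Lemma last_arrival : exists m, [/\ S m <= T, T < S m.+1 &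
  forall A : set RR, measurable A -> N o A = (cnt A m)%:R%:E].
Proof.
have ex : exists n, T < S n by exact: arrival_unbounded.
case: (ex_minnP ex) => -[|m] mT mmin; first by move: mT; rewrite arrival0 ltNge T0.
have SmT : S m <= T by rewrite leNgt; apply/negP => /mmin; rewrite ltnn.
exists m; split => // A mA.
have [_ NE] := good.
rewrite NE// (@nneseries_split _ _ 1 m); last by move=> n _; rewrite diracE lee_fin.
rewrite [X in (_ + X)%E]eseries0 ?adde0; last first.
  move=> n; rewrite add1n => mn _; rewrite diracE memNset// => -[_ /=].
  rewrite in_itv/= => /andP[_ nT].
  by move: (lt_le_trans mT (le_trans (arrival_le mn) nT)); rewrite ltxx.
rewrite add1n big_add1/= big_mkord /arrival_count natr_sum -sumEFin.
apply: eq_bigr => i _; rewrite diracE; congr ((nat_of_bool _)%:R%:E).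
have iT : S i.+1 <= T by rewrite (le_trans _ SmT)// arrival_le.
apply/idP/idP; rewrite !inE /=; first by case.
by move=> ?; split => //; rewrite in_itv/= arrival_ge0 iT.
Qed.

Lemma arrival_le_last m n : S m <= T -> T < S m.+1 -> (S n <= T) = (n <= m)%N.
Proof.
move=> mT Tm; apply/idP/idP => [nT|nm]; last by rewrite (le_trans _ mT)// arrival_le.
rewrite leqNgt; apply/negP => /arrival_le h.
by move: (lt_le_trans Tm (le_trans h nT)); rewrite ltxx.
Qed.

(** Simultaneous arrivals would make a double point, or an atom at 0. *)
Lemma arrival_lt i j : (i < j)%N -> S j <= T -> S i < S j.
Proof.
move=> ij jT; rewrite lt_neqAle arrival_le ?(ltnW ij)// andbT; apply/eqP => Sij.
have [m [mT Tm NE]] := last_arrival.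
have jm : (j <= m)%N by rewrite -(arrival_le_last _ mT Tm).
have mS : measurable ([set S j] : set RR) by exact: measurable_set1.
have cj : (cnt [set S j] i < cnt [set S j] j)%N.
  case: j ij jT Sij jm mS => // j; rewrite ltnS => ij jT Sij jm mS.
  by rewrite arrival_countS mem_set// addn1 ltnS arrival_count_le.
case: i ij Sij cj => [|i] ij Sij cj.
  have := config_atom0 (configP (N o)); rewrite -arrival0 Sij NE// => -[] /eqP.
  rewrite pnatr_eq0 => /eqP h.
  by move: (leq_trans cj (arrival_count_le _ jm)); rewrite h ltn0.
have := config_simple (configP (N o)) (S j); rewrite NE// lee_fin -[1]/(1%:R) ler_nat => h.
have ci : (0 < cnt [set S j] i.+1)%N.
  by rewrite arrival_countS Sij mem_set// addn1.
by move: (leq_trans (leq_ltn_trans ci cj) (leq_trans (arrival_count_le _ jm) h)).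
Qed.

Lemma chain_count n (A : set RR) : measurable A -> S n <= T ->
  (chain T tau n o).1 A = (cnt A n)%:R%:E.
Proof.
elim: n A => [|n IH] A mA nT; first by rewrite /arrival_count big_ord0.
have nT' : S n <= T by rewrite (le_trans _ nT)// arrival_le.
have Sn0 : 0 < S n.+1 by rewrite -arrival0 arrival_lt.
have E : (chain T tau n o).2 + tau n o = S n.+1 by rewrite chain_arrival arrivalS.
rewrite /= E add_pointE.
- by rewrite IH// arrival_countS natrD EFinD.
- by rewrite Sn0.
rewrite IH// (_ : cnt _ _ = 0%N)//; apply: big1 => i _; rewrite memNset//= => h.
by have := arrival_lt (ltn_ord i : (i.+1 < n.+1)%N) nT; rewrite h ltxx.
Qed.

Lemma chain_last m : S m <= T -> T < S m.+1 -> eqc (N o) (chain T tau m o).1.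
Proof.
move=> mT Tm A mA; have [m' [m'T Tm' NE]] := last_arrival.
rewrite NE// chain_count//.
have : (m <= m')%N by rewrite -(arrival_le_last _ m'T Tm').
have : (m' <= m)%N by rewrite -(arrival_le_last _ mT Tm).
by move=> h1 h2; rewrite (anti_leq (introT andP (conj h1 h2))).
Qed.

Lemma npoints_arrival n t : t <= T -> npoints (N o) t = n -> S n <= T.
Proof.
move=> tT Nn; have [m [mT Tm NE]] := last_arrival.
rewrite (arrival_le_last _ mT Tm) -Nn -(ler_nat R) -lee_fin -npointsP NE//.
by rewrite lee_fin ler_nat arrival_count_max.
Qed.

(** From the [n]-th arrival on, nothing falls into [0, t]. *)
Lemma arrival_count_lt n t m : 0 <= t -> t < S n -> (cnt `[0%R, t]%classic m < n)%N.
Proof.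
move=> t0; elim: m => [|m IH] tn.
  by rewrite /arrival_count big_ord0; case: n tn => //; rewrite arrival0 ltNge t0.
have [nm|mn] := leqP n m.+1.
  rewrite arrival_countS memNset ?addn0 ?IH//= in_itv/= => /andP[_ mt].
  by move: (lt_le_trans tn (arrival_le nm)); rewrite ltNge mt.
exact: leq_ltn_trans (arrival_count_max _ _) mn.
Qed.

Lemma arrival_le_time t : 0 <= t -> 0 <= S (npoints (N o) t) <= t.
Proof.
move=> t0; rewrite arrival_ge0 leNgt; apply/negP => h.
have [m [_ _ NEm]] := last_arrival.
have := arrival_count_lt m t0 h; rewrite ltnNge => /negP; apply.
by rewrite -(ler_nat R) -lee_fin -npointsP NEm//; exact: measurable_itv.
Qed.

End paths.

Section states.
Context {R : realType} {T : R}.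
Local Notation RR := (measurableTypeR R).

(** What the states of the chain up to [T] look like; the initial one is the
    only one whose time is not a point. *)
Definition state (n : nat) (w : config T) (s : R) := [/\ 0 <= s <= T, past w s,
  s = 0 \/ w [set s] = 1%E & npoints w s = n].

Hypothesis T0 : 0 <= T.
Context d (Omega : measurableType d) (P : probability Omega R).
Variables (N : {RV P >-> config T}) (tau : nat -> {RV P >-> R}).

Lemma chain_state o n : good_path N tau o -> (chain T tau n o).2 <= T ->
  state n (chain T tau n o).1 (chain T tau n o).2.
Proof.
move=> good; rewrite chain_arrival => nT; have S0 := arrival_ge0 good n.
split; first by rewrite S0.
- rewrite /past (chain_count T0 good)//; rewrite (_ : arrival_count _ _ _ _ = 0%N)//.
  apply: big1 => i _; rewrite memNset//= in_itv/= andbT => h.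
  by have := lt_le_trans h (arrival_le good (ltn_ord i)); rewrite ltxx.
- case: n nT S0 => [|n] nT S0; first by left; rewrite arrival0.
  right; apply/eqP; rewrite eq_le (config_simple (configP _)) andTb.
  rewrite (chain_count T0 good)// arrival_countS mem_set// addn1 lee_fin ler1n//.
- apply/eqP; rewrite -(eqr_nat R); apply/eqP; apply: EFin_inj; rewrite -npointsP.
  rewrite (chain_count T0 good)//; congr (_%:R%:E).
  rewrite -[RHS](card_ord n) -sum1_card; apply: eq_bigr => i _.
  by rewrite mem_set//= in_itv/= (arrival_ge0 good)//= (arrival_le good).
Qed.

Lemma integral_path o (y : R -> \bar R) : good_path N tau o ->
  measurable_fun setT y -> (forall t, 0 <= y t)%E ->
  (\int[N o]_(t in `[0%R, T]) y t =
   \sum_(n <oo) (if ((chain T tau n.+1 o).2 <= T)%R then y (chain T tau n.+1 o).2 else 0))%E.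
Proof.
move=> good my y0; have [m [mT Tm NE]] := last_arrival T0 good.
have my' : measurable_fun `[0%R, T]%classic (y : RR -> \bar R) by exact: measurable_funTS.
pose dl i : {measure set RR -> \bar R} := @dirac _ RR (arrival tau i.+1 o) R.
rewrite (eq_measure_integral (msum dl m)); last first.
  move=> A mA _; rewrite NE// /msum /arrival_count natr_sum -sumEFin.
  by apply: eq_bigr => i _; apply/esym; exact: diracE.
rewrite ge0_integral_measure_sum//.
rewrite (@nneseries_split _ _ 0 m); last by move=> n _; case: ifP.
rewrite [X in (_ = _ + X)%E]eseries0 ?adde0; last first.
  move=> n; rewrite add0n => mn _; rewrite chain_arrival leNgt ifN// negbK.
  by apply: (lt_le_trans Tm); exact: arrival_le good _ _ _.
rewrite add0n big_mkord; apply: eq_bigr => i _.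
have iT : arrival tau i.+1 o <= T by rewrite (le_trans _ mT)// (arrival_le good).
rewrite chain_arrival iT /dl integral_dirac// diracE mem_set ?mul1e//=.
by rewrite in_itv/= (arrival_ge0 good).
Qed.

End states.

(** * The Papangelou intensity *)

Section resume.
Context {R : realType} {T : R} (f : R -> R).
Local Notation mu := (@lebesgue_measure R).
Local Notation RR := (measurableTypeR R).
Implicit Types (w : config T) (s t r : R).

Hypothesis mf : measurable_fun setT f.
Hypothesis f0 : forall x, 0 <= f x.
Hypothesis fneg : forall x : R, x < 0 -> f x = 0.
Hypothesis f1 : (\int[mu]_x (f x)%:E = 1)%E.
Hypothesis tailT : 0 < tail f T.
(** This is what the finiteness of [ratio_sup] says where [f] vanishes. *)
Hypothesis fvanish : forall x z, 0 <= z -> z <= x -> x <= T -> f x = 0 -> f (x - z) = 0.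

Lemma future_mean0 w s : future_mean f (fun=> 0%E) w s = 0%E.
Proof.
apply: eseries0 => k _ _; elim: k w s => [|k IH] w s /=; first by rewrite mule0.
by rewrite integral0_eq// => t _; rewrite IH mule0.
Qed.

Lemma agree_npoints w s w' t : agree w s w' -> t <= s -> npoints w' t = npoints w t.
Proof.
move=> h ts; apply/eqP; rewrite -(eqr_nat R); apply/eqP; apply: EFin_inj.
rewrite -!npointsP; apply: h; first exact: measurable_itv.
by move=> x /=; rewrite !in_itv/= => /andP[_ /le_trans]; apply.
Qed.

Lemma agree_atom w s w' t : agree w s w' -> t <= s -> w' [set t] = w [set t].
Proof. by move=> h ts; apply: h => // x /= ->; rewrite in_itv. Qed.

(** The part of the expectation of [Psi], given [w] up to its last point [s],
    which comes from the event that ]s, t] has no point. *)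
Definition resume (Psi : config T -> \bar R) w s t : \bar R :=
  ((tail f (T - s))%:E * Psi w +
   \int[mu]_r ((if (t < r)%R then next_density T f s r else 0)%:E * future_mean f Psi (add_point r w) r))%E.

Let mlate d (X : measurableType d) (c e g : X -> R) :
  measurable_fun setT c -> measurable_fun setT e -> measurable_fun setT g ->
  measurable_fun setT (fun x => (if g x < e x then next_density T f (c x) (e x) else 0)%:E).
Proof.
move=> mc me mg; apply/measurable_EFinP; apply: measurable_fun_ifT => //.
  exact: measurable_fun_ltr.
by apply/measurable_EFinP; exact: measurable_next_density2.
Qed.

Let late0 s t r : (0 <= (if (t < r)%R then next_density T f s r else 0)%:E)%E.
Proof. by rewrite lee_fin; case: ifP => // _; exact: next_density_ge0. Qed.

Lemma resume_ge0 Psi w s t : (forall w, 0 <= Psi w)%E -> (0 <= resume Psi w s t)%E.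
Proof.
move=> Psi0; rewrite adde_ge0//; first by rewrite mule_ge0// lee_fin tail_ge0.
by apply: integral_ge0 => r _; rewrite mule_ge0//; exact: future_mean_ge0.
Qed.

Lemma measurable_resume d (X : measurableType d) (Phi : X * config T -> \bar R)
    (b : X -> config T) (c e : X -> R) :
  measurable_fun setT Phi -> (forall x, 0 <= Phi x)%E ->
  measurable_fun setT b -> measurable_fun setT c -> measurable_fun setT e ->
  measurable_fun setT (fun x => resume (fun w => Phi (x, w)) (b x) (c x) (e x)).
Proof.
move=> mPhi Phi0 mb mc me; apply: emeasurable_funD.
  apply: emeasurable_funM.
    apply/measurable_EFinP; apply: (measurableT_comp (measurable_tail mf f0 f1)).
    exact: measurable_funB.
  by apply: (measurableT_comp mPhi (g := fun x => (x, b x))); exact: measurable_fun_pair.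
pose h (q : X * RR) : \bar R :=
  ((if (e q.1 < q.2)%R then next_density T f (c q.1) q.2 else 0)%R%:E *
    future_mean f (fun w => Phi (q.1, w)) (add_point q.2 (b q.1)) q.2)%E.
apply: (measurable_fun_fubini_tonelli_F (m2 := mu) h); last first.
  by move=> q; rewrite mule_ge0//; exact: future_mean_ge0.
have mb1 : measurable_fun setT (fun q : X * RR => b q.1) by exact: (measurableT_comp mb measurable_fst).
have mc1 : measurable_fun setT (fun q : X * RR => c q.1) by exact: (measurableT_comp mc measurable_fst).
have me1 : measurable_fun setT (fun q : X * RR => e q.1) by exact: (measurableT_comp me measurable_fst).
have m2 : measurable_fun setT (fun q : X * RR => q.2 : R) by exact: measurable_snd.
apply: emeasurable_funM; first exact: mlate.
pose Phi' (y : (X * RR) * config T) : \bar R := Phi (y.1.1, y.2).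
have mPhi' : measurable_fun setT Phi'.
  apply: (measurableT_comp mPhi (g := fun y : (X * RR) * config T => (y.1.1, y.2))).
  apply: measurable_fun_pair; last exact: measurable_snd.
  exact: (measurableT_comp measurable_fst measurable_fst).
have mab : measurable_fun setT (fun q : X * RR => add_point q.2 (b q.1)).
  apply: (measurableT_comp measurable_add_point (g := fun q : X * RR => (q.2 : RR, b q.1))).
  by apply: measurable_fun_pair => //; exact: measurable_snd.
exact: (measurable_future_mean mf f0 f1 mPhi' (fun y => Phi0 _) mab m2).
Qed.

Lemma resumeZ (c : R) Psi w s t : 0 <= c ->
  measurable_fun setT Psi -> (forall w, 0 <= Psi w)%E ->
  resume (fun w => c%:E * Psi w)%E w s t = (c%:E * resume Psi w s t)%E.
Proof.
move=> c0 mPsi Psi0.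
have mstep : measurable_fun setT (fun r : RR =>
    ((if (t < r)%R then next_density T f s r else 0)%:E * future_mean f Psi (add_point r w) r)%E).
  apply: emeasurable_funM.
    by apply: (mlate (c := fun=> s) (g := fun=> t)).
  by apply: (measurable_future_mean1 mf f0 f1) => //; exact: measurable_add1.
rewrite /resume ge0_muleDr; last 2 first.
- by rewrite mule_ge0// lee_fin tail_ge0.
- by apply: integral_ge0 => r _; rewrite mule_ge0//; exact: future_mean_ge0.
rewrite [in LHS]muleCA; congr (_ + _)%E.
rewrite -ge0_integralZl_EFin//; last by move=> r _; rewrite mule_ge0//; exact: future_mean_ge0.
by apply: eq_integral => r _; rewrite future_meanZ// muleCA.
Qed.

(** Whether ]s, t] has a point is decided by the next arrival. *)
Lemma future_mean_state n w s t Psi : state n w s -> 0 <= t <= T ->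
  measurable_fun setT Psi -> (forall w, 0 <= Psi w)%E ->
  future_mean f (fun w' => if npoints w' t == n then Psi w' else 0%E) w s =
  if s <= t then resume Psi w s t else 0%E.
Proof.
move=> [/andP[s0 sT] ws wat wn] /andP[t0 tT] mPsi Psi0.
have mPn : measurable_fun setT (fun w' => if npoints w' t == n then Psi w' else 0%E).
  apply: measurable_fun_ifT => //.
  by apply: measurable_fun_eqn => //; exact: measurable_npointsr.
case: ifPn => [st|]; last first.
  rewrite -ltNge => ts; rewrite -[RHS](future_mean0 w s); apply: future_mean_local => // w' h.
  rewrite (agree_npoints h (ltW ts)) ifN// ltn_eqF// -wn npoints_lt ?t0//.
  by case: wat => // s00; move: ts; rewrite s00 ltNge t0.
rewrite (future_mean_rec mf f0 f1)//; last by move=> w'; case: ifP.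
have wst : w `]s, t]%classic = 0%E.
  apply/eqP; rewrite eq_le measure_ge0 andbT -ws.
  by apply: config_le => //; apply: subset_itvl; rewrite bnd_simp.
have wt : npoints w t = n by rewrite (@npoints_const _ _ w s t)// s0.
rewrite wt eqxx; congr (_ + _)%E; apply: eq_integral => r _.
rewrite /next_density; case: ifPn => [/andP[sr rT]|_]; last first.
  by rewrite if_same !mul0e.
have r0 : 0 <= r by rewrite (le_trans s0)// ltW.
have pr : past (add_point r w) r by exact: past_add ws s0 sr rT.
have wr0 : w [set r] = 0%E by exact: past_atom ws sr.
have rr : 0 < r <= T by rewrite (le_lt_trans s0 sr).
case: ltP => tr.
  congr (_ * _)%E; apply: future_mean_local => // w' h.
  have -> : npoints w' t = npoints w t; last by rewrite wt eqxx.
  rewrite (agree_npoints h (ltW tr)); apply/eqP; rewrite -(eqr_nat R); apply/eqP.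
  apply: EFin_inj; rewrite -!npointsP add_pointE// memNset ?adde0//= in_itv/= r0/=.
  by move=> rt; move: (lt_le_trans tr rt); rewrite ltxx.
rewrite mul0e; suff -> : future_mean f (fun w' => if npoints w' t == n then Psi w' else 0%E)
  (add_point r w) r = 0%E by rewrite mule0.
rewrite -[RHS](future_mean0 (add_point r w) r); apply: future_mean_local => // w' h.
rewrite ifN// gtn_eqF// (leq_trans _ (npoints_le w' tr))//.
rewrite (agree_npoints h (lexx r)) -wn -(ltr_nat R) -lte_fin -!npointsP add_pointE//.
rewrite mem_set/=; last by rewrite in_itv/= r0 lexx.
rewrite npointsP (npointsP w r) -EFinD lte_fin -natrD ltr_nat addn1 ltnS.
by apply: npoints_le; exact: ltW.
Qed.

Local Notation pi := (renewal_intensity f).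

(** The points around [t] are [s] and [r]. *)
Lemma intensity_next w s t r w' : past w s -> (s = 0 \/ w [set s] = 1%E) ->
  0 <= s -> s < t -> t < r -> r <= T -> agree (add_point r w) r w' ->
  pi t w' = f (r - t) * f (t - s) / f (r - s).
Proof.
move=> ws wat s0 st tr rT h.
have t0 : 0 <= t by rewrite (le_trans s0)// ltW.
have tT : t <= T by rewrite (le_trans _ rT)// ltW.
have sr : s < r by exact: lt_trans st tr.
have wr0 : w [set r] = 0%E by exact: past_atom ws sr.
have rr : 0 < r <= T by rewrite (le_lt_trans s0 sr).
have w'E (A : set RR) : measurable A -> A `<=` `]-oo, r]%classic -> w' A = (w A + (r \in A)%:R%:E)%E.
  by move=> mA Ar; rewrite h// add_pointE.
have wst (A : set RR) : measurable A -> A `<=` `]s, +oo[%classic -> w A = 0%E.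
  move=> mA As; apply/eqP; rewrite eq_le measure_ge0 andbT -ws.
  exact: config_le.
have w'st : w' `]s, t]%classic = 0%E.
  rewrite w'E//; last by move=> x /=; rewrite !in_itv/= => /andP[_ /le_trans]; apply; exact: ltW.
  rewrite wst//; last by apply: subset_itvl; rewrite bnd_simp.
  by rewrite memNset ?add0e//= in_itv/= [r <= t]leNgt tr andbF.
have w'tr : w' `]t, r[%classic = 0%E.
  rewrite w'E//; last by move=> x /=; rewrite !in_itv/= => /andP[_ /ltW].
  rewrite wst//; last by move=> x /=; rewrite !in_itv/= andbT => /andP[/(lt_trans st)].
  by rewrite memNset ?add0e//= in_itv/= ltxx andbF.
have w'r : w' [set r] = 1%E.
  by rewrite (agree_atom h (lexx r)) add_pointE// wr0 add0e mem_set.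
have w's : s = 0 \/ w' [set s] = 1%E.
  case: wat => [->|ws1]; [by left|right].
  rewrite (agree_atom h (ltW sr)) add_pointE// ws1 memNset ?adde0//= => rs.
  by rewrite rs ltxx in sr.
have [lt pn] := next_pointE t0 tr rT w'tr w'r.
by rewrite /renewal_intensity lt pn (last_pointE s0 (ltW st) tT w'st w's).
Qed.

(** The last point is [s]. *)
Lemma intensity_last w s t : past w s -> (s = 0 \/ w [set s] = 1%E) ->
  0 <= s -> s < t -> t <= T ->
  pi t w = f (t - s) * tail f (T - t) / tail f (T - s).
Proof.
move=> ws wat s0 st tT.
have wst t' : s <= t' -> w `]s, t']%classic = 0%E.
  move=> st'; apply/eqP; rewrite eq_le measure_ge0 andbT -ws.
  by apply: config_le => //; apply: subset_itvl; rewrite bnd_simp.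
have sT : s <= T by rewrite (le_trans (ltW st)).
have nE t' : s <= t' -> t' <= T -> npoints w t' = npoints w s.
  by move=> st' t'T; apply: npoints_const; [rewrite s0|exact: wst].
rewrite /renewal_intensity (nE t)// 1?ltW// (nE T)// ltnn.
by rewrite (last_pointE s0 (lexx s) sT (wst s (lexx s)) wat).
Qed.

(** The factor [pi] turns [f (r - s)], the density of the next arrival, into
    [f (t - s) * f (r - t)], that of an arrival at [t] and another one at [r];
    likewise for the probability that there is no further arrival. *)
Lemma resume_intensity n w s t (Psi X : config T -> \bar R) :
  state n w s -> s < t -> t <= T ->
  measurable_fun setT X -> (forall w, 0 <= X w)%E ->
  (forall w', w' [set t] = 0%E -> Psi w' = X (add_point t w')) ->
  resume (fun w' => Psi w' * (pi t w')%:E)%E w s t =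
  ((f (t - s))%:E * future_mean f X (add_point t w) t)%E.
Proof.
move=> [/andP[s0 sT] ws wat wn] st tT mX X0 PsiX.
have t0 : 0 < t by exact: le_lt_trans s0 st.
have wt0 : w [set t] = 0%E by exact: past_atom ws st.
have tt : 0 < t <= T by rewrite t0.
have mXt : measurable_fun setT (fun w' => X (add_point t w')).
  apply: (measurableT_comp mX); apply: (measurableT_comp measurable_add_point (g := fun w' => (t : RR, w'))).
  exact: measurable_fun_pair.
rewrite -(future_mean_add_split mf f0 f1 mX X0 tt wt0) /resume ge0_muleDr; last 2 first.
- by rewrite mule_ge0// lee_fin tail_ge0.
- by apply: integral_ge0 => r _; rewrite mule_ge0 ?lee_fin ?next_density_ge0//; exact: future_mean_ge0.
congr (_ + _)%E.
  rewrite PsiX// (intensity_last ws wat s0 st tT) [in LHS](muleC (X _)) !muleA; congr (_ * _)%E.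
  rewrite -!EFinM; congr _%:E; rewrite mulrC mulfVK//.
  by rewrite gt_eqF// (lt_le_trans tailT)// tail_nincr// gerBl.
rewrite -ge0_integralZl//; last 3 first.
- apply: emeasurable_funM; first exact: measurable_next_density2.
  by apply: (measurable_future_mean1 mf f0 f1) => //; exact: measurable_add1.
- by move=> r _; rewrite mule_ge0 ?lee_fin ?next_density_ge0//; exact: future_mean_ge0.
- by rewrite lee_fin.
apply: eq_integral => r _; case: ltP => tr; last first.
  by rewrite /next_density ltNge tr/= !mul0e mule0.
rewrite /next_density tr (lt_trans st tr)/=; case: (leP r T) => rT; last by rewrite !mul0e mule0.
pose c := f (r - t) * f (t - s) / f (r - s).
have c0 : 0 <= c by rewrite mulr_ge0 ?invr_ge0// mulr_ge0.
have sr : s < r by exact: lt_trans st tr.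
have r0 : 0 <= r by rewrite (le_trans s0)// ltW.
have rr : 0 < r <= T by rewrite (lt_trans t0 tr).
have wr0 : w [set r] = 0%E by exact: past_atom ws sr.
have -> : future_mean f (fun w' => Psi w' * (pi t w')%:E)%E (add_point r w) r =
   (c%:E * future_mean f (fun w' => X (add_point t w')) (add_point r w) r)%E.
  rewrite -future_meanZ//; apply: future_mean_local => //; first exact: past_add ws s0 sr rT.
  move=> w' h; rewrite (intensity_next ws wat s0 st tr rT h) muleC -/c PsiX//.
  rewrite (agree_atom h (ltW tr)) add_pointE// wt0 add0e memNset//= => rt.
  by rewrite rt ltxx in tr.
rewrite !muleA -!EFinM; congr (_%:E * _)%E; rewrite /c.
have [frs|frs] := eqVneq (f (r - s)) 0; last by field.
have -> : f (r - t) = 0; last by rewrite frs; ring.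
have -> : r - t = (r - s) - (t - s) by ring.
by apply: fvanish => //; lra.
Qed.

End resume.

Section intensity_formula.
Context {R : realType} {T : R} (f : R -> R).
Local Notation mu := (@lebesgue_measure R).
Local Notation RR := (measurableTypeR R).
Local Notation pi := (renewal_intensity f).

Hypothesis T0 : 0 <= T.
Hypothesis mf : measurable_fun setT f.
Hypothesis f0 : forall x, 0 <= f x.
Hypothesis fneg : forall x : R, x < 0 -> f x = 0.
Hypothesis f1 : (\int[mu]_x (f x)%:E = 1)%E.
Hypothesis tailT : 0 < tail f T.
Hypothesis fvanish : forall x z, 0 <= z -> z <= x -> x <= T -> f x = 0 -> f (x - z) = 0.

Lemma intensity_ge0 t (w : config T) : 0 <= pi t w.
Proof.
rewrite /renewal_intensity; case: ifP => _.
  by rewrite mulr_ge0 ?invr_ge0// mulr_ge0.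
by rewrite mulr_ge0 ?invr_ge0 ?tail_ge0// mulr_ge0 ?tail_ge0.
Qed.

Lemma measurable_intensity :
  measurable_fun setT (fun p : RR * config T => pi p.1 p.2).
Proof.
have mp i : measurable_fun setT (fun p : RR * config T => point_of p.2 i).
  by apply: (measurableT_comp (measurable_point_of i T0)); exact: measurable_snd.
have m1 : measurable_fun setT (fun p : RR * config T => p.1 : R) by exact: measurable_fst.
have mt := measurable_tail mf f0 f1.
pose h (i n : nat) (p : RR * config T) : R :=
  if (i < n)%N then f (point_of p.2 i.+1 - p.1) * f (p.1 - point_of p.2 i)
      / f (point_of p.2 i.+1 - point_of p.2 i)
  else f (p.1 - point_of p.2 n) * tail f (T - p.1) / tail f (T - point_of p.2 n).
have mh i n : measurable_fun setT (h i n).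
  rewrite /h; case: (i < n)%N.
    apply: measurable_funM; last first.
      by apply: measurable_funV; apply: (measurableT_comp mf); exact: measurable_funB.
    by apply: measurable_funM; apply: (measurableT_comp mf); exact: measurable_funB.
  apply: measurable_funM; last first.
    by apply: measurable_funV; apply: (measurableT_comp mt); exact: measurable_funB.
  apply: measurable_funM; first by apply: (measurableT_comp mf); exact: measurable_funB.
  by apply: (measurableT_comp mt); exact: measurable_funB.
apply: (measurable_fun_dispatch (c := fun p : RR * config T => npoints p.2 p.1)
  (h := fun i p => h i (npoints p.2 T) p)); first exact: measurable_npoints.
move=> i; apply: (measurable_fun_dispatch (c := fun p : RR * config T => npoints p.2 T)
  (h := fun n p => h i n p)) => //.
by apply: (measurableT_comp (measurable_npointsr T)); exact: measurable_snd.
Qed.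

Context d (Omega : measurableType d) (P : probability Omega R).
Variables (N : {RV P >-> config T}) (tau : nat -> {RV P >-> R}).
Hypothesis indep : mutually_independent tau.
Hypothesis dens : forall i A, measurable A ->
  distribution P (tau i) A = (\int[mu]_(u in A) (f u)%:E)%E.
Hypothesis NE : {ae P, forall o : Omega, forall A : set RR, measurable A ->
  N o A = (\sum_(1 <= n <oo) \d_(arrival tau n o) (A `&` `[0%R, T]))%E}.

Local Notation Z n o := (chain T tau n o).

Let ae_good := ae_good_path fneg dens NE.
Let mN : measurable_fun setT N. Proof. exact: measurable_funP. Qed.
Let mZ n : measurable_fun setT (chain T tau n). Proof. exact: measurable_chain. Qed.
Let mZ1 n : measurable_fun setT (fun o => (Z n o).1). Proof. exact: measurable_chain1. Qed.
Let mZ2 n : measurable_fun setT (fun o => (Z n o).2). Proof. exact: measurable_chain2. Qed.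

Let ae_eq_expectation (h k : Omega -> \bar R) :
  measurable_fun setT h -> measurable_fun setT k ->
  (forall o, good_path N tau o -> h o = k o) ->
  (\int[P]_o h o = \int[P]_o k o)%E.
Proof.
move=> mh mk hk; apply: ae_eq_integral => //.
by apply: filterS ae_good => o go _; exact: hk.
Qed.

Let mbefore n : measurable_fun setT (fun o => (Z n o).2 <= T).
Proof. exact: measurable_fun_ler. Qed.

(** The Markov property at the [n]-th arrival, by summing over the number of
    arrivals still to come before [T]. *)
Lemma transfer n (Phi : (config T * R) * config T -> \bar R) :
  measurable_fun setT Phi -> (forall x, 0 <= Phi x)%E ->
  (\int[P]_o (if ((Z n o).2 <= T)%R then Phi (Z n o, N o) else 0) =
   \int[P]_o (if ((Z n o).2 <= T)%R then
      future_mean f (fun w => Phi (Z n o, w)) (Z n o).1 (Z n o).2 else 0))%E.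
Proof.
move=> mPhi Phi0.
pose hk k o := (if ((Z n o).2 <= T)%R then
      future_part f k (fun w => Phi (Z n o, w)) (Z n o).1 (Z n o).2 else 0)%E.
pose gk k o := (if ((Z (n + k) o).2 <= T)%R && (T < (Z (n + k).+1 o).2)%R
      then Phi (Z n o, (Z (n + k) o).1) else 0)%E.
have mhk k : measurable_fun setT (hk k).
  apply: measurable_fun_ifT => //.
  apply: (measurableT_comp (measurable_future_part mf f0 f1 k mPhi Phi0) (g := fun o => (Z n o, Z n o))).
  exact: measurable_fun_pair.
have hk0 k o : (0 <= hk k o)%E by rewrite /hk; case: ifP => // _; exact: future_part_ge0.
have mgk k : measurable_fun setT (gk k).
  apply: measurable_fun_ifT => //.
    by apply: measurable_and => //; exact: measurable_fun_ltr.
  apply: (measurableT_comp mPhi (g := fun o => (Z n o, (Z (n + k) o).1))).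
  exact: measurable_fun_pair.
have gk0 k o : (0 <= gk k o)%E by rewrite /gk; case: ifP.
have -> : (\int[P]_o (if ((Z n o).2 <= T)%R then
      future_mean f (fun w => Phi (Z n o, w)) (Z n o).1 (Z n o).2 else 0) =
   \int[P]_o (\sum_(k <oo) hk k o))%E.
  apply: eq_integral => o _; rewrite /hk; case: ifP => // _.
  by rewrite eseries0.
rewrite integral_nneseries//.
have -> : (\sum_(k <oo) \int[P]_o hk k o = \sum_(k <oo) \int[P]_o gk k o)%E.
  apply: eq_eseriesr => k _; rewrite /hk /gk (chain_stop mf f0 f1 indep dens n k mPhi Phi0).
  by have := chain_future_part mf f0 fneg f1 indep dens n k 0 mPhi Phi0; rewrite addn0.
rewrite -integral_nneseries//; apply: ae_eq_expectation.
- apply: measurable_fun_ifT => //.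
  apply: (measurableT_comp mPhi (g := fun o => (Z n o, N o))).
  exact: measurable_fun_pair.
- exact: ge0_emeasurable_sum.
move=> o go; have [m [mT Tm mE]] := last_arrival T0 go.
have gkE k : gk k o = if (n + k)%N == m then Phi (Z n o, (Z (n + k) o).1) else 0%E.
  rewrite /gk !chain_arrival (arrival_le_last go _ mT Tm).
  rewrite ltNge (arrival_le_last go _ mT Tm) -ltnNge ltnS.
  by congr (if _ then _ else _); rewrite eqn_leq.
rewrite chain_arrival (arrival_le_last go _ mT Tm); case: ifPn => nm.
  rewrite (@nneseriesD1 _ _ (m - n))//.
  rewrite gkE subnKC// eqxx eseries0 ?adde0; last first.
    move=> k _ /= km; rewrite gkE ifN//; apply: contra km => /eqP <-.
    by rewrite addKn.
  apply: (eqc_ereal (Psi := fun w => Phi (Z n o, w))); last exact: chain_last.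
  by apply: measurable_fun_pair2.
rewrite eseries0// => k _ _; rewrite gkE ifN//; apply: contra nm => /eqP <-.
by rewrite leq_addr.
Qed.

Let itvE (h : R -> \bar R) : (\int[mu]_(t in `[0%R, T]) h t =
  \int[mu]_t (if (0 <= t <= T)%R then h t else 0))%E.
Proof.
rewrite integral_mkcond; apply: eq_integral => t _.
by rewrite patchE mem_setE in_itv.
Qed.

(** At a given time [t], the Markov property at the [n]-th arrival is applied
    to the event that it is the last one before [t]. *)
Lemma integral_between n (Y : (RR * (config T * R)) * config T -> \bar R) :
  measurable_fun setT Y -> (forall x, 0 <= Y x)%E ->
  (\int[P]_o \int[mu]_(t in `[0%R, T])
      (if npoints (N o) t == n then Y ((t, Z n o), N o) else 0) =
   \int[P]_o (if ((Z n o).2 <= T)%R then \int[mu]_(t in `[0%R, T])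
      (if ((Z n o).2 <= t)%R then resume f (fun w => Y ((t, Z n o), w)) (Z n o).1 (Z n o).2 t
       else 0) else 0))%E.
Proof.
move=> mY Y0.
pose g (x : Omega * RR) : \bar R := if (0 <= x.2 <= T)%R then
  (if npoints (N x.1) x.2 == n then Y ((x.2, Z n x.1), N x.1) else 0%E) else 0%E.
pose k (x : Omega * RR) : \bar R := if (0 <= x.2 <= T)%R then
  (if ((Z n x.1).2 <= T)%R then
   (if ((Z n x.1).2 <= x.2)%R then resume f (fun w => Y ((x.2, Z n x.1), w)) (Z n x.1).1 (Z n x.1).2 x.2
    else 0%E) else 0%E) else 0%E.
have m1 : measurable_fun setT (@fst Omega RR) by exact: measurable_fst.
have m2 : measurable_fun setT (@snd Omega RR) by exact: measurable_snd.
have mitv : measurable_fun setT (fun x : Omega * RR => (0 <= x.2 <= T)%R).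
  by apply: measurable_and; exact: measurable_fun_ler.
have mZx : measurable_fun setT (fun x : Omega * RR => Z n x.1) by exact: (measurableT_comp (mZ n) m1).
have mZx1 : measurable_fun setT (fun x : Omega * RR => (Z n x.1).1) by exact: (measurableT_comp (mZ1 n) m1).
have mZx2 : measurable_fun setT (fun x : Omega * RR => (Z n x.1).2) by exact: (measurableT_comp (mZ2 n) m1).
have mNx : measurable_fun setT (fun x : Omega * RR => N x.1) by exact: (measurableT_comp mN m1).
have mg : measurable_fun setT g.
  apply: measurable_fun_ifT => //; apply: measurable_fun_ifT => //.
    apply: measurable_fun_eqn => //.
    apply: (measurableT_comp measurable_npoints (g := fun x : Omega * RR => (x.2, N x.1))).
    exact: measurable_fun_pair.
  apply: (measurableT_comp mY (g := fun x : Omega * RR => ((x.2, Z n x.1), N x.1))).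
  by apply: measurable_fun_pair => //; exact: measurable_fun_pair.
have g0 x : (0 <= g x)%E by rewrite /g; do 2 case: ifP => //.
have mk : measurable_fun setT k.
  apply: measurable_fun_ifT => //; apply: measurable_fun_ifT => //; first exact: measurable_fun_ler.
  apply: measurable_fun_ifT => //; first exact: measurable_fun_ler.
  pose Phi (y : (Omega * RR) * config T) : \bar R := Y ((y.1.2, Z n y.1.1), y.2).
  have mPhi : measurable_fun setT Phi.
    apply: (measurableT_comp mY (g := fun y : (Omega * RR) * config T => ((y.1.2, Z n y.1.1), y.2))).
    apply: measurable_fun_pair; last exact: measurable_snd.
    apply: measurable_fun_pair; first exact: (measurableT_comp m2 measurable_fst).
    exact: (measurableT_comp mZx measurable_fst).
  exact: (measurable_resume mf f0 f1 mPhi (fun y => Y0 _) mZx1 mZx2 m2).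
have k0 x : (0 <= k x)%E.
  by rewrite /k; do 3 case: ifP => // _; exact: resume_ge0.
have -> : (\int[P]_o \int[mu]_(t in `[0%R, T])
      (if npoints (N o) t == n then Y ((t, Z n o), N o) else 0) =
    \int[P]_o \int[mu]_t g (o, t))%E.
  by apply: eq_integral => o _; rewrite itvE.
have -> : (\int[P]_o (if ((Z n o).2 <= T)%R then \int[mu]_(t in `[0%R, T])
      (if ((Z n o).2 <= t)%R then resume f (fun w => Y ((t, Z n o), w)) (Z n o).1 (Z n o).2 t
       else 0) else 0) = \int[P]_o \int[mu]_t k (o, t))%E.
  apply: eq_integral => o _; rewrite itvE; case: ifPn => nT.
    by apply: eq_integral => t _; rewrite /k/= nT.
  by rewrite integral0_eq// => t _; rewrite /k/= (negbTE nT) if_same.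
rewrite (fubini_tonelli (m1 := P) (m2 := mu) g mg g0) (fubini_tonelli (m1 := P) (m2 := mu) k mk k0).
apply: eq_integral => t _.
have [tT|tT] := boolP (0 <= t <= T); last by rewrite /g /k/= (negbTE tT).
rewrite /g /k/= tT.
pose Phi (y : (config T * R) * config T) : \bar R :=
  if npoints y.2 t == n then Y ((t, y.1), y.2) else 0%E.
have mPhi : measurable_fun setT Phi.
  apply: measurable_fun_ifT => //.
    apply: measurable_fun_eqn => //.
    by apply: (measurableT_comp (measurable_npointsr t)); exact: measurable_snd.
  apply: (measurableT_comp mY (g := fun y : (config T * R) * config T => ((t, y.1), y.2))).
  apply: measurable_fun_pair; last exact: measurable_snd.
  by apply: measurable_fun_pair => //; exact: measurable_fst.
have Phi0 y : (0 <= Phi y)%E by rewrite /Phi; case: ifP.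
have mgt : measurable_fun setT (fun o => g (o, t)) by exact: measurable_fun_pair1.
have mkt : measurable_fun setT (fun o => k (o, t)) by exact: measurable_fun_pair1.
have E1 : (\int[P]_o (if npoints (N o) t == n then Y ((t, Z n o), N o) else 0) =
   \int[P]_o (if ((Z n o).2 <= T)%R then Phi (Z n o, N o) else 0))%E.
  apply: ae_eq_expectation.
  - by move: mgt; rewrite /g/= tT.
  - apply: measurable_fun_ifT => //.
    apply: (measurableT_comp mPhi (g := fun o => (Z n o, N o))).
    exact: measurable_fun_pair.
  move=> o go; rewrite /Phi/=; case: eqP => [Nn|_]; last by rewrite if_same.
  by rewrite chain_arrival (npoints_arrival T0 go _ Nn)//; case/andP: tT.
rewrite E1 transfer//; apply: ae_eq_expectation.
- apply: measurable_fun_ifT => //.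
  pose Phi' (y : Omega * config T) : \bar R := Phi (Z n y.1, y.2).
  have mPhi' : measurable_fun setT Phi'.
    apply: (measurableT_comp mPhi (g := fun y : Omega * config T => (Z n y.1, y.2))).
    apply: measurable_fun_pair; last exact: measurable_snd.
    exact: (measurableT_comp (mZ n) measurable_fst).
  exact: (measurable_future_mean mf f0 f1 mPhi' (fun y => Phi0 _) (mZ1 n) (mZ2 n)).
- by move: mkt; rewrite /k/= tT.
move=> o go; case: ifPn => // nT.
have st := chain_state T0 go nT.
rewrite /Phi (future_mean_state mf f0 f1 st tT (Psi := fun w => Y ((t, Z n o), w)))//.
by apply: measurable_fun_pair2.
Qed.

(** Against the intensity, a point at [t] is inserted between the [n]-th
    arrival and the next one. *)
Lemma integral_intensity n (b : RR * (config T * R) -> R)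
    (Psi X : RR * config T -> \bar R) :
  measurable_fun setT b -> (forall x, 0 <= b x) ->
  measurable_fun setT Psi -> (forall x, 0 <= Psi x)%E ->
  measurable_fun setT X -> (forall x, 0 <= X x)%E ->
  (forall (t : R) (w : config T), (0 < t <= T)%R -> w [set t] = 0%E -> Psi (t, w) = X (t, add_point t w)) ->
  (\int[P]_o \int[mu]_(t in `[0%R, T])
      (if npoints (N o) t == n then (b (t, Z n o))%:E * (Psi (t, N o) * (pi t (N o))%:E) else 0) =
   \int[P]_o (if ((Z n o).2 <= T)%R then \int[mu]_t
      ((next_density T f (Z n o).2 t)%:E *
       ((b (t, Z n o))%:E * future_mean f (fun w => X (t, w)) (add_point t (Z n o).1) t)) else 0))%E.
Proof.
move=> mb b0 mPsi Psi0 mX X0 PsiX.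
pose Y (y : (RR * (config T * R)) * config T) : \bar R :=
  ((b y.1)%:E * (Psi (y.1.1, y.2) * (pi y.1.1 y.2)%:E))%E.
have m1 : measurable_fun setT (fun y : (RR * (config T * R)) * config T => (y.1.1, y.2)).
  apply: measurable_fun_pair; last exact: measurable_snd.
  exact: (measurableT_comp measurable_fst measurable_fst).
have mY : measurable_fun setT Y.
  apply: emeasurable_funM; first by apply/measurable_EFinP; exact: (measurableT_comp mb measurable_fst).
  apply: emeasurable_funM; first exact: (measurableT_comp mPsi m1).
  apply/measurable_EFinP.
  exact: (measurableT_comp measurable_intensity m1).
have Y0 y : (0 <= Y y)%E by rewrite /Y !mule_ge0 ?lee_fin// intensity_ge0.
rewrite (integral_between n mY Y0).
pose h (o : Omega) (t : R) := ((next_density T f (Z n o).2 t)%:E *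
       ((b (t, Z n o))%:E * future_mean f (fun w => X (t, w)) (add_point t (Z n o).1) t))%E.
have mRX : measurable_fun setT (fun x : Omega * RR =>
    future_mean f (fun w => X (x.2, w)) (add_point x.2 (Z n x.1).1) x.2).
  pose Phi (y : (Omega * RR) * config T) : \bar R := X (y.1.2, y.2).
  have mPhi : measurable_fun setT Phi.
    apply: (measurableT_comp mX (g := fun y : (Omega * RR) * config T => (y.1.2, y.2))).
    apply: measurable_fun_pair; last exact: measurable_snd.
    exact: (measurableT_comp measurable_snd measurable_fst).
  have ma : measurable_fun setT (fun x : Omega * RR => add_point x.2 (Z n x.1).1).
    apply: (measurableT_comp measurable_add_point (g := fun x : Omega * RR => (x.2, (Z n x.1).1))).
    apply: measurable_fun_pair; first exact: measurable_snd.
    exact: (measurableT_comp (mZ1 n) measurable_fst).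
  exact: (measurable_future_mean mf f0 f1 mPhi (fun y => X0 _) ma measurable_snd).
have mh : measurable_fun setT (fun x : Omega * RR => h x.1 x.2).
  apply: emeasurable_funM.
    apply: measurable_next_density2; last exact: measurable_snd.
      by [].
    exact: (measurableT_comp (mZ2 n) measurable_fst).
  apply: emeasurable_funM => //; apply/measurable_EFinP.
  apply: (measurableT_comp mb (g := fun x : Omega * RR => (x.2, Z n x.1))).
  apply: measurable_fun_pair; first exact: measurable_snd.
  exact: (measurableT_comp (mZ n) measurable_fst).
have h0 o t : (0 <= h o t)%E.
  by rewrite /h mule_ge0 ?lee_fin ?next_density_ge0// mule_ge0 ?lee_fin//; exact: future_mean_ge0.
pose k (x : Omega * RR) : \bar R := if (0 <= x.2 <= T)%R then
   (if ((Z n x.1).2 <= x.2)%R then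
     resume f (fun w => Y ((x.2, Z n x.1), w)) (Z n x.1).1 (Z n x.1).2 x.2
    else 0%E) else 0%E.
have mk : measurable_fun setT k.
  apply: measurable_fun_ifT => //.
    by apply: measurable_and; apply: measurable_fun_ler => //; exact: measurable_snd.
  apply: measurable_fun_ifT => //.
    apply: measurable_fun_ler; last exact: measurable_snd.
    exact: (measurableT_comp (mZ2 n) measurable_fst).
  pose Phi (y : (Omega * RR) * config T) : \bar R := Y ((y.1.2, Z n y.1.1), y.2).
  have mPhi : measurable_fun setT Phi.
    apply: (measurableT_comp mY (g := fun y : (Omega * RR) * config T => ((y.1.2, Z n y.1.1), y.2))).
    apply: measurable_fun_pair; last exact: measurable_snd.
    apply: measurable_fun_pair; first exact: (measurableT_comp measurable_snd measurable_fst).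
    exact: (measurableT_comp (mZ n) (measurableT_comp measurable_fst measurable_fst)).
  apply: (measurable_resume mf f0 f1 mPhi (fun y => Y0 _)).
  - exact: (measurableT_comp (mZ1 n) measurable_fst).
  - exact: (measurableT_comp (mZ2 n) measurable_fst).
  - exact: measurable_snd.
have k0 x : (0 <= k x)%E by rewrite /k; do 2 case: ifP => // _; exact: resume_ge0.
apply: ae_eq_expectation.
- apply: measurable_fun_ifT => //.
  rewrite (_ : (fun o => _) = (fun o => \int[mu]_t k (o, t))%E); last first.
    by apply/funext => o; rewrite itvE.
  exact: (measurable_fun_fubini_tonelli_F (m2 := mu) k).
- apply: measurable_fun_ifT => //.
  exact: (measurable_fun_fubini_tonelli_F (m2 := mu) (fun x : Omega * RR => h x.1 x.2)).
move=> o go; case: ifPn => // nT; have st := chain_state T0 go nT.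
have [/andP[s0 sT] ws wat wn] := st.
rewrite itvE -[LHS]/(\int[mu]_t k (o, t))%E -[RHS]/(\int[mu]_t h o t)%E.
apply: ae_eq_integral; first exact: measurableT.
- exact: measurable_fun_pair2.
- exact: (measurable_fun_pair2 (f := fun x : Omega * RR => h x.1 x.2)).
exists [set (Z n o).2]; split; [by []|exact: lebesgue_measure_set1|].
move=> t /= ht; apply: contrapT => /eqP ts; apply: ht => _.
rewrite /k /h/= /next_density.
case: (ltgtP (Z n o).2 t) ts => // [st'|ts] _; last by rewrite if_same !mul0e.
rewrite (le_trans s0 (ltW st'))/=; case: (leP t T) => tT; last by rewrite mul0e.
have t0 : 0 < t by exact: le_lt_trans s0 st'.
have mXt : measurable_fun setT (fun w => X (t, w)) by exact: measurable_fun_pair2.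
have mPt : measurable_fun setT (fun w => Psi (t, w)) by exact: measurable_fun_pair2.
rewrite muleCA -(resume_intensity mf f0 f1 tailT fvanish st st' tT (Psi := fun w => Psi (t, w)) mXt)//.
  rewrite -resumeZ//.
  - by apply: emeasurable_funM => //; apply/measurable_EFinP; exact: (measurable_fun_pair2 (f := fun p : RR * config T => pi p.1 p.2) _ measurable_intensity).
  - by move=> w; rewrite mule_ge0// lee_fin intensity_ge0.
by move=> w' wt; apply: PsiX; rewrite ?t0.
Qed.

(** ** The Papangelou formula *)

(** The [n.+1]-th arrival is a point added to the past at the [n]-th one; the
    sum over [n] is the integral against the process. *)
Lemma papangelou_intensity (X : RR * config T -> \bar R) :
  measurable_fun setT X -> (forall x, 0 <= X x)%E ->
  (\int[P]_o \int[N o]_(t in `[0%R, T]) X (t, del_point t (N o)) =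
   \int[P]_o \int[mu]_(t in `[0%R, T]) (X (t, N o) * (pi t (N o))%:E))%E.
Proof.
move=> mX X0.
pose Xd (p : RR * config T) : \bar R := X (p.1, del_point p.1 p.2).
have mXd : measurable_fun setT Xd.
  apply: (measurableT_comp mX (g := fun p : RR * config T => (p.1, del_point p.1 p.2))).
  by apply: measurable_fun_pair; [exact: measurable_fst|exact: measurable_del_point].
have Xd0 p : (0 <= Xd p)%E by exact: X0.
have mNx : measurable_fun setT (fun x : Omega * RR => (x.2, N x.1)).
  apply: measurable_fun_pair; first exact: measurable_snd.
  exact: (measurableT_comp mN measurable_fst).
pose a n o := (if ((Z n.+1 o).2 <= T)%R then Xd ((Z n.+1 o).2, N o) else 0)%E.
have ma n : measurable_fun setT (a n).
  apply: measurable_fun_ifT => //.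
  apply: (measurableT_comp mXd (g := fun o => ((Z n.+1 o).2 : RR, N o))).
  by apply: measurable_fun_pair => //; exact: mZ2.
have a0 n o : (0 <= a n o)%E by rewrite /a; case: ifP.
have E1 : (\int[P]_o \int[N o]_(t in `[0%R, T]) X (t, del_point t (N o)) =
    \sum_(n <oo) \int[P]_o a n o)%E.
  rewrite -integral_nneseries//; apply: ae_eq_expectation.
  - rewrite (_ : (fun o => _) = (fun o => \int[N o]_t
       (if (0 <= t <= T)%R then Xd (t, N o) else 0))%E); last first.
      apply/funext => o; rewrite integral_mkcond; apply: eq_integral => t _.
      by rewrite patchE mem_setE in_itv.
    apply: (measurable_config_integral (k := fun x : Omega * RR =>
       if (0 <= x.2 <= T)%R then Xd (x.2, N x.1) else 0%E) mN).
      by move=> x; case: ifP.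
    apply: measurable_fun_ifT => //.
      by apply: measurable_and; apply: measurable_fun_ler => //; exact: measurable_snd.
    exact: (measurableT_comp mXd mNx).
  - exact: ge0_emeasurable_sum.
  move=> o go; rewrite (integral_path T0 (y := fun t => Xd (t, N o)) go)//.
  exact: (measurable_fun_pair1 (f := Xd)).
pose c n o : \bar R := (\int[mu]_(t in `[0%R, T])
  (if npoints (N o) t == n then X (t, N o) * (pi t (N o))%:E else 0))%E.
have mXpi : measurable_fun setT (fun x : Omega * RR => X (x.2, N x.1) * (pi x.2 (N x.1))%:E)%E.
  apply: emeasurable_funM; first exact: (measurableT_comp mX mNx).
  by apply/measurable_EFinP; exact: (measurableT_comp measurable_intensity mNx).
have Xpi0 o t : (0 <= X (t, N o) * (pi t (N o))%:E)%E by rewrite mule_ge0// lee_fin intensity_ge0.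
have mnp n : measurable_fun setT (fun x : Omega * RR => npoints (N x.1) x.2 == n).
  by apply: measurable_fun_eqn => //; exact: (measurableT_comp measurable_npoints mNx).
have mcn n : measurable_fun setT (fun x : Omega * RR =>
    if npoints (N x.1) x.2 == n then X (x.2, N x.1) * (pi x.2 (N x.1))%:E else 0)%E.
  exact: measurable_fun_ifT.
have E2 : (\int[P]_o \int[mu]_(t in `[0%R, T]) (X (t, N o) * (pi t (N o))%:E) =
   \sum_(n <oo) \int[P]_o c n o)%E.
  rewrite -integral_nneseries//; last 2 first.
  - move=> n; rewrite (_ : c n = fun o => \int[mu]_t (if (0 <= t <= T)%R then
      (if npoints (N o) t == n then X (t, N o) * (pi t (N o))%:E else 0) else 0))%E; last first.
      by apply/funext => o; rewrite /c itvE.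
    apply: (measurable_fun_fubini_tonelli_F (m2 := mu) (fun x : Omega * RR => if (0 <= x.2 <= T)%R then
      (if npoints (N x.1) x.2 == n then X (x.2, N x.1) * (pi x.2 (N x.1))%:E else 0) else 0)%E).
      apply: measurable_fun_ifT => //.
      by apply: measurable_and; apply: measurable_fun_ler => //; exact: measurable_snd.
    by move=> x; do 2 case: ifP => //.
  - by move=> n o _; apply: integral_ge0 => t _; case: ifP.
  apply: eq_integral => o _; rewrite -integral_nneseries//; last 2 first.
  - move=> n; apply: measurable_funTS.
    exact: (measurable_fun_pair2 (f := fun x : Omega * RR =>
      if npoints (N x.1) x.2 == n then X (x.2, N x.1) * (pi x.2 (N x.1))%:E else 0)%E).
  - by move=> n t _; case: ifP.
  apply: eq_integral => t _; rewrite (@nneseriesD1 _ _ (npoints (N o) t))//; last first.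
    by move=> n _; case: ifP.
  rewrite eqxx eseries0 ?adde0// => n _ /= nt.
  by rewrite eq_sym (negbTE nt).
rewrite E1 E2; apply: eq_eseriesr => n _.
have mXb : measurable_fun setT (fun y : (config T * R) * config T => Xd (y.1.2, y.2)).
  apply: (measurableT_comp mXd (g := fun y : (config T * R) * config T => (y.1.2 : RR, y.2))).
  apply: measurable_fun_pair; last exact: measurable_snd.
  exact: (measurableT_comp measurable_snd measurable_fst).
rewrite (transfer n.+1 mXb)//.
have mPsi : measurable_fun setT (fun y : (config T * R) * (config T * R) =>
    future_mean f (fun w => Xd (y.2.2, w)) y.2.1 y.2.2).
  pose Phi (q : ((config T * R) * (config T * R)) * config T) : \bar R := Xd (q.1.2.2, q.2).
  have m22 : measurable_fun setT (fun y : (config T * R) * (config T * R) => y.2.2).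
    exact: (measurableT_comp measurable_snd measurable_snd).
  have mPhi : measurable_fun setT Phi.
    apply: (measurableT_comp mXd (g := fun q : ((config T * R) * (config T * R)) * config T =>
      (q.1.2.2 : RR, q.2))).
    apply: measurable_fun_pair; last exact: measurable_snd.
    exact: (measurableT_comp m22 measurable_fst).
  apply: (measurable_future_mean mf f0 f1 mPhi (fun y => Xd0 _) _ m22).
  exact: (measurableT_comp measurable_fst measurable_snd).
have := chain_step mf f0 fneg indep dens n 0 mPsi; rewrite addn0 => -> //; last first.
  by move=> y; exact: future_mean_ge0.
rewrite -[RHS](_ : (\int[P]_o \int[mu]_(t in `[0%R, T])
      (if npoints (N o) t == n then 1%:E * (X (t, N o) * (pi t (N o))%:E) else 0) = _)%E); last first.
  by apply: eq_integral => o _; apply: eq_integral => t _; rewrite mul1e.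
have mone : measurable_fun setT (fun _ : RR * (config T * R) => 1 : R) by exact: measurable_cst.
rewrite (integral_intensity n mone (fun=> ler01) mX X0 mXd Xd0).
- apply: eq_integral => o _; case: ifP => // _.
  by apply: eq_integral => t _; rewrite mul1e.
- move=> t w tT wt; rewrite /Xd/=.
  apply: (eqc_ereal (Psi := fun w => X (t, w))); first exact: measurable_fun_pair2.
  move=> A mA; rewrite del_pointE add_pointE// memNset; last by move=> [_]; exact.
  rewrite adde0; apply/eqP; rewrite eq_le; apply/andP; split; last first.
    by apply: config_le => //; exact: measurableD.
  rewrite -(adde0 (w (A `\` _))) -wt -measureU//; last 2 first.
  - exact: measurableD.
  - by apply/seteqP; split => // x [[_ h] /h].
  apply: config_le => //; first by apply: measurableU => //; exact: measurableD.
  by move=> x Ax; have [->|xt] := eqVneq x t; [right|left; split => //; apply/eqP].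
Qed.

End intensity_formula.

(** * The variance as an integral over the chain *)

Section predictable.
Context {R : realType} {T : R} (f : R -> R).
Local Notation mu := (@lebesgue_measure R).
Local Notation RR := (measurableTypeR R).
Implicit Types (w : config T) (s t r : R).

Hypothesis mf : measurable_fun setT f.
Hypothesis f0 : forall x, 0 <= f x.
Hypothesis fneg : forall x : R, x < 0 -> f x = 0.
Hypothesis f1 : (\int[mu]_x (f x)%:E = 1)%E.
Hypothesis tailT : 0 < tail f T.

Lemma resume_le Psi Psi' w s t :
  measurable_fun setT Psi -> measurable_fun setT Psi' ->
  (forall w, 0 <= Psi w)%E -> (forall w, Psi w <= Psi' w)%E ->
  (resume f Psi w s t <= resume f Psi' w s t)%E.
Proof.
move=> mP mP' P0 PP'; have P'0 w' : (0 <= Psi' w')%E by exact: le_trans (P0 _) (PP' _).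
have late0 r : (0 <= (if (t < r)%R then next_density T f s r else 0)%:E)%E.
  by rewrite lee_fin; case: ifP => // _; exact: next_density_ge0.
have mstep (Q : config T -> \bar R) : measurable_fun setT Q -> (forall w, 0 <= Q w)%E ->
  measurable_fun setT (fun r : RR =>
    ((if (t < r)%R then next_density T f s r else 0)%:E * future_mean f Q (add_point r w) r)%E).
  move=> mQ Q0; apply: emeasurable_funM.
    apply/measurable_EFinP; apply: measurable_fun_ifT => //; first exact: measurable_fun_ltr.
    by apply/measurable_EFinP; exact: measurable_next_density2.
  by apply: (measurable_future_mean1 mf f0 f1) => //; exact: measurable_add1.
apply: leeD; first by rewrite lee_wpmul2l// lee_fin tail_ge0.
apply: ge0_le_integral => //.
- by move=> r _; rewrite mule_ge0//; exact: future_mean_ge0.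
- exact: mstep.
- exact: mstep.
- by move=> r _; rewrite lee_wpmul2l//; exact: future_mean_le.
Qed.

Lemma resume1 w s t : 0 <= s -> s <= t -> t <= T ->
  resume f (fun=> 1%E) w s t = (tail f (t - s))%:E.
Proof.
move=> s0 st tT; rewrite -(tail_split mf f0 f1 st tT) addeC /resume mule1; congr (_ + _)%E.
apply: eq_integral => r _; case: ltP => tr; last by rewrite mul0e.
rewrite /next_density; case: ifPn => [/andP[sr rT]|_]; last by rewrite mul0e.
by rewrite (future_mean1 mf f0 fneg f1 tailT) ?mule1// (le_trans s0)// ltW.
Qed.

Variables (G : config T -> R) (B : R).
Hypotheses (mG : measurable_fun setT G) (G0 : forall w, 0 <= G w) (GB : forall w, G w <= B).

Local Notation GE := (fun w => (G w)%:E).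

Let B0 : 0 <= B. Proof. exact: le_trans (G0 point) (GB _). Qed.
Let mGE : measurable_fun setT (fun w => (G w)%:E). Proof. exact/measurable_EFinP. Qed.
Let GE0 w : (0 <= (G w)%:E)%E. Proof. by rewrite lee_fin. Qed.

Let GE_le w : ((G w)%:E <= B%:E * 1)%E. Proof. by rewrite mule1 lee_fin. Qed.

Lemma future_mean_bounded w s : (future_mean f GE w s <= B%:E)%E.
Proof.
apply: (@le_trans _ _ (future_mean f (fun=> (B%:E * 1)%E) w s)).
  by apply: future_mean_le => //; exact: measurable_cst.
rewrite (future_meanZ mf f0 f1 (Psi := fun=> 1%E))//.
by rewrite -[leRHS]mule1 lee_wpmul2l ?lee_fin//; exact: future_mean1_le1.
Qed.

(** The expectation of [G] given the points [w] up to the last one, [s]. *)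
Definition cond_mean w s : R := fine (future_mean f GE w s).

Lemma cond_meanE w s : (cond_mean w s)%:E = future_mean f GE w s.
Proof.
rewrite fineK// ge0_fin_numE; last exact: future_mean_ge0.
exact: le_lt_trans (future_mean_bounded w s) (ltry _).
Qed.

Lemma cond_mean_ge0 w s : 0 <= cond_mean w s.
Proof. by rewrite -lee_fin cond_meanE; exact: future_mean_ge0. Qed.

Lemma cond_mean_le w s : cond_mean w s <= B.
Proof. by rewrite -lee_fin cond_meanE; exact: future_mean_bounded. Qed.

Lemma measurable_cond_mean d (X : measurableType d) (b : X -> config T) (c : X -> R) :
  measurable_fun setT b -> measurable_fun setT c ->
  measurable_fun setT (fun x => cond_mean (b x) (c x)).
Proof.
move=> mb mc; apply/measurable_EFinP.
rewrite (_ : _ \o _ = fun x => future_mean f GE (b x) (c x)).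
  exact: (measurable_future_mean1 mf f0 f1).
by apply/funext => x /=; rewrite cond_meanE.
Qed.

Lemma resume_bounded w s t : 0 <= s -> s <= t -> t <= T ->
  (resume f GE w s t <= (B * tail f (t - s))%:E)%E.
Proof.
move=> s0 st tT; apply: (@le_trans _ _ (resume f (fun=> (B%:E * 1)%E) w s t)).
  by apply: resume_le => //; exact: measurable_cst.
by rewrite (resumeZ mf f0 f1 (Psi := fun=> 1%E))// resume1// -EFinM.
Qed.

(** The expectation of [G] given the points [w] up to the last one, [s], and
    given that there is none in ]s, t]. *)
Definition gap_mean w s t : R := fine (resume f GE w s t) / tail f (t - s).

Lemma resumeE w s t : 0 <= s -> s <= t -> t <= T ->
  resume f GE w s t = (gap_mean w s t * tail f (t - s))%:E.
Proof.
move=> s0 st tT; rewrite /gap_mean mulfVK; last first.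
  by rewrite gt_eqF// (lt_le_trans tailT)// tail_nincr//; lra.
rewrite fineK// ge0_fin_numE; last exact: resume_ge0.
exact: le_lt_trans (resume_bounded w s0 st tT) (ltry _).
Qed.

Lemma gap_mean_ge0 w s t : 0 <= gap_mean w s t.
Proof.
rewrite /gap_mean mulr_ge0 ?invr_ge0 ?tail_ge0// fine_ge0//.
exact: resume_ge0.
Qed.

Lemma gap_mean_le w s t : 0 <= s -> s <= t -> t <= T -> gap_mean w s t <= B.
Proof.
move=> s0 st tT; have := resume_bounded w s0 st tT; rewrite resumeE// lee_fin.
by rewrite ler_pM2r// (lt_le_trans tailT)// tail_nincr//; lra.
Qed.

Lemma measurable_gap_mean d (X : measurableType d) (b : X -> config T) (c e : X -> R) :
  measurable_fun setT b -> measurable_fun setT c -> measurable_fun setT e ->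
  measurable_fun setT (fun x => gap_mean (b x) (c x) (e x)).
Proof.
move=> mb mc me; apply: measurable_funM; last first.
  apply: measurable_funV; apply: (measurableT_comp (measurable_tail mf f0 f1)).
  exact: measurable_funB.
apply: (measurableT_comp (f := fine)) => //; 
apply: (measurable_resume mf f0 f1 (Phi := fun y => (G y.2)%:E)) => //.
apply/measurable_EFinP; apply: (measurableT_comp mG); exact: measurable_snd.
Qed.

(** The change in the expectation of [G] caused by a point at [t]. *)
Definition jump w s t : R := cond_mean (add_point t w) t - gap_mean w s t.

Lemma measurable_jump d (X : measurableType d) (b : X -> config T) (c e : X -> R) :
  measurable_fun setT b -> measurable_fun setT c -> measurable_fun setT e ->
  measurable_fun setT (fun x => jump (b x) (c x) (e x)).
Proof.
move=> mb mc me; apply: measurable_funB; last exact: measurable_gap_mean.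
apply: measurable_cond_mean => //.
apply: (measurableT_comp measurable_add_point (g := fun x => (e x : RR, b x))).
exact: measurable_fun_pair.
Qed.

Lemma jump_bounded w s t : 0 <= s -> s <= t -> t <= T -> `|jump w s t| <= B.
Proof.
move=> s0 st tT; have := gap_mean_le w s0 st tT; have := gap_mean_ge0 w s t.
have := cond_mean_ge0 (add_point t w) t; have := cond_mean_le (add_point t w) t.
by rewrite /jump ler_norml; lra.
Qed.

Hypothesis cf : {within `[0, +oo[, continuous f}.

(** The one-step identity, for the conditional mean at the next arrival,
    or [G w] if there is none before [T]. *)
Lemma jump_variance w s : 0 <= s -> s <= T ->
  (\int[mu]_t (next_density T f s t * jump w s t ^+ 2)%:E + (cond_mean w s ^+ 2)%:E =
   \int[mu]_t (next_density T f s t * cond_mean (add_point t w) t ^+ 2)%:E +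
     (tail f (T - s) * G w ^+ 2)%:E)%E.
Proof.
move=> s0 sT.
pose g t := cond_mean (add_point t w) t.
have mg : measurable_fun setT g.
  by apply: measurable_cond_mean => //; exact: measurable_add1.
have g0 t : 0 <= g t by exact: cond_mean_ge0.
have gB t : g t <= B by exact: cond_mean_le.
have IE0 : (\int[mu]_t ((next_density T f s t)%:E * future_mean f GE (add_point t w) t) =
     \int[mu]_t (next_density T f s t * g t)%:E)%E.
  by apply: eq_integral => t _; rewrite EFinM cond_meanE.
have totE : step_mean (next_density T f s) (tail f (T - s)) g (G w) = cond_mean w s.
  apply: EFin_inj; rewrite cond_meanE (future_mean_rec mf f0 f1)// IE0.
  rewrite /step_mean EFinD fineK// ge0_fin_numE; last first.
    by apply: integral_ge0 => t _; rewrite lee_fin mulr_ge0// next_density_ge0.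
  apply: le_lt_trans (ltry B); apply: le_trans (future_mean_bounded w s).
  rewrite (future_mean_rec mf f0 f1)// IE0 [leRHS]addeC.
  by apply: leeDl; rewrite mule_ge0// lee_fin tail_ge0.
have mE t : s < t -> t <= T ->
  step_rest_mean (next_density T f s) (fun t => tail f (t - s)) (tail f (T - s)) g (G w) t = gap_mean w s t.
  move=> st tT.
  have IE : (\int[mu]_r (if (t < r)%R then next_density T f s r * g r else 0)%:E =
      \int[mu]_r ((if (t < r)%R then next_density T f s r else 0)%:E * future_mean f GE (add_point r w) r))%E.
    by apply: eq_integral => r _; rewrite -cond_meanE -EFinM; case: ifP; rewrite ?mul0r.
  rewrite /step_rest_mean /step_rest /gap_mean /right_mass IE; congr (_ / _).
  set I := (\int[mu]_r _)%E.
  have I0 : (0 <= I)%E.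
    by apply: integral_ge0 => r _; rewrite mule_ge0 ?future_mean_ge0// lee_fin; case: ifP => // _; exact: next_density_ge0.
  have Ifin : I \is a fin_num.
    rewrite ge0_fin_numE//; apply: le_lt_trans (ltry (B * tail f (t - s))).
    apply: le_trans (resume_bounded w s0 (ltW st) tT).
    by rewrite /resume -/I [leRHS]addeC; apply: leeDl; rewrite mule_ge0// lee_fin tail_ge0.
  by rewrite /resume -/I -[in RHS](fineK Ifin).
have := next_density_step_variance mf f0 fneg f1 cf tailT s0 sT mg g0 gB (G0 w).
rewrite totE => <-; congr (_ + _)%E; apply: eq_integral => t _.
rewrite {1 2}/next_density; case: ifPn => [/andP[st tT]|_]; last by rewrite !mul0r.
by rewrite mE.
Qed.

End predictable.

Section variance_jumps.
Context {R : realType} {T : R} (f : R -> R).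
Local Notation mu := (@lebesgue_measure R).
Local Notation RR := (measurableTypeR R).

Hypothesis T0 : 0 <= T.
Hypothesis mf : measurable_fun setT f.
Hypothesis f0 : forall x, 0 <= f x.
Hypothesis fneg : forall x : R, x < 0 -> f x = 0.
Hypothesis f1 : (\int[mu]_x (f x)%:E = 1)%E.
Hypothesis tailT : 0 < tail f T.
Hypothesis cf : {within `[0, +oo[, continuous f}.

Context d (Omega : measurableType d) (P : probability Omega R).
Variables (N : {RV P >-> config T}) (tau : nat -> {RV P >-> R}).
Hypothesis indep : mutually_independent tau.
Hypothesis dens : forall i A, measurable A ->
  distribution P (tau i) A = (\int[mu]_(u in A) (f u)%:E)%E.
Hypothesis NE : {ae P, forall o : Omega, forall A : set RR, measurable A ->
  N o A = (\sum_(1 <= n <oo) \d_(arrival tau n o) (A `&` `[0%R, T]))%E}.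

Local Notation Z n o := (chain T tau n o).

Let ae_good := ae_good_path fneg dens NE.
Let mZ n : measurable_fun setT (chain T tau n). Proof. exact: measurable_chain. Qed.
Let mZ1 n : measurable_fun setT (fun o => (Z n o).1). Proof. exact: measurable_chain1. Qed.
Let mZ2 n : measurable_fun setT (fun o => (Z n o).2). Proof. exact: measurable_chain2. Qed.
Let mbefore n : measurable_fun setT (fun o => (Z n o).2 <= T).
Proof. exact: measurable_fun_ler. Qed.

Let mkx n : measurable_fun setT (fun x : Omega * RR => (next_density T f (Z n x.1).2 x.2)%:E).
Proof.
apply: (measurable_next_density2 mf (a := fun x : Omega * RR => (Z n x.1).2)).
  exact: (measurableT_comp (mZ2 n) measurable_fst).
exact: measurable_snd.
Qed.

(** Each spacing exceeds [T] with probability [tail f T]. *)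
Lemma arrival_geometric n :
  (\int[P]_o (if ((Z n o).2 <= T)%R then 1 else 0) <= ((1 - tail f T) ^+ n)%:E)%E.
Proof.
have r0 : 0 <= 1 - tail f T by rewrite subr_ge0; exact: tail_le1.
elim: n => [|n IH].
  under eq_integral do rewrite /= T0.
  by rewrite integral_cst// mul1e expr0 probability_le1.
have := chain_step mf f0 fneg indep dens n 0 (Psi := fun=> 1%E) (measurable_cst _) (fun=> lee01).
rewrite addn0 => ->; apply: (@le_trans _ _ (\int[P]_o ((1 - tail f T)%:E *
   (if ((Z n o).2 <= T)%R then 1 else 0)))%E); last first.
  rewrite ge0_integralZl_EFin//.
  - by rewrite exprS EFinM lee_wpmul2l// lee_fin.
  - by move=> o _; case: ifP.
  - exact: measurable_fun_ifT.
apply: ae_ge0_le_integral => //.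
- move=> o _; case: ifP => // _; apply: integral_ge0 => t _.
  by rewrite mule1 lee_fin next_density_ge0.
- apply: measurable_fun_ifT => //.
  apply: (measurable_fun_fubini_tonelli_F (m2 := mu)
    (fun x : Omega * RR => (next_density T f (Z n x.1).2 x.2)%:E * 1)%E).
    by apply: emeasurable_funM; [exact: mkx|exact: measurable_cst].
  by move=> x; rewrite mule1 lee_fin next_density_ge0.
- by move=> o _; case: ifP => _; rewrite ?mule0// mule1 lee_fin.
- by apply: emeasurable_funM => //; exact: measurable_fun_ifT.
apply: filterS ae_good => o go _; case: ifPn => nT; last by rewrite mule0.
have [/andP[s0 _] _ _ _] := chain_state T0 go nT.
under eq_integral do rewrite mule1.
by rewrite mule1 next_density_mass_le.
Qed.

Variables (G : config T -> R) (B : R).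
Hypotheses (mG : measurable_fun setT G) (G0 : forall w, 0 <= G w) (GB : forall w, G w <= B).

Local Notation V := (cond_mean f G).

Definition jump_mass n : \bar R := (\int[P]_o (if ((Z n o).2 <= T)%R then
  \int[mu]_t (next_density T f (Z n o).2 t * jump f G (Z n o).1 (Z n o).2 t ^+ 2)%:E else 0))%E.

Let C n : \bar R := (\int[P]_o (if ((Z n o).2 <= T)%R then
  (V (Z n o).1 (Z n o).2 ^+ 2)%:E else 0))%E.
Let E n : \bar R := (\int[P]_o (if ((Z n o).2 <= T)%R then
  (tail f (T - (Z n o).2) * G (Z n o).1 ^+ 2)%:E else 0))%E.

Let mjump n : measurable_fun setT (fun x : Omega * RR =>
  jump f G (Z n x.1).1 (Z n x.1).2 x.2).
Proof.
apply: (measurable_jump mf f0 fneg f1 mG G0 GB (b := fun x : Omega * RR => (Z n x.1).1)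
  (c := fun x => (Z n x.1).2) (e := snd)).
- exact: (measurableT_comp (mZ1 n) measurable_fst).
- exact: (measurableT_comp (mZ2 n) measurable_fst).
- exact: measurable_snd.
Qed.

Lemma measurable_jump_mass n : measurable_fun setT (fun o : Omega =>
  if ((Z n o).2 <= T)%R then
  \int[mu]_t (next_density T f (Z n o).2 t * jump f G (Z n o).1 (Z n o).2 t ^+ 2)%:E else 0)%E.
Proof.
apply: measurable_fun_ifT => //.
apply: (measurable_fun_fubini_tonelli_F (m2 := mu) (fun x : Omega * RR =>
  (next_density T f (Z n x.1).2 x.2 * jump f G (Z n x.1).1 (Z n x.1).2 x.2 ^+ 2)%:E)).
  apply/measurable_EFinP; apply: measurable_funM; last exact: measurable_funX.
  by apply/measurable_EFinP; exact: mkx.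
by move=> x; rewrite lee_fin mulr_ge0 ?next_density_ge0// sqr_ge0.
Qed.

Let mV2 n : measurable_fun setT (fun o => V (Z n o).1 (Z n o).2 ^+ 2).
Proof. by apply: measurable_funX; exact: measurable_cond_mean. Qed.

(** The second moments of the conditional means at two successive arrivals,
    where [E n] collects the paths whose [n]-th arrival is the last one. *)
Let jump_step n : (jump_mass n + C n = C n.+1 + E n)%E.
Proof.
have mVp : measurable_fun setT (fun y : (config T * R) * (config T * R) => (V y.2.1 y.2.2 ^+ 2)%:E).
  apply/measurable_EFinP; apply: measurable_funX.
  apply: (measurable_cond_mean mf f0 fneg f1 mG G0 GB).
    exact: (measurableT_comp measurable_fst measurable_snd).
  exact: (measurableT_comp measurable_snd measurable_snd).
have := chain_step mf f0 fneg indep dens n 0 mVp.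
rewrite addn0 => H; rewrite {2}/C {}H; last by move=> y; rewrite lee_fin sqr_ge0.
have mK : measurable_fun setT (fun o : Omega => if ((Z n o).2 <= T)%R then
    \int[mu]_t ((next_density T f (Z n o).2 t)%:E * (V (add_point t (Z n o).1) t ^+ 2)%:E) else 0)%E.
  apply: measurable_fun_ifT => //.
  apply: (measurable_fun_fubini_tonelli_F (m2 := mu) (fun x : Omega * RR =>
    (next_density T f (Z n x.1).2 x.2)%:E * (V (add_point x.2 (Z n x.1).1) x.2 ^+ 2)%:E)%E).
    apply: emeasurable_funM; first exact: mkx.
    apply/measurable_EFinP; apply: measurable_funX.
    apply: (measurable_cond_mean mf f0 fneg f1 mG G0 GB); last exact: measurable_snd.
    apply: (measurableT_comp measurable_add_point (g := fun x : Omega * RR => (x.2, (Z n x.1).1))).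
    apply: measurable_fun_pair; first exact: measurable_snd.
    exact: (measurableT_comp (mZ1 n) measurable_fst).
  by move=> x; rewrite mule_ge0// ?lee_fin ?next_density_ge0// sqr_ge0.
have mE : measurable_fun setT (fun o : Omega => if ((Z n o).2 <= T)%R then
    (tail f (T - (Z n o).2) * G (Z n o).1 ^+ 2)%:E else 0)%E.
  apply: measurable_fun_ifT => //; apply/measurable_EFinP; apply: measurable_funM.
    by apply: (measurableT_comp (measurable_tail mf f0 f1)); exact: measurable_funB.
  by apply: measurable_funX; exact: (measurableT_comp mG (mZ1 n)).
have mC : measurable_fun setT (fun o : Omega => if ((Z n o).2 <= T)%R then
    (V (Z n o).1 (Z n o).2 ^+ 2)%:E else 0)%E.
  by apply: measurable_fun_ifT => //; exact/measurable_EFinP.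
have i0 (c : bool) (h : R -> R) : (forall t, 0 <= h t) ->
    (0 <= if c then \int[mu]_t (h t)%:E else 0)%E.
  by move=> h0; case: c => //; apply: integral_ge0 => t _; rewrite lee_fin.
have c0 (c : bool) (x : R) : 0 <= x -> (0 <= if c then x%:E else 0)%E.
  by move=> x0; case: c.
have j0 o t : 0 <= next_density T f (Z n o).2 t * jump f G (Z n o).1 (Z n o).2 t ^+ 2.
  by rewrite mulr_ge0 ?next_density_ge0// sqr_ge0.
transitivity (\int[P]_o ((if ((Z n o).2 <= T)%R then
  \int[mu]_t (next_density T f (Z n o).2 t * jump f G (Z n o).1 (Z n o).2 t ^+ 2)%:E else 0) +
  (if ((Z n o).2 <= T)%R then (V (Z n o).1 (Z n o).2 ^+ 2)%:E else 0)))%E.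
  apply/esym; apply: ge0_integralD; first exact: measurableT.
  - by move=> o _; apply: i0.
  - exact: measurable_jump_mass.
  - by move=> o _; apply: c0; exact: sqr_ge0.
  - exact: mC.
transitivity (\int[P]_o ((if ((Z n o).2 <= T)%R then
    \int[mu]_t ((next_density T f (Z n o).2 t)%:E * (V (add_point t (Z n o).1) t ^+ 2)%:E) else 0) +
  (if ((Z n o).2 <= T)%R then (tail f (T - (Z n o).2) * G (Z n o).1 ^+ 2)%:E else 0)))%E; last first.
  apply: ge0_integralD; first exact: measurableT.
  - move=> o _; case: ifP => // _; apply: integral_ge0 => t _.
    by rewrite -EFinM lee_fin mulr_ge0 ?next_density_ge0// sqr_ge0.
  - exact: mK.
  - by move=> o _; apply: c0; rewrite mulr_ge0 ?tail_ge0// sqr_ge0.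
  - exact: mE.
apply: ae_eq_integral; first exact: measurableT.
- by apply: emeasurable_funD; [exact: measurable_jump_mass|exact: mC].
- by apply: emeasurable_funD; [exact: mK|exact: mE].
apply: filterS ae_good => o go _; case: ifPn => // nT.
have [/andP[s0 sT] _ _ _] := chain_state T0 go nT.
by rewrite (jump_variance mf f0 fneg f1 tailT mG G0 GB cf _ s0 sT).
Qed.

Let jump_sum n : (\sum_(0 <= k < n) jump_mass k + C 0 = C n + \sum_(0 <= k < n) E k)%E.
Proof.
elim: n => [|n IH]; first by rewrite !big_geq// adde0 add0e.
by rewrite !big_nat_recr//= addeAC IH addeAC (addeC (C n)) jump_step -addeA (addeC (E n)).
Qed.

Lemma jump_mass_ge0 n : (0 <= jump_mass n)%E.
Proof.
apply: integral_ge0 => o _; case: ifP => // _; apply: integral_ge0 => t _.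
by rewrite lee_fin mulr_ge0 ?next_density_ge0// sqr_ge0.
Qed.

Let E0 n : (0 <= E n)%E.
Proof.
apply: integral_ge0 => o _; case: ifP => // _.
by rewrite lee_fin mulr_ge0 ?tail_ge0// sqr_ge0.
Qed.

Let C0 n : (0 <= C n)%E.
Proof. by apply: integral_ge0 => o _; case: ifP => // _; rewrite lee_fin sqr_ge0. Qed.

Let C_le n : (C n <= (B ^+ 2 * (1 - tail f T) ^+ n)%:E)%E.
Proof.
apply: (@le_trans _ _ (\int[P]_o ((B ^+ 2)%:E * (if ((Z n o).2 <= T)%R then 1 else 0)))%E).
  apply: ge0_le_integral => //.
  - by move=> o _; case: ifP => // _; rewrite lee_fin sqr_ge0.
  - by apply: measurable_fun_ifT => //; exact/measurable_EFinP.
  - by apply: emeasurable_funM; [exact: measurable_cst|exact: measurable_fun_ifT].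
  move=> o _; case: ifP => _; last by rewrite mule0.
  rewrite mule1 lee_fin; have := cond_mean_ge0 mf f0 fneg f1 mG G0 GB (Z n o).1 (Z n o).2.
  have := cond_mean_le mf f0 fneg f1 mG G0 GB (Z n o).1 (Z n o).2.
  by move=> h1 h2; apply: lerXn2r => //; rewrite nnegrE// (le_trans h2).
rewrite ge0_integralZl_EFin//.
- by rewrite (EFinM (B ^+ 2)) lee_wpmul2l ?lee_fin ?sqr_ge0//; exact: arrival_geometric.
- by move=> o _; case: ifP.
- exact: measurable_fun_ifT.
- exact: sqr_ge0.
Qed.

Lemma mean_G : (\int[P]_o (G (N o))%:E = (V (@no_points R T) 0)%:E)%E.
Proof.
have mPhi : measurable_fun setT (fun y : (config T * R) * config T => (G y.2)%:E).
  by apply/measurable_EFinP; apply: (measurableT_comp mG); exact: measurable_snd.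
have := transfer T0 mf f0 fneg f1 indep dens NE 0 mPhi.
under eq_integral do rewrite /= T0.
move=> ->; last by move=> y; rewrite lee_fin.
under eq_integral do rewrite /= T0 -(cond_meanE mf f0 fneg f1 mG G0 GB).
by rewrite integral_cst// -[RHS]mule1; congr (_ * _)%E; exact: probability_setT.
Qed.

Let second_moment : (\int[P]_o (G (N o) ^+ 2)%:E = \sum_(n <oo) E n)%E.
Proof.
have mPhi : measurable_fun setT (fun y : (config T * R) * config T => (G y.2 ^+ 2)%:E).
  apply/measurable_EFinP; apply: measurable_funX.
  by apply: (measurableT_comp mG); exact: measurable_snd.
have Phi0 (y : (config T * R) * config T) : (0 <= (G y.2 ^+ 2)%:E)%E by rewrite lee_fin sqr_ge0.
have := transfer T0 mf f0 fneg f1 indep dens NE 0 mPhi Phi0.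
under eq_integral do rewrite /= T0.
move=> ->.
have mG2 : measurable_fun setT (fun w => (G w ^+ 2)%:E) by apply/measurable_EFinP; exact: measurable_funX.
have G20 w : (0 <= (G w ^+ 2)%:E)%E by rewrite lee_fin sqr_ge0.
transitivity (\int[P]_o (\sum_(k <oo) future_part f k (fun w => (G w ^+ 2)%:E) (Z 0 o).1 (Z 0 o).2))%E.
  by apply: eq_integral => o _; rewrite /= T0.
rewrite integral_nneseries//.
- apply: eq_eseriesr => k _.
  have := chain_future_part mf f0 fneg f1 indep dens 0 k 0 mPhi Phi0; rewrite !add0n => H.
  apply: (etrans _ H); by apply: eq_integral => o _; rewrite /= T0.
- by move=> k; exact: (measurable_future_part1 mf f0 f1 mG2 G20 k (mZ1 0) (mZ2 0)).
- by move=> k o _; exact: future_part_ge0.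
Qed.

(** The increments of a martingale are orthogonal; what is still to come at
    the [n]-th arrival dies out geometrically. *)
Lemma variance_jumps :
  (\sum_(n <oo) jump_mass n + (V (@no_points R T) 0 ^+ 2)%:E = \int[P]_o (G (N o) ^+ 2)%:E)%E.
Proof.
have C00 : C 0 = (V (@no_points R T) 0 ^+ 2)%:E.
  rewrite /C; under eq_integral do rewrite /= T0.
  by rewrite integral_cst// -[RHS]mule1; congr (_ * _)%E; exact: probability_setT.
have cC : C @ \oo --> 0%E.
  apply: (@squeeze_cvge _ _ _ _ (fun=> 0%E) _ (fun n => (B ^+ 2 * (1 - tail f T) ^+ n)%:E)).
  - by near=> n; rewrite C0 C_le.
  - exact: cvg_cst.
  - apply: cvg_EFin; first by near=> n.
    rewrite -[X in _ --> X](mulr0 (B ^+ 2)); apply: cvgMr.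
    by apply: cvg_expr; rewrite ger0_norm ?subr_ge0 ?tail_le1// gtrBl.
have h1 : (fun n => \sum_(0 <= k < n) jump_mass k + C 0)%E @ \oo -->
    (\sum_(n <oo) jump_mass n + (V (@no_points R T) 0 ^+ 2)%:E)%E.
  rewrite -C00; apply: cvgeD; last exact: cvg_cst.
    by rewrite ge0_adde_def// inE ?C0// nneseries_ge0// => n _ _; exact: jump_mass_ge0.
  by apply: is_cvg_nneseries => n _ _; exact: jump_mass_ge0.
have h2 : (fun n => C n + \sum_(0 <= k < n) E k)%E @ \oo --> (0 + \sum_(n <oo) E n)%E.
  apply: cvgeD; [by apply: ge0_adde_def; rewrite inE//; apply: nneseries_ge0 => n _ _; exact: E0|exact: cC|].
  by apply: is_cvg_nneseries => n _ _; exact: E0.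
rewrite second_moment -[RHS]add0e; apply: (cvg_unique _ h1) => //.
by rewrite (_ : (fun n => _) = (fun n => C n + \sum_(0 <= k < n) E k)%E)//; apply/funext.
Unshelve. all: by end_near. Qed.

End variance_jumps.

(** * The dispersion of the intensity *)

Section dispersion.
Context {R : realType} (T : R) (f : R -> R).
Local Notation mu := (@lebesgue_measure R).
Local Notation RR := (measurableTypeR R).
Implicit Types (w : config T) (s t r : R).

Hypothesis mf : measurable_fun setT f.
Hypothesis f0 : forall x, 0 <= f x.
Hypothesis fneg : forall x : R, x < 0 -> f x = 0.
Hypothesis f1 : (\int[mu]_x (f x)%:E = 1)%E.
Hypothesis tailT : 0 < tail f T.

(** The second moment of [f (r - t) / f (r - s)] under the density of the next
    arrival [r], on ]t, T]. *)
Definition overlap s t : \bar R :=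
  (\int[mu]_r (if (t < r)%R && (r <= T)%R then f (r - t) ^+ 2 / f (r - s) else 0)%:E)%E.

(** [f (t - s)] times the dispersion is the second moment, on the event that
    ]s, t] has no point, of the difference between the intensity at [t] and
    the hazard rate, given that the last point before [t] is at [s]. *)
Definition dispersion s t : R := f (t - s) *
  (tail f (T - t) ^+ 2 / tail f (T - s) + fine (overlap s t) - (tail f (t - s))^-1).

Definition hazard x : R := f x / tail f x.

Lemma hazard_ge0 x : 0 <= hazard x.
Proof. by rewrite mulr_ge0 ?invr_ge0 ?tail_ge0. Qed.

Lemma measurable_hazard : measurable_fun setT hazard.
Proof. by apply: measurable_funM => //; apply: measurable_funV; exact: measurable_tail. Qed.

Let mlap d (X : measurableType d) (a b c : X -> R) :
  measurable_fun setT a -> measurable_fun setT b -> measurable_fun setT c ->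
  measurable_fun setT (fun x => (if (b x < c x) && (c x <= T) then
    f (c x - b x) ^+ 2 / f (c x - a x) else 0)%:E).
Proof.
move=> ma mb mc; apply/measurable_EFinP; apply: measurable_fun_ifT => //.
  by apply: measurable_and; [exact: measurable_fun_ltr|exact: measurable_fun_ler].
apply: measurable_funM.
  by apply: measurable_funX; apply: (measurableT_comp mf); exact: measurable_funB.
by apply: measurable_funV; apply: (measurableT_comp mf); exact: measurable_funB.
Qed.

Let lap0 s t r : (0 <= (if (t < r)%R && (r <= T)%R then f (r - t) ^+ 2 / f (r - s) else 0)%:E)%E.
Proof. by rewrite lee_fin; case: ifP => // _; rewrite mulr_ge0 ?invr_ge0// sqr_ge0. Qed.

Lemma measurable_dispersion : measurable_fun setT (fun p : RR * RR => dispersion p.1 p.2).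
Proof.
have m1 : measurable_fun setT (fun p : RR * RR => p.1 : R) by exact: measurable_fst.
have m2 : measurable_fun setT (fun p : RR * RR => p.2 : R) by exact: measurable_snd.
have mt := measurable_tail mf f0 f1.
apply: measurable_funM; first by apply: (measurableT_comp mf); exact: measurable_funB.
apply: measurable_funB; last first.
  by apply: measurable_funV; apply: (measurableT_comp mt); exact: measurable_funB.
apply: measurable_funD.
  apply: measurable_funM.
    by apply: measurable_funX; apply: (measurableT_comp mt); exact: measurable_funB.
  by apply: measurable_funV; apply: (measurableT_comp mt); exact: measurable_funB.
apply: (measurableT_comp (f := fine)) => //.
apply: (measurable_fun_fubini_tonelli_F (m2 := mu) (fun x : (RR * RR) * RR =>
  (if (x.1.2 < x.2)%R && (x.2 <= T)%R then f (x.2 - x.1.2) ^+ 2 / f (x.2 - x.1.1) else 0)%:E)) => //.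
apply: mlap; last exact: measurable_snd.
  exact: (measurableT_comp measurable_fst measurable_fst).
exact: (measurableT_comp measurable_snd measurable_fst).
Qed.

Let late_mass s t : s <= t -> t <= T ->
  (\int[mu]_r (if (t < r)%R then next_density T f s r else 0)%R%:E =
   (tail f (t - s) - tail f (T - s))%:E)%E.
Proof.
move=> st tT; have := tail_split mf f0 f1 st tT.
set I := (\int[mu]_r _)%E; move: I => [i| |]// [] <-.
by rewrite addrK.
Qed.

Section ratio.
Variable h : R -> R.
Hypothesis h0 : forall z, 0 <= h z.
Hypothesis fh : forall x z, 0 <= z -> z <= x -> x <= T -> f (x - z) <= h z * f x.

Lemma overlap_le s t : 0 <= s -> s <= t -> t <= T ->
  (overlap s t <= (h (t - s) ^+ 2 * (tail f (t - s) - tail f (T - s)))%:E)%E.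
Proof.
move=> s0 st tT; rewrite EFinM -late_mass//.
rewrite -ge0_integralZl_EFin ?sqr_ge0//; last 2 first.
- by move=> r _; rewrite lee_fin; case: ifP => // _; exact: next_density_ge0.
- apply/measurable_EFinP; apply: measurable_fun_ifT => //; first exact: measurable_fun_ltr.
  by apply/measurable_EFinP; exact: measurable_next_density2.
apply: ge0_le_integral => //.
- exact: mlap.
- apply: emeasurable_funM; first exact: measurable_cst.
  apply/measurable_EFinP; apply: measurable_fun_ifT => //; first exact: measurable_fun_ltr.
  by apply/measurable_EFinP; exact: measurable_next_density2.
move=> r _; rewrite -EFinM lee_fin /next_density; case: (ltP t r) => tr/=; last by rewrite mulr0.
rewrite (le_lt_trans st tr)/=; case: (leP r T) => rT; last by rewrite mulr0.
have fr : f (r - t) <= h (t - s) * f (r - s).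
  by have := fh (x := r - s) (z := t - s); rewrite opprB addrA subrK; apply; lra.
have [->|frs] := eqVneq (f (r - s)) 0; first by rewrite invr0 !mulr0.
rewrite ler_pdivrMr ?lt_neqAle 1?eq_sym ?frs ?f0// -mulrA -expr2 -exprMn.
by apply: lerXn2r => //; rewrite nnegrE ?mulr_ge0.
Qed.

Let overlap_fin s t : 0 <= s -> s <= t -> t <= T -> overlap s t \is a fin_num.
Proof.
move=> s0 st tT; rewrite ge0_fin_numE; last exact: integral_ge0.
exact: le_lt_trans (overlap_le s0 st tT) (ltry _).
Qed.

(** On the right is the expression under the supremum of [gamma_const], for
    [z := t - s]. *)
Lemma dispersion_le s t : 0 <= s -> s <= t -> t <= T ->
  dispersion s t <= f (t - s) *
    (tail f (T - t) ^+ 2 / tail f (T - s) +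
     h (t - s) ^+ 2 * (tail f (t - s) - tail f (T - s)) - (tail f (t - s))^-1).
Proof.
move=> s0 st tT; rewrite ler_wpM2l// lerB// lerD2l -lee_fin fineK; first exact: overlap_le.
exact: overlap_fin.
Qed.

(** The next point after [t] is at [r], with density [f (r - s)], or beyond
    [T]; expanding the squares leaves only masses of the spacing law and the
    overlap. *)
Lemma dispersionE s t : 0 <= s -> s <= t -> t <= T ->
  ((tail f (T - s) * (f (t - s) * tail f (T - t) / tail f (T - s) - hazard (t - s)) ^+ 2)%:E +
   \int[mu]_r ((if (t < r)%R then next_density T f s r else 0) *
      (f (r - t) * f (t - s) / f (r - s) - hazard (t - s)) ^+ 2)%:E =
   (f (t - s) * dispersion s t)%:E)%E.
Proof.
move=> s0 st tT.
have mkap u : measurable_fun setT (fun r : RR => next_density T f u r).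
  by apply/measurable_EFinP; exact: measurable_next_density2.
have mlate : measurable_fun setT (fun r : RR => if t < r then next_density T f s r else 0).
  by apply: measurable_fun_ifT => //; exact: measurable_fun_ltr.
have late0 r : 0 <= (if t < r then next_density T f s r else 0).
  by case: ifP => // _; exact: next_density_ge0.
have ml := hazard_ge0 (t - s).
set F := f (t - s); set l := hazard (t - s).
have F0 : 0 <= F by exact: f0.
set A := (\int[mu]_r _)%E.
have E : (A + (2 * l * F)%:E * \int[mu]_r (next_density T f t r)%:E =
    (F ^+ 2)%:E * overlap s t +
    (l ^+ 2)%:E * \int[mu]_r (if (t < r)%R then next_density T f s r else 0)%:E)%E.
  have mA : measurable_fun setT (fun r : RR => ((if t < r then next_density T f s r else 0) *
      (f (r - t) * F / f (r - s) - l) ^+ 2)%:E).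
    apply/measurable_EFinP; apply: measurable_funM => //; apply: measurable_funX.
    apply: measurable_funB => //; apply: measurable_funM.
      by apply: measurable_funM => //; apply: (measurableT_comp mf); exact: measurable_funB.
    by apply: measurable_funV; apply: (measurableT_comp mf); exact: measurable_funB.
  have mlateE : measurable_fun setT (fun r : RR => (if t < r then next_density T f s r else 0)%:E).
    exact/measurable_EFinP.
  have mkapE : measurable_fun setT (fun r : RR => (next_density T f t r)%:E).
    by apply/measurable_EFinP; exact: mkap.
  have kap0 r : (0 <= (next_density T f t r)%:E)%E by rewrite lee_fin next_density_ge0.
  have lateE0 r : (0 <= (if (t < r)%R then next_density T f s r else 0)%:E)%E by rewrite lee_fin.
  have mlap' : measurable_fun setT (fun r : RR =>
      (if (t < r) && (r <= T) then f (r - t) ^+ 2 / f (r - s) else 0)%:E) by exact: mlap.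
  have Z (c : R) (g : R -> \bar R) : 0 <= c -> measurable_fun setT g -> (forall r, 0 <= g r)%E ->
      (c%:E * \int[mu]_r g r = \int[mu]_r (c%:E * g r))%E.
    by move=> c0 mg g0; apply/esym; apply: ge0_integralZl_EFin.
  have lF0 : 0 <= 2 * l * F by rewrite (mulr_ge0 (mulr_ge0 _ ml)).
  rewrite /overlap; have /= -> := Z _ _ lF0 mkapE kap0.
  have /= -> := Z _ _ (sqr_ge0 l) mlateE lateE0.
  have /= -> := Z _ _ (sqr_ge0 F) mlap' (lap0 s t).
  transitivity (\int[mu]_r (((if (t < r)%R then next_density T f s r else 0) *
      (f (r - t) * F / f (r - s) - l) ^+ 2)%:E + (2 * l * F)%:E * (next_density T f t r)%:E))%E.
    apply/esym; apply: ge0_integralD; first exact: measurableT.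
    - by move=> r _; rewrite lee_fin mulr_ge0// sqr_ge0.
    - exact: mA.
    - by move=> r _; rewrite -EFinM lee_fin (mulr_ge0 lF0)// next_density_ge0.
    - by apply: emeasurable_funM => //; apply/measurable_EFinP.
  transitivity (\int[mu]_r ((F ^+ 2)%:E *
      (if (t < r)%R && (r <= T)%R then f (r - t) ^+ 2 / f (r - s) else 0)%:E +
      (l ^+ 2)%:E * (if (t < r)%R then next_density T f s r else 0)%:E))%E; last first.
    apply: ge0_integralD; first exact: measurableT.
    - by move=> r _; rewrite mule_ge0// lee_fin sqr_ge0.
    - by apply: emeasurable_funM => //; exact: mlap.
    - by move=> r _; rewrite -EFinM lee_fin mulr_ge0// sqr_ge0.
    - by apply: emeasurable_funM => //; exact/measurable_EFinP.
  apply: eq_integral => r _; rewrite -!EFinM -!EFinD; congr _%:E.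
  rewrite /next_density; case: (ltP t r) => tr/=; last by rewrite mul0r !mulr0.
  rewrite (le_lt_trans st tr)/=; case: (leP r T) => rT/=; last by rewrite mul0r !mulr0.
  have [frs|frs] := eqVneq (f (r - s)) 0; last by field.
  have -> : f (r - t) = 0; last by rewrite frs invr0; ring.
  apply/eqP; rewrite eq_le f0 andbT; have := fh (x := r - s) (z := t - s).
  by rewrite opprB addrA subrK frs mulr0; apply; lra.
have Km : (\int[mu]_r (next_density T f t r)%:E = (1 - tail f (T - t))%:E)%E.
  have := next_density_mass (T := T) mf f0 fneg f1 t; set I := (\int[mu]_r _)%E; move: I => [i| |]// [] <-.
  by rewrite addrK.
move: E; rewrite Km late_mass// -(fineK (overlap_fin s0 st tT)) /dispersion -/F.
move: (A) (fine _) => [a| |] o // [] E; rewrite -EFinD; congr _%:E.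
have -> : a = F ^+ 2 * o + l ^+ 2 * (tail f (t - s) - tail f (T - s)) - 2 * l * F * (1 - tail f (T - t)).
  by rewrite -E addrK.
have ne x : x <= T -> tail f x != 0.
  by move=> xT; rewrite gt_eqF// (lt_le_trans tailT)// tail_nincr.
have ne1 : tail f (T - s) != 0 by apply: ne; lra.
have ne2 : tail f (t - s) != 0 by apply: ne; lra.
rewrite /l /hazard -/F; field.
by rewrite ne1 ne2.
Qed.

(** Up to the factor [f (t - s)] it is a second moment. *)
Lemma dispersion_ge0 s t : 0 <= s -> s <= t -> t <= T -> 0 <= dispersion s t.
Proof.
move=> s0 st tT.
have : 0 <= f (t - s) * dispersion s t.
  rewrite -lee_fin -dispersionE//; apply: adde_ge0.
    by rewrite lee_fin mulr_ge0 ?tail_ge0// sqr_ge0.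
  apply: integral_ge0 => r _; rewrite lee_fin mulr_ge0 ?sqr_ge0//.
  by case: ifP => // _; exact: next_density_ge0.
have [F0 _|F0] := eqVneq (f (t - s)) 0; first by rewrite /dispersion F0 mul0r.
by rewrite pmulr_rge0// lt_neqAle eq_sym F0 f0.
Qed.

(** Once the next arrival after [t] is known, so is the intensity at [t]. *)
Lemma resume_dispersion n w s t : state n w s -> s < t -> t <= T ->
  (resume f (fun w' => ((renewal_intensity f t w' - hazard (t - s)) ^+ 2)%:E) w s t <=
   (f (t - s) * dispersion s t)%:E)%E.
Proof.
move=> [/andP[s0 sT] ws wat wn] st tT.
have T0 : 0 <= T by exact: le_trans sT.
have mPsi : measurable_fun setT (fun w' : config T =>
    ((renewal_intensity f t w' - hazard (t - s)) ^+ 2)%:E).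
  apply/measurable_EFinP; apply: measurable_funX; apply: measurable_funB => //.
  exact: (measurable_fun_pair2 (f := fun p : RR * config T => renewal_intensity f p.1 p.2)
    _ (measurable_intensity T0 mf f0 f1)).
rewrite -dispersionE//; last exact: ltW.
apply: leeD.
  by rewrite (intensity_last f ws wat s0 st tT) -EFinM.
apply: ge0_le_integral => //.
- move=> r _; rewrite mule_ge0//; last by apply: future_mean_ge0 => // w'; rewrite lee_fin sqr_ge0.
  by rewrite lee_fin; case: ifP => // _; exact: next_density_ge0.
- apply: emeasurable_funM.
    apply/measurable_EFinP; apply: measurable_fun_ifT => //; first exact: measurable_fun_ltr.
    by apply/measurable_EFinP; exact: measurable_next_density2.
  apply: (measurable_future_mean1 mf f0 f1) => //; first by move=> w'; rewrite lee_fin sqr_ge0.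
  exact: measurable_add1.
- apply/measurable_EFinP; apply: measurable_funM.
    apply: measurable_fun_ifT => //; first exact: measurable_fun_ltr.
    by apply/measurable_EFinP; exact: measurable_next_density2.
  apply: measurable_funX; apply: measurable_funB => //; apply: measurable_funM.
    by apply: measurable_funM => //; apply: (measurableT_comp mf); exact: measurable_funB.
  by apply: measurable_funV; apply: (measurableT_comp mf); exact: measurable_funB.
move=> r _; case: ltP => tr; last by rewrite mul0e mul0r.
rewrite /next_density (lt_trans st tr)/=; case: (leP r T) => rT; last by rewrite mul0e mul0r.
rewrite EFinM lee_wpmul2l// ?lee_fin//.
set c := (_ ^+ 2).
rewrite (future_mean_local f (Psi' := fun=> (c%:E * 1)%E)).
- rewrite (future_meanZ mf f0 f1 (Psi := fun=> 1%E))//; last exact: sqr_ge0.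
  by rewrite -[leRHS]mule1 lee_wpmul2l ?lee_fin ?sqr_ge0//; exact: future_mean1_le1.
- by rewrite (le_trans s0)// ltW// (lt_trans st).
- exact: past_add ws s0 (lt_trans st tr) rT.
by move=> w' ww'; rewrite mule1 (intensity_next f ws wat s0 st tr rT ww').
Qed.

End ratio.

End dispersion.

(** * The variance inequality for bounded functionals *)

Section weighted.
Context {R : realType} d (X : measurableType d) (m : {measure set X -> \bar R}).
Variable b : X -> R.
Hypotheses (mb : measurable_fun setT b) (b0 : forall x, 0 <= b x).
Implicit Types g h : X -> R.

Definition weighted g : \bar R := (\int[m]_x (b x * g x)%:E)%E.

Let mbg g : measurable_fun setT g -> measurable_fun setT (fun x => (b x * g x)%:E).
Proof. by move=> mg; apply/measurable_EFinP; exact: measurable_funM. Qed.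

Lemma weighted_ge0 g : (forall x, 0 <= g x) -> (0 <= weighted g)%E.
Proof. by move=> g0; apply: integral_ge0 => x _; rewrite lee_fin mulr_ge0. Qed.

Lemma weightedD g h : measurable_fun setT g -> (forall x, 0 <= g x) ->
  measurable_fun setT h -> (forall x, 0 <= h x) ->
  weighted (fun x => g x + h x) = (weighted g + weighted h)%E.
Proof.
move=> mg g0 mh h0.
transitivity (\int[m]_x ((b x * g x)%:E + (b x * h x)%:E))%E.
  by apply: eq_integral => x _; rewrite -EFinD mulrDr.
apply: ge0_integralD; first exact: measurableT.
- by move=> x _; rewrite lee_fin mulr_ge0.
- exact: mbg.
- by move=> x _; rewrite lee_fin mulr_ge0.
- exact: mbg.
Qed.

Lemma weightedZ c g : 0 <= c -> measurable_fun setT g -> (forall x, 0 <= g x) ->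
  weighted (fun x => c * g x) = (c%:E * weighted g)%E.
Proof.
move=> c0 mg g0; transitivity (\int[m]_x (c%:E * (b x * g x)%:E))%E.
  by apply: eq_integral => x _; rewrite -EFinM mulrCA.
apply: ge0_integralZl_EFin => //; last exact: mbg.
by move=> x _; rewrite lee_fin mulr_ge0.
Qed.

Lemma weighted_le g h : measurable_fun setT g -> (forall x, 0 <= g x) ->
  measurable_fun setT h -> (forall x, g x <= h x) ->
  (weighted g <= weighted h)%E.
Proof.
move=> mg g0 mh gh; apply: ge0_le_integral => //.
- by move=> x _; rewrite lee_fin mulr_ge0.
- exact: mbg.
- exact: mbg.
- by move=> x _; rewrite lee_fin ler_wpM2l.
Qed.

End weighted.

Section bounded_inequality.
Context {R : realType} {T : R} (f : R -> R).
Local Notation mu := (@lebesgue_measure R).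
Local Notation RR := (measurableTypeR R).
Local Notation pi := (renewal_intensity f).

Hypothesis T0 : 0 <= T.
Hypothesis mf : measurable_fun setT f.
Hypothesis f0 : forall x, 0 <= f x.
Hypothesis fneg : forall x : R, x < 0 -> f x = 0.
Hypothesis f1 : (\int[mu]_x (f x)%:E = 1)%E.
Hypothesis tailT : 0 < tail f T.
Variable h : R -> R.
Hypothesis h0 : forall z, 0 <= h z.
Hypothesis fh : forall x z, 0 <= z -> z <= x -> x <= T -> f (x - z) <= h z * f x.

Context d (Omega : measurableType d) (P : probability Omega R).
Variables (N : {RV P >-> config T}) (tau : nat -> {RV P >-> R}).
Hypothesis indep : mutually_independent tau.
Hypothesis dens : forall i A, measurable A ->
  distribution P (tau i) A = (\int[mu]_(u in A) (f u)%:E)%E.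
Hypothesis NE : {ae P, forall o : Omega, forall A : set RR, measurable A ->
  N o A = (\sum_(1 <= n <oo) \d_(arrival tau n o) (A `&` `[0%R, T]))%E}.

Local Notation Z n o := (chain T tau n o).
Local Notation C := (RR * (config T * R))%type.
Implicit Types (Y : C * config T -> R) (y : C -> R) (w : config T) (s t : R).

Let ae_good := ae_good_path fneg dens NE.
Let mN : measurable_fun setT N. Proof. exact: measurable_funP. Qed.
Let mZ n : measurable_fun setT (chain T tau n). Proof. exact: measurable_chain. Qed.

Let fvanish x z : 0 <= z -> z <= x -> x <= T -> f x = 0 -> f (x - z) = 0.
Proof.
move=> z0 zx xT fx; apply/eqP; rewrite eq_le f0 andbT.
by have := fh z0 zx xT; rewrite fx mulr0.
Qed.

Definition gap_weight n (x : Omega * RR) : R :=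
  if (0 <= x.2 <= T) && (npoints (N x.1) x.2 == n) then 1 else 0.

Definition chain_weight n (x : Omega * RR) : R :=
  if (Z n x.1).2 <= T then next_density T f (Z n x.1).2 x.2 else 0.

(** An integral over the paths and over the times between the [n]-th arrival
    and the next one. *)
Definition gap_integral n (Y : C * config T -> R) : \bar R :=
  weighted (P \x mu)%E (gap_weight n) (fun x => Y ((x.2, Z n x.1), N x.1)).

(** An integral over the paths up to the [n]-th arrival and over the position
    of the next one. *)
Definition chain_integral n (y : C -> R) : \bar R :=
  weighted (P \x mu)%E (chain_weight n) (fun x => y (x.2, Z n x.1)).

Let m1 : measurable_fun setT (@fst Omega RR). Proof. exact: measurable_fst. Qed.
Let m2 : measurable_fun setT (fun x : Omega * RR => x.2 : R). Proof. exact: measurable_snd. Qed.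
Let mZx n : measurable_fun setT (fun x : Omega * RR => Z n x.1).
Proof. exact: (measurableT_comp (mZ n) m1). Qed.
Let mZx2 n : measurable_fun setT (fun x : Omega * RR => (Z n x.1).2).
Proof. exact: (measurableT_comp measurable_snd (mZx n)). Qed.
Let mNx : measurable_fun setT (fun x : Omega * RR => N x.1).
Proof. exact: (measurableT_comp mN m1). Qed.

Let mcoord n : measurable_fun setT (fun x : Omega * RR => (x.2, Z n x.1) : C).
Proof. by apply: measurable_fun_pair => //; exact: measurable_snd. Qed.
Let mcoordN n : measurable_fun setT (fun x : Omega * RR => ((x.2, Z n x.1) : C, N x.1)).
Proof. by apply: measurable_fun_pair => //; exact: mcoord. Qed.

Let mnp n : measurable_fun setT (fun x : Omega * RR => npoints (N x.1) x.2 == n).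
Proof.
apply: measurable_fun_eqn => //.
apply: (measurableT_comp measurable_npoints (g := fun x : Omega * RR => (x.2, N x.1))).
by apply: measurable_fun_pair => //; exact: measurable_snd.
Qed.

Let mitv : measurable_fun setT (fun x : Omega * RR => 0 <= x.2 <= T).
Proof. by apply: measurable_and; exact: measurable_fun_ler. Qed.

Let mgw n : measurable_fun setT (gap_weight n).
Proof. by apply: measurable_fun_ifT => //; exact: measurable_and. Qed.
Let gw0 n x : 0 <= gap_weight n x. Proof. by rewrite /gap_weight; case: ifP. Qed.
Let mcw n : measurable_fun setT (chain_weight n).
Proof.
apply: measurable_fun_ifT => //; first exact: measurable_fun_ler.
by apply/measurable_EFinP; exact: (measurable_next_density2 mf (mZx2 n) m2).
Qed.
Let cw0 n x : 0 <= chain_weight n x.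
Proof. by rewrite /chain_weight; case: ifP => // _; exact: next_density_ge0. Qed.

Let iterated_le n (g k : Omega * RR -> \bar R) :
  measurable_fun setT g -> (forall x, 0 <= g x)%E ->
  measurable_fun setT k -> (forall x, 0 <= k x)%E ->
  (forall o t, good_path N tau o -> t != (Z n o).2 -> (g (o, t) <= k (o, t))%E) ->
  (\int[P \x mu]_x g x <= \int[P \x mu]_x k x)%E.
Proof.
move=> mg g0 mk k0 gk.
rewrite (fubini_tonelli1 (m1 := P) (m2 := mu) g mg g0) (fubini_tonelli1 (m1 := P) (m2 := mu) k mk k0).
apply: ae_ge0_le_integral => //.
- by move=> o _; apply: integral_ge0.
- exact: measurable_fun_fubini_tonelli_F.
- by move=> o _; apply: integral_ge0.
- exact: measurable_fun_fubini_tonelli_F.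
apply: filterS ae_good => o go _; apply: ae_ge0_le_integral => //.
- exact: measurable_fun_pair2.
- exact: measurable_fun_pair2.
exists [set (Z n o).2]; split; [by []|exact: lebesgue_measure_set1|].
move=> t /= ht; apply: contrapT => /eqP ts; apply: ht => _; exact: gk.
Qed.

Let resumed n (Y : C * config T -> R) (x : Omega * RR) : \bar R :=
  if ((Z n x.1).2 <= T)%R && ((0 <= x.2 <= T)%R && ((Z n x.1).2 <= x.2)%R) then
    resume f (fun w => (Y ((x.2, Z n x.1), w))%:E) (Z n x.1).1 (Z n x.1).2 x.2 else 0%E.

Let resumed_ge0 n Y x : (forall x, 0 <= Y x) -> (0 <= resumed n Y x)%E.
Proof. by move=> Y0; rewrite /resumed; case: ifP => // _; apply: resume_ge0 => // w; rewrite lee_fin. Qed.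

Let measurable_resumed n Y : measurable_fun setT Y -> (forall x, 0 <= Y x) ->
  measurable_fun setT (resumed n Y).
Proof.
move=> mY Y0; apply: measurable_fun_ifT => //.
  apply: measurable_and; first exact: measurable_fun_ler.
  by apply: measurable_and => //; exact: measurable_fun_ler.
apply: (measurable_resume mf f0 f1 (Phi := fun y : (Omega * RR) * config T =>
  (Y ((y.1.2, Z n y.1.1), y.2))%:E)).
- apply/measurable_EFinP; apply: (measurableT_comp mY (g := fun y : (Omega * RR) * config T =>
    ((y.1.2, Z n y.1.1) : C, y.2))).
  apply: measurable_fun_pair; last exact: measurable_snd.
  exact: (measurableT_comp (mcoord n) measurable_fst).
- by move=> y; rewrite lee_fin.
- exact: (measurableT_comp measurable_fst (mZx n)).
- exact: mZx2.
- exact: measurable_snd.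
Qed.

Let mgY n (Y : C * config T -> R) : measurable_fun setT Y -> measurable_fun setT
  (fun x : Omega * RR => Y ((x.2, Z n x.1), N x.1)).
Proof. by move=> mY; exact: (measurableT_comp mY (mcoordN n)). Qed.

Let mcy n (y : C -> R) : measurable_fun setT y -> measurable_fun setT
  (fun x : Omega * RR => y (x.2, Z n x.1)).
Proof. by move=> my; exact: (measurableT_comp my (mcoord n)). Qed.

Let itvE (g : R -> \bar R) : (\int[mu]_(t in `[0%R, T]) g t =
  \int[mu]_t (if (0 <= t <= T)%R then g t else 0))%E.
Proof.
rewrite integral_mkcond; apply: eq_integral => t _.
by rewrite patchE mem_setE in_itv.
Qed.

Let gap_resumed n Y : measurable_fun setT Y -> (forall x, 0 <= Y x) ->
  gap_integral n Y = (\int[P \x mu]_x resumed n Y x)%E.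
Proof.
move=> mY Y0.
have mYE : measurable_fun setT (fun x : C * config T => (Y x)%:E) by exact/measurable_EFinP.
have YE0 x : (0 <= (Y x)%:E)%E by rewrite lee_fin.
rewrite /gap_integral /weighted.
rewrite (fubini_tonelli1 (m1 := P) (m2 := mu)); last 2 first.
- by apply/measurable_EFinP; apply: measurable_funM => //; exact: mgY.
- by move=> x; rewrite lee_fin mulr_ge0.
rewrite (fubini_tonelli1 (m1 := P) (m2 := mu) (resumed n Y)); last 2 first.
- exact: measurable_resumed.
- by move=> x; exact: resumed_ge0.
have := integral_between T0 mf f0 fneg f1 indep dens NE n mYE YE0 => E.
transitivity (\int[P]_o \int[mu]_(t in `[0%R, T])
      (if npoints (N o) t == n then (Y ((t, Z n o), N o))%:E else 0))%E.
  apply: eq_integral => o _; rewrite itvE; apply: eq_integral => t _.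
  rewrite /gap_weight/=; case: (0 <= t <= T) => /=; last by rewrite mul0r.
  by case: ifP => _; rewrite ?mul1r ?mul0r.
rewrite E; apply: eq_integral => o _; rewrite itvE /fubini_F /resumed/=.
case: ifP => _ /=; last by rewrite integral0.
by apply: eq_integral => t _; case: (0 <= t <= T).
Qed.

(** Given the past at the [n]-th arrival, [resume] is the expectation on the
    event that [t] comes before the next one. The comparison fails at the arrival
    itself, a null set of times. *)
Let gap_chain_le n Y y : measurable_fun setT Y -> (forall x, 0 <= Y x) ->
  measurable_fun setT y -> (forall x, 0 <= y x) ->
  (forall t w s, state n w s -> (s < t)%R -> (t <= T)%R ->
    resume f (fun w' => (Y ((t, (w, s)), w'))%:E) w s t <= (f (t - s) * y (t, (w, s)))%:E)%E ->
  (gap_integral n Y <= chain_integral n y)%E.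
Proof.
move=> mY Y0 my y0 le; rewrite gap_resumed//; apply: (iterated_le (n := n)).
- exact: measurable_resumed.
- by move=> x; exact: resumed_ge0.
- by apply/measurable_EFinP; apply: measurable_funM => //; exact: mcy.
- by move=> x; rewrite lee_fin mulr_ge0.
move=> o t go ts; rewrite /resumed/=; case: ifPn => [/and3P[nT /andP[t0 tT] st]|_]; last first.
  by rewrite lee_fin mulr_ge0.
have st' : (Z n o).2 < t by rewrite lt_neqAle eq_sym ts st.
rewrite /chain_weight/= nT /next_density st' tT/=.
have := chain_state T0 go nT; move: st'; case: (Z n o) => w s /= st' sto.
exact: le.
Qed.

Let gap_chain n Y y : measurable_fun setT Y -> (forall x, 0 <= Y x) ->
  measurable_fun setT y -> (forall x, 0 <= y x) ->
  (forall t w s, state n w s -> (s < t)%R -> (t <= T)%R ->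
    resume f (fun w' => (Y ((t, (w, s)), w'))%:E) w s t = (f (t - s) * y (t, (w, s)))%:E)%E ->
  gap_integral n Y = chain_integral n y.
Proof.
move=> mY Y0 my y0 E; apply/eqP; rewrite eq_le gap_chain_le//=; last first.
  by move=> t w s sto st tT; rewrite E.
rewrite gap_resumed//; apply: (iterated_le (n := n)).
- by apply/measurable_EFinP; apply: measurable_funM => //; exact: mcy.
- by move=> x; rewrite lee_fin mulr_ge0.
- exact: measurable_resumed.
- by move=> x; exact: resumed_ge0.
move=> o t go ts; rewrite /chain_weight/= /next_density; case: ifPn => nT; last by rewrite mul0r resumed_ge0.
case: ifPn => [/andP[st tT]|_]; last by rewrite mul0r resumed_ge0.
have sto := chain_state T0 go nT.
have [/andP[s0 _] _ _ _] := sto.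
rewrite /resumed/= nT (ltW st) tT (le_trans s0 (ltW st))/=.
move: st sto; case: (Z n o) => w s /= st sto.
by rewrite E.
Qed.

Let mpiE : measurable_fun setT (fun x : C * config T => pi x.1.1 x.2).
Proof.
apply: (measurableT_comp (measurable_intensity T0 mf f0 f1) (g := fun x : C * config T => (x.1.1, x.2))).
apply: measurable_fun_pair; last exact: measurable_snd.
exact: (measurableT_comp measurable_fst measurable_fst).
Qed.

Let maddE : measurable_fun setT (fun x : C * config T => add_point x.1.1 x.2).
Proof.
apply: (measurableT_comp measurable_add_point (g := fun x : C * config T => (x.1.1, x.2))).
apply: measurable_fun_pair; last exact: measurable_snd.
exact: (measurableT_comp measurable_fst measurable_fst).
Qed.

Let mgap : measurable_fun setT (fun z : C => z.1 - z.2.2 : R).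
Proof.
apply: measurable_funB; first exact: measurable_fst.
exact: (measurableT_comp measurable_snd measurable_snd).
Qed.

Let mhaz : measurable_fun setT (fun z : C => hazard f (z.1 - z.2.2)).
Proof. exact: (measurableT_comp (measurable_hazard mf f0 f1) mgap). Qed.

Let haz0 t : 0 <= hazard f t. Proof. exact: hazard_ge0. Qed.
Let pi0 t w : 0 <= pi t w. Proof. exact: intensity_ge0. Qed.

Let mfstE y : measurable_fun setT y -> measurable_fun setT (fun x : C * config T => y x.1).
Proof. by move=> my; exact: (measurableT_comp my measurable_fst). Qed.

(** Against the intensity, a point is added at [t]. *)
Lemma gap_intensity n (b v : C -> R) (H : config T -> R) :
  measurable_fun setT b -> (forall x, 0 <= b x) ->
  measurable_fun setT v -> (forall x, 0 <= v x) ->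
  measurable_fun setT H -> (forall w, 0 <= H w) ->
  (forall t w s, state n w s -> s < t -> t <= T ->
    future_mean f (fun w => (H w)%:E) (add_point t w) t = (v (t, (w, s)))%:E) ->
  gap_integral n (fun x => b x.1 * (H (add_point x.1.1 x.2) * pi x.1.1 x.2)) =
  chain_integral n (fun z => b z * v z).
Proof.
move=> mb b0 mv v0 mH H0 E; apply: gap_chain.
- apply: measurable_funM; first exact: mfstE.
  by apply: measurable_funM => //; exact: (measurableT_comp mH maddE).
- by move=> x; rewrite !mulr_ge0.
- exact: measurable_funM.
- by move=> x; rewrite mulr_ge0.
move=> t w s sto st tT /=.
have mHE : measurable_fun setT (fun w => (H w)%:E) by exact/measurable_EFinP.
have HE0 w' : (0 <= (H w')%:E)%E by rewrite lee_fin.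
have := resume_intensity mf f0 f1 tailT fvanish sto st tT (Psi := fun w' => (H (add_point t w'))%:E)
  mHE HE0 (fun _ _ => erefl).
rewrite (E _ _ _ sto st tT) => R1; rewrite mulrCA EFinM [(f _ * v _)%:E]EFinM -R1 -resumeZ//.
- apply/measurable_EFinP; apply: measurable_funM.
    apply: (measurableT_comp mH); apply: (measurableT_comp measurable_add_point (g := fun w' => (t : RR, w'))).
    exact: measurable_fun_pair.
  exact: (measurable_fun_pair2 (f := fun p : RR * config T => pi p.1 p.2)
    _ (measurable_intensity T0 mf f0 f1)).
- by move=> w'; rewrite lee_fin mulr_ge0.
Qed.

(** The hazard rate turns the probability of waiting until [t] into the
    density of an arrival at [t]. *)
Lemma gap_hazard n (b v : C -> R) (H : config T -> R) :
  measurable_fun setT b -> (forall x, 0 <= b x) ->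
  measurable_fun setT v -> (forall x, 0 <= v x) ->
  measurable_fun setT H -> (forall w, 0 <= H w) ->
  (forall t w s, state n w s -> s < t -> t <= T ->
    resume f (fun w => (H w)%:E) w s t = (v (t, (w, s)) * tail f (t - s))%:E) ->
  gap_integral n (fun x => b x.1 * (hazard f (x.1.1 - x.1.2.2) * H x.2)) =
  chain_integral n (fun z => b z * v z).
Proof.
move=> mb b0 mv v0 mH H0 E; apply: gap_chain.
- apply: measurable_funM; first exact: mfstE.
  apply: measurable_funM; first exact: (mfstE mhaz).
  exact: (measurableT_comp mH measurable_snd).
- by move=> x; rewrite (mulr_ge0 (b0 _) (mulr_ge0 (haz0 _) (H0 _))).
- exact: measurable_funM.
- by move=> x; rewrite mulr_ge0.
move=> t w s sto st tT /=; have [/andP[s0 _] _ _ _] := sto.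
have mHE : measurable_fun setT (fun w => (H w)%:E) by exact/measurable_EFinP.
have HE0 w' : (0 <= (H w')%:E)%E by rewrite lee_fin.
have -> : (fun w' => (b (t, (w, s)) * (hazard f (t - s) * H w'))%:E) =
    (fun w' => (b (t, (w, s)) * hazard f (t - s))%:E * (H w')%:E)%E.
  by apply/funext => w'; rewrite -EFinM mulrA.
rewrite (resumeZ mf f0 f1 w s t (mulr_ge0 (b0 _) (haz0 _)) mHE HE0).
rewrite E// -EFinM; congr _%:E; rewrite /hazard.
have ne : tail f (t - s) != 0 by rewrite gt_eqF// (lt_le_trans tailT)// tail_nincr//; lra.
by field.
Qed.

Variables (G : config T -> R) (B : R).
Hypotheses (mG : measurable_fun setT G) (G0 : forall w, 0 <= G w) (GB : forall w, G w <= B).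

Let u (z : C) : R := jump f G z.2.1 z.2.2 z.1.
Let added (z : C) : R := cond_mean f G (add_point z.1 z.2.1) z.1.
Let before (z : C) : R := gap_mean f G z.2.1 z.2.2 z.1.
Let c : R := cond_mean f G (@no_points R T) 0.

Definition gap_dispersion (z : C) : R :=
  if (0 <= z.2.2) && ((z.2.2 <= z.1) && (z.1 <= T)) then dispersion T f z.2.2 z.1 else 0.

Lemma gap_dispersion_ge0 z : 0 <= gap_dispersion z.
Proof.
rewrite /gap_dispersion; case: ifPn => // /and3P[s0 st tT].
exact: (dispersion_ge0 mf f0 fneg f1 tailT h0 fh).
Qed.

Let mz2 : measurable_fun setT (fun z : C => z.2.2).
Proof. exact: (measurableT_comp measurable_snd measurable_snd). Qed.
Let mz1 : measurable_fun setT (fun z : C => z.1 : R).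
Proof. exact: measurable_fst. Qed.
Let mzw : measurable_fun setT (fun z : C => z.2.1).
Proof. exact: (measurableT_comp measurable_fst measurable_snd). Qed.

Let mdisp : measurable_fun setT gap_dispersion.
Proof.
apply: measurable_fun_ifT => //.
  apply: measurable_and; first exact: measurable_fun_ler.
  by apply: measurable_and; exact: measurable_fun_ler.
apply: (measurableT_comp (measurable_dispersion T mf f0 f1) (g := fun z : C => (z.2.2 : RR, z.1))).
by apply: measurable_fun_pair => //; exact: measurable_fst.
Qed.

Let mu_ : measurable_fun setT u.
Proof. exact: (measurable_jump mf f0 fneg f1 mG G0 GB). Qed.
Let madded : measurable_fun setT added.
Proof.
apply: (measurable_cond_mean mf f0 fneg f1 mG G0 GB) => //.
apply: (measurableT_comp measurable_add_point (g := fun z : C => (z.1, z.2.1))).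
by apply: measurable_fun_pair => //; exact: measurable_fst.
Qed.
Let mbefore_ : measurable_fun setT before.
Proof. exact: (measurable_gap_mean mf f0 f1 mG G0). Qed.

Let added0 z : 0 <= added z. Proof. exact: (cond_mean_ge0 mf f0 fneg f1 mG G0 GB). Qed.
Let before0 z : 0 <= before z. Proof. exact: gap_mean_ge0. Qed.
Let c0 : 0 <= c. Proof. exact: (cond_mean_ge0 mf f0 fneg f1 mG G0 GB). Qed.

Let up z := Num.max (u z) 0.
Let un z := Num.max (- u z) 0.
Let up0 z : 0 <= up z. Proof. by rewrite le_max lexx orbT. Qed.
Let un0 z : 0 <= un z. Proof. by rewrite le_max lexx orbT. Qed.
Let mup : measurable_fun setT up. Proof. exact: measurable_maxr. Qed.
Let mun : measurable_fun setT un.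
Proof. by apply: measurable_maxr => //; exact: measurableT_comp. Qed.
Let upun z : up z - un z = u z.
Proof.
rewrite /up /un; have [uz|uz] := leP (u z) 0.
  by rewrite max_l ?oppr_ge0// sub0r opprK.
by rewrite max_r ?subr0// oppr_le0 ltW.
Qed.

Let E_added n t w s : state n w s -> s < t -> t <= T ->
  future_mean f (fun w => (G w)%:E) (add_point t w) t = (added (t, (w, s)))%:E.
Proof. by move=> _ _ _; rewrite -(cond_meanE mf f0 fneg f1 mG G0 GB). Qed.

Let E_before n t w s : state n w s -> s < t -> t <= T ->
  resume f (fun w => (G w)%:E) w s t = (before (t, (w, s)) * tail f (t - s))%:E.
Proof.
by move=> [/andP[s0 _] _ _ _] st tT; rewrite (resumeE mf f0 fneg f1 tailT mG G0 GB)// ltW.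
Qed.

Let E_added1 n t w s : state n w s -> s < t -> t <= T ->
  future_mean f (fun=> 1%:E) (add_point t w) t = (1 : R)%:E.
Proof.
move=> [/andP[s0 _] _ _ _] st tT.
by rewrite (future_mean1 mf f0 fneg f1 tailT)// (le_trans s0)// ltW.
Qed.

Let E_before1 n t w s : state n w s -> s < t -> t <= T ->
  resume f (fun=> 1%:E) w s t = (1 * tail f (t - s))%:E.
Proof.
move=> [/andP[s0 _] _ _ _] st tT.
by rewrite (resume1 mf f0 fneg f1 tailT)// ?mul1r// ltW.
Qed.

Let chainD n y y' : measurable_fun setT y -> (forall x, 0 <= y x) ->
  measurable_fun setT y' -> (forall x, 0 <= y' x) ->
  chain_integral n (fun x => y x + y' x) = (chain_integral n y + chain_integral n y')%E.
Proof. by move=> my y0 my' y'0; apply: weightedD => //; exact: mcy. Qed.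

Let gapD n Y Y' : measurable_fun setT Y -> (forall x, 0 <= Y x) ->
  measurable_fun setT Y' -> (forall x, 0 <= Y' x) ->
  gap_integral n (fun x => Y x + Y' x) = (gap_integral n Y + gap_integral n Y')%E.
Proof. by move=> mY Y0 mY' Y'0; apply: weightedD => //; exact: mgY. Qed.

Let gapZ n k Y : 0 <= k -> measurable_fun setT Y -> (forall x, 0 <= Y x) ->
  gap_integral n (fun x => k * Y x) = (k%:E * gap_integral n Y)%E.
Proof. by move=> k0 mY Y0; apply: weightedZ => //; exact: mgY. Qed.

(** The weight [b] goes with the functional with an added point, and [b'] with
    the functional before it. The same is done for the constant functional [c]
    with the weights exchanged, which amounts to subtracting it while all terms
    stay nonnegative. *)
Let mixed n (b b' : C -> R) : measurable_fun setT b -> (forall x, 0 <= b x) ->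
  measurable_fun setT b' -> (forall x, 0 <= b' x) ->
  gap_integral n (fun x => b x.1 * (G (add_point x.1.1 x.2) * pi x.1.1 x.2) +
    b' x.1 * (hazard f (x.1.1 - x.1.2.2) * G x.2) +
    (c * b' x.1 * (1 * pi x.1.1 x.2) + c * b x.1 * (hazard f (x.1.1 - x.1.2.2) * 1))) =
  chain_integral n (fun z => b z * added z + b' z * before z + (c * b' z * 1 + c * b z * 1)).
Proof.
move=> mb b0 mb' b'0.
have mGA : measurable_fun setT (fun x : C * config T => G (add_point x.1.1 x.2)).
  exact: (measurableT_comp mG maddE).
have mG2 : measurable_fun setT (fun x : C * config T => G x.2).
  exact: (measurableT_comp mG measurable_snd).
have mc (e : C -> R) : measurable_fun setT e -> measurable_fun setT (fun z => c * e z).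
  by move=> me; exact: measurable_funM.
have mcE := mfstE (mc _ mb); have mcE' := mfstE (mc _ mb').
have mbE := mfstE mb; have mbE' := mfstE mb'; have mhE := mfstE mhaz.
have n1 x : 0 <= b x.1 * (G (add_point x.1.1 x.2) * pi x.1.1 x.2) by rewrite !mulr_ge0.
have n2 (x : C * config T) : 0 <= b' x.1 * (hazard f (x.1.1 - x.1.2.2) * G x.2).
  by rewrite (mulr_ge0 (b'0 _) (mulr_ge0 (haz0 _) (G0 _))).
have n3 (x : C * config T) : 0 <= c * b' x.1 * (1 * pi x.1.1 x.2) by rewrite !mulr_ge0.
have n4 (x : C * config T) : 0 <= c * b x.1 * (hazard f (x.1.1 - x.1.2.2) * 1).
  by rewrite mulr1 (mulr_ge0 (mulr_ge0 c0 (b0 _)) (haz0 _)).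
rewrite gapD; last 4 first.
- by apply: measurable_funD; do 2 (apply: measurable_funM => //).
- by move=> x; rewrite addr_ge0.
- by apply: measurable_funD; do 2 (apply: measurable_funM => //).
- by move=> x; rewrite addr_ge0.
rewrite gapD//; [|by do 2 (apply: measurable_funM => //)..].
rewrite gapD//; [|by do 2 (apply: measurable_funM => //)..].
have ca : forall z, 0 <= c * b z by move=> z; rewrite mulr_ge0.
have ca' : forall z, 0 <= c * b' z by move=> z; rewrite mulr_ge0.
rewrite (gap_intensity (v := added) mb b0 madded added0 mG G0 (@E_added n)).
rewrite (gap_hazard (v := before) mb' b'0 mbefore_ before0 mG G0 (@E_before n)).
rewrite (gap_intensity (b := fun z => c * b' z) (v := fun=> 1) (H := fun=> 1)
  (mc _ mb') ca' _ _ _ _ (@E_added1 n))//.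
rewrite (gap_hazard (b := fun z => c * b z) (v := fun=> 1) (H := fun=> 1)
  (mc _ mb) ca _ _ _ _ (@E_before1 n))//.
rewrite chainD; last 4 first.
- by apply: measurable_funD; exact: measurable_funM.
- by move=> x; rewrite addr_ge0// mulr_ge0.
- by apply: measurable_funD; apply: measurable_funM => //; exact: mc.
- by move=> x; rewrite addr_ge0// mulr1.
rewrite chainD//; last 4 first.
- exact: measurable_funM.
- by move=> x; rewrite mulr_ge0.
- exact: measurable_funM.
- by move=> x; rewrite mulr_ge0.
rewrite chainD//; last 4 first.
- by apply: measurable_funM => //; exact: mc.
- by move=> x; rewrite mulr1.
- by apply: measurable_funM => //; exact: mc.
- by move=> x; rewrite mulr1.
Qed.

Let jumpE z : u z = added z - before z. Proof. by []. Qed.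

Let B0 : 0 <= B. Proof. exact: le_trans (G0 point) (GB _). Qed.

Let x2_ge0 z : 0 <= un z * added z + up z * before z + (c * up z * 1 + c * un z * 1).
Proof. by apply: addr_ge0; apply: addr_ge0; rewrite ?mulr1; apply: mulr_ge0. Qed.

Let mx2 : measurable_fun setT (fun z : C =>
  un z * added z + up z * before z + (c * up z * 1 + c * un z * 1)).
Proof.
apply: measurable_funD; first by apply: measurable_funD; exact: measurable_funM.
by apply: measurable_funD; apply: measurable_funM => //; exact: measurable_funM.
Qed.

(** It will be cancelled from an inequality. *)
Let mixed_finite n :
  (chain_integral n (fun z => (un z * added z + up z * before z + (c * up z * 1 + c * un z * 1))%R) < +oo)%E.
Proof.
pose g (x : Omega * RR) : \bar R := ((B ^+ 2 *+ 4)%:E * (chain_weight n x)%:E)%E.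
have mcwE : measurable_fun setT (fun x => (chain_weight n x)%:E) by exact/measurable_EFinP.
have B4 : 0 <= B ^+ 2 *+ 4 by rewrite mulrn_wge0// sqr_ge0.
apply: (@le_lt_trans _ _ (\int[P \x mu]_x g x)%E).
  apply: (iterated_le (n := n)).
  - by apply/measurable_EFinP; apply: measurable_funM; [exact: mcw|exact: (mcy n mx2)].
  - by move=> x; rewrite lee_fin; apply: mulr_ge0; [exact: cw0|exact: x2_ge0].
  - exact: emeasurable_funM.
  - by move=> x; rewrite mule_ge0// lee_fin.
  move=> o t go ts; rewrite /g -EFinM lee_fin [leRHS]mulrC.
  rewrite /chain_weight/=; case: ifPn => [nT|_]; last by rewrite !mul0r.
  rewrite /next_density; case: ifPn => [/andP[st tT]|_]; last by rewrite !mul0r.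
  rewrite ler_wpM2l//; have [/andP[s0 _] _ _ _] := chain_state T0 go nT.
  have uB : `|u (t, Z n o)| <= B by exact: (jump_bounded mf f0 fneg f1 tailT mG G0 GB _ s0 (ltW st) tT).
  have upB : up (t, Z n o) <= B.
    by rewrite ge_max B0 andbT (le_trans _ uB)// ler_norm.
  have unB : un (t, Z n o) <= B.
    by rewrite ge_max B0 andbT (le_trans _ uB)// -normrN ler_norm.
  have aB : added (t, Z n o) <= B by exact: (cond_mean_le mf f0 fneg f1 mG G0 GB).
  have bB : before (t, Z n o) <= B by exact: (gap_mean_le mf f0 fneg f1 tailT mG G0 GB _ s0 (ltW st) tT).
  have cB : c <= B by exact: (cond_mean_le mf f0 fneg f1 mG G0 GB).
  rewrite (_ : B ^+ 2 *+ 4 = B * B + B * B + (B * B + B * B)); last by ring.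
  by rewrite !mulr1 !lerD// ler_pM.
rewrite /g ge0_integralZl_EFin//.
- rewrite (fubini_tonelli1 (m1 := P) (m2 := mu) _ mcwE); last by move=> x; rewrite lee_fin.
  apply: (@le_lt_trans _ _ ((B ^+ 2 *+ 4)%:E * 1)%E); last by rewrite mule1 ltry.
  rewrite lee_wpmul2l ?lee_fin//.
  apply: (@le_trans _ _ (\int[P]_o 1)%E); last first.
    by rewrite integral_cst// mul1e probability_le1.
  apply: ae_ge0_le_integral => //.
  - by move=> o _; apply: integral_ge0 => t _; rewrite lee_fin.
  - by apply: (measurable_fun_fubini_tonelli_F (m2 := mu)) => // x; rewrite lee_fin.
  apply: filterS ae_good => o go _; rewrite /fubini_F /chain_weight/=; have [nT|nT] := boolP ((Z n o).2 <= T); last first.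
    by rewrite integral0.
  have [/andP[s0 sT] _ _ _] := chain_state T0 go nT.
  apply: le_trans (next_density_mass_le mf f0 fneg f1 s0 sT) _.
  by rewrite lee_fin gerBl tail_ge0.
- by move=> x _; rewrite lee_fin.
Qed.

Let amgm (a x y : R) : 0 < a -> x * y <= a / 2 * x ^+ 2 + (2 * a)^-1 * y ^+ 2.
Proof.
move=> a0; rewrite -subr_ge0.
have -> : a / 2 * x ^+ 2 + (2 * a)^-1 * y ^+ 2 - x * y = (2 * a)^-1 * (a * x - y) ^+ 2.
  by field; rewrite gt_eqF.
by rewrite mulr_ge0 ?sqr_ge0// invr_ge0 mulr_ge0// ltW.
Qed.

Variables (q e : R).
Hypotheses (q0 : 0 < q) (q1 : q < 1) (e0 : 0 < e).

Let K (z : C) := gap_dispersion z + e.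
Let K0 z : 0 < K z. Proof. by rewrite ltr_wpDl// gap_dispersion_ge0. Qed.
Let mK : measurable_fun setT K. Proof. exact: measurable_funD. Qed.

Definition gradient (x : C * config T) : R :=
  pi x.1.1 x.2 * (G (add_point x.1.1 x.2) - G x.2) ^+ 2.

Definition deviation (x : C * config T) : R := (gap_dispersion x.1 + e) * (G x.2 - c) ^+ 2.

Let mgrad : measurable_fun setT gradient.
Proof.
apply: measurable_funM => //; apply: measurable_funX; apply: measurable_funB.
  exact: (measurableT_comp mG maddE).
exact: (measurableT_comp mG measurable_snd).
Qed.
Let grad0 x : 0 <= gradient x. Proof. by rewrite mulr_ge0// sqr_ge0. Qed.
Let mdev : measurable_fun setT deviation.
Proof.
apply: measurable_funM; first exact: (mfstE mK).
apply: measurable_funX; apply: measurable_funB => //.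
exact: (measurableT_comp mG measurable_snd).
Qed.
Let dev0 x : 0 <= deviation x. Proof. exact: mulr_ge0 (ltW (K0 _)) (sqr_ge0 _). Qed.

Let mu2 : measurable_fun setT (fun z : C => u z ^+ 2).
Proof. exact: measurable_funX. Qed.

(** The denominator [K] cancels the dispersion of the intensity. *)
Let gap_spread n :
  (gap_integral n (fun x => (u x.1 ^+ 2 / K x.1 * (pi x.1.1 x.2 - hazard f (x.1.1 - x.1.2.2)) ^+ 2)%R) <=
   chain_integral n (fun z => (u z ^+ 2)%R))%E.
Proof.
have muK : measurable_fun setT (fun z : C => u z ^+ 2 / K z).
  by apply: measurable_funM => //; exact: measurable_funV.
have uK0 z : 0 <= u z ^+ 2 / K z by rewrite divr_ge0 ?sqr_ge0 ?(ltW (K0 z)).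
apply: gap_chain_le.
- apply: measurable_funM; first exact: (mfstE muK).
  by apply: measurable_funX; apply: measurable_funB => //; exact: (mfstE mhaz).
- by move=> x; exact: mulr_ge0 (uK0 _) (sqr_ge0 _).
- by [].
- by move=> x; exact: sqr_ge0.
move=> t w s sto st tT /=; have [/andP[s0 sT] _ _ _] := sto.
have mS : measurable_fun setT (fun w' : config T => ((pi t w' - hazard f (t - s)) ^+ 2)%:E).
  apply/measurable_EFinP; apply: measurable_funX; apply: measurable_funB; last exact: measurable_cst.
  exact: (measurable_fun_pair2 (f := fun p : RR * config T => pi p.1 p.2)
    _ (measurable_intensity T0 mf f0 f1)).
have S0 (w' : config T) : (0 <= ((pi t w' - hazard f (t - s)) ^+ 2)%:E)%E by rewrite lee_fin sqr_ge0.
have -> : (fun w' => (u (t, (w, s)) ^+ 2 / K (t, (w, s)) * (pi t w' - hazard f (t - s)) ^+ 2)%:E) =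
    (fun w' => (u (t, (w, s)) ^+ 2 / K (t, (w, s)))%:E * ((pi t w' - hazard f (t - s)) ^+ 2)%:E)%E.
  by apply/funext => w'; rewrite -EFinM.
rewrite (resumeZ mf f0 f1 w s t (uK0 _) mS S0).
apply: (@le_trans _ _ ((u (t, (w, s)) ^+ 2 / K (t, (w, s)))%:E * (f (t - s) * dispersion T f s t)%:E)%E).
  rewrite lee_wpmul2l ?lee_fin//.
  exact: (resume_dispersion mf f0 fneg f1 tailT h0 fh sto st tT).
rewrite -EFinM lee_fin mulrAC ler_pdivrMr// mulrCA mulrA; apply: ler_wpM2l.
  by apply: mulr_ge0 => //; exact: sqr_ge0.
by rewrite /K /gap_dispersion/= s0 (ltW st) tT/= lerDl ltW.
Qed.

(** With the positive and the negative part of the jump [u] as weights, and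
    conversely, two mixed integrals differ on the chain by the integral of
    [u ^ 2], and in the gaps by that of
    [u * (pi * D_t G + (pi - hazard) * (G - c))]. The inequality of arithmetic and geometric means applies to both terms. *)
Lemma jump_mass_le n : (jump_mass f tau G n <=
  (2^-1)%:E * jump_mass f tau G n + (((2 * (1 - q))^-1)%:E * gap_integral n gradient +
    ((2 * q)^-1)%:E * gap_integral n deviation))%E.
Proof.
have jE : chain_integral n (fun z => u z ^+ 2) = jump_mass f tau G n.
  rewrite /chain_integral /weighted (fubini_tonelli1 (m1 := P) (m2 := mu)); last 2 first.
  - by apply/measurable_EFinP; apply: measurable_funM; [exact: mcw|exact: (mcy n mu2)].
  - by move=> x; rewrite lee_fin mulr_ge0// sqr_ge0.
  apply: eq_integral => o _; rewrite /fubini_F /chain_weight/=.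
  have [nT|nT] := boolP ((Z n o).2 <= T) => //.
  by rewrite integral0_eq// => t _; rewrite mul0r.
rewrite -jE; set A := chain_integral n _.
pose X1 (x : C * config T) := up x.1 * (G (add_point x.1.1 x.2) * pi x.1.1 x.2) +
    un x.1 * (hazard f (x.1.1 - x.1.2.2) * G x.2) +
    (c * un x.1 * (1 * pi x.1.1 x.2) + c * up x.1 * (hazard f (x.1.1 - x.1.2.2) * 1)).
pose X2 (x : C * config T) := un x.1 * (G (add_point x.1.1 x.2) * pi x.1.1 x.2) +
    up x.1 * (hazard f (x.1.1 - x.1.2.2) * G x.2) +
    (c * up x.1 * (1 * pi x.1.1 x.2) + c * un x.1 * (hazard f (x.1.1 - x.1.2.2) * 1)).
pose x2 z := un z * added z + up z * before z + (c * up z * 1 + c * un z * 1).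
pose Q1 (x : C * config T) := u x.1 ^+ 2 * (1 * pi x.1.1 x.2).
pose Q3 (x : C * config T) := u x.1 ^+ 2 / K x.1 * (pi x.1.1 x.2 - hazard f (x.1.1 - x.1.2.2)) ^+ 2.
pose Q x := (1 - q) / 2 * Q1 x + q / 2 * Q3 x +
  ((2 * (1 - q))^-1 * gradient x + (2 * q)^-1 * deviation x).
have mGA : measurable_fun setT (fun x : C * config T => G (add_point x.1.1 x.2)).
  exact: (measurableT_comp mG maddE).
have mG2 : measurable_fun setT (fun x : C * config T => G x.2).
  exact: (measurableT_comp mG measurable_snd).
have mupE := mfstE mup; have munE := mfstE mun; have mhE := mfstE mhaz.
have mX1 : measurable_fun setT X1.
  by apply: measurable_funD; apply: measurable_funD; do 2 (apply: measurable_funM => //); exact: measurable_funM.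
have mX2 : measurable_fun setT X2.
  by apply: measurable_funD; apply: measurable_funD; do 2 (apply: measurable_funM => //); exact: measurable_funM.
have X10 x : 0 <= X1 x.
  by apply: addr_ge0; apply: addr_ge0; rewrite ?mulr1 ?mul1r; do 2 apply: mulr_ge0 => //; exact: mulr_ge0.
have X20 x : 0 <= X2 x.
  by apply: addr_ge0; apply: addr_ge0; rewrite ?mulr1 ?mul1r; do 2 apply: mulr_ge0 => //; exact: mulr_ge0.
have mQ1 : measurable_fun setT Q1.
  by apply: measurable_funM; [exact: (mfstE mu2)|exact: measurable_funM].
have mQ3 : measurable_fun setT Q3.
  apply: measurable_funM; last by apply: measurable_funX; exact: measurable_funB.
  apply: measurable_funM; first exact: (mfstE mu2).
  by apply: measurable_funV; exact: (mfstE mK).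
have Q10 x : 0 <= Q1 x by apply: mulr_ge0; rewrite ?mul1r ?sqr_ge0.
have Q30 x : 0 <= Q3 x.
  by apply: mulr_ge0; rewrite ?sqr_ge0// divr_ge0 ?sqr_ge0 ?(ltW (K0 _)).
have p1 : 0 <= (1 - q) / 2 by rewrite divr_ge0// subr_ge0 ltW.
have p2 : 0 <= q / 2 by rewrite divr_ge0// ltW.
have p3 : 0 <= (2 * (1 - q))^-1 by rewrite invr_ge0 mulr_ge0// subr_ge0 ltW.
have p4 : 0 <= (2 * q)^-1 by rewrite invr_ge0 mulr_ge0// ltW.
have mZl k (Y : C * config T -> R) : measurable_fun setT Y -> measurable_fun setT (fun x => k * Y x).
  by move=> mY; exact: measurable_funM.
have X1Q x : X1 x <= X2 x + Q x.
  rewrite -lerBlDl.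
  have -> : X1 x - X2 x = pi x.1.1 x.2 * (u x.1 * (G (add_point x.1.1 x.2) - G x.2)) +
      u x.1 * (pi x.1.1 x.2 - hazard f (x.1.1 - x.1.2.2)) * (G x.2 - c).
    by rewrite -upun /X1 /X2; ring.
  rewrite /Q [leRHS](_ : _ = ((1 - q) / 2 * Q1 x + (2 * (1 - q))^-1 * gradient x) +
    (q / 2 * Q3 x + (2 * q)^-1 * deviation x)); last by ring.
  apply: lerD.
    rewrite [leRHS](_ : _ = pi x.1.1 x.2 * ((1 - q) / 2 * u x.1 ^+ 2 +
        (2 * (1 - q))^-1 * (G (add_point x.1.1 x.2) - G x.2) ^+ 2)).
      by rewrite ler_wpM2l// amgm// subr_gt0.
    by rewrite /Q1 /gradient; ring.
  apply: le_trans (amgm _ _ (divr_gt0 q0 (K0 x.1))) _.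
  rewrite le_eqVlt; apply/orP; left; apply/eqP; rewrite /Q3 /deviation -/(K x.1).
  have Kn : K x.1 != 0 by rewrite gt_eqF.
  have qn : q != 0 by rewrite gt_eqF.
  by field; rewrite Kn qn.
have le1 : (gap_integral n X1 <= gap_integral n X2 + gap_integral n Q)%E.
  rewrite -gapD//; last 2 first.
  - by apply: measurable_funD; apply: measurable_funD; exact: mZl.
  - by move=> x; rewrite !addr_ge0// mulr_ge0.
  apply: weighted_le => //; first exact: mgY.
  apply: (mgY n (Y := fun x => X2 x + Q x)); apply: measurable_funD => //.
  by apply: measurable_funD; apply: measurable_funD; exact: mZl.
have E1 : gap_integral n X1 = (A + chain_integral n x2)%E.
  rewrite (mixed n mup up0 mun un0) -(chainD n mu2 (fun _ => sqr_ge0 _) mx2 x2_ge0).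
  congr chain_integral; apply/funext => z; rewrite /x2.
  have upE : up z = un z + (added z - before z) by rewrite -jumpE -upun; ring.
  by rewrite jumpE upE; ring.
have E2 : gap_integral n X2 = chain_integral n x2 by exact: (mixed n mun un0 mup up0).
have x2fin : chain_integral n x2 \is a fin_num.
  rewrite ge0_fin_numE; first exact: mixed_finite.
  by apply: weighted_ge0 => // x; exact: x2_ge0.
have EQ : gap_integral n Q = (((1 - q) / 2)%:E * gap_integral n Q1 + (q / 2)%:E * gap_integral n Q3 +
   (((2 * (1 - q))^-1)%:E * gap_integral n gradient + ((2 * q)^-1)%:E * gap_integral n deviation))%E.
  rewrite gapD; last 4 first.
  - by apply: measurable_funD; exact: mZl.
  - by move=> x; rewrite addr_ge0// mulr_ge0.
  - by apply: measurable_funD; exact: mZl.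
  - by move=> x; rewrite addr_ge0// mulr_ge0.
  rewrite gapD; last 4 first.
  - exact: mZl.
  - by move=> x; rewrite mulr_ge0.
  - exact: mZl.
  - by move=> x; rewrite mulr_ge0.
  rewrite gapD; last 4 first.
  - exact: mZl.
  - by move=> x; rewrite mulr_ge0.
  - exact: mZl.
  - by move=> x; rewrite mulr_ge0.
  by rewrite !gapZ.
have EQ1 : gap_integral n Q1 = A.
  rewrite (gap_intensity (b := fun z => u z ^+ 2) (v := fun=> 1) (H := fun=> 1)
    mu2 (fun _ => sqr_ge0 _) _ _ _ _ (@E_added1 n))//.
  by congr chain_integral; apply/funext => z; rewrite mulr1.
have A0 : (0 <= A)%E by apply: weighted_ge0 => // x; exact: sqr_ge0.
move: le1; rewrite E1 E2 addeC leeD2lE// EQ EQ1 => /le_trans; apply.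
rewrite leeD2r//; apply: (@le_trans _ _ (((1 - q) / 2)%:E * A + (q / 2)%:E * A)%E).
  by rewrite leeD2l// lee_wpmul2l ?lee_fin//; exact: gap_spread.
rewrite -ge0_muleDl ?lee_fin// -EFinD.
by rewrite (_ : (1 - q) / 2 + q / 2 = 2^-1)//; field.
Qed.

End bounded_inequality.

(** * From the gaps to the whole interval *)

Section gamma_bound.
Context {R : realType} (T : R) (f : R -> R).
Local Notation mu := (@lebesgue_measure R).
Local Notation RR := (measurableTypeR R).

Hypothesis f0 : forall x, 0 <= f x.
Hypothesis ratio_fin : forall z : R, 0 <= z <= T -> (ratio_sup T f z < +oo)%E.

Let ratio_ge0 (x y : R) : (0 <= (f x)%:E / (f y)%:E)%E.
Proof. by rewrite mule_ge0 ?lee_fin// inve_ge0 lee_fin. Qed.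

Definition ratio_bound z : R := fine (ratio_sup T f z).

Let ratio_sup_ge0 z : z <= T -> (0 <= ratio_sup T f z)%E.
Proof.
move=> zT; apply: le_trans (ratio_ge0 (z - z) z) _.
by apply: ereal_sup_ubound; exists z => //=; rewrite in_itv/= lexx.
Qed.

Lemma ratio_boundE z : 0 <= z <= T -> ratio_sup T f z = (ratio_bound z)%:E.
Proof.
move=> zT; rewrite fineK// ge0_fin_numE ?ratio_fin// ratio_sup_ge0//.
by case/andP: zT.
Qed.

Lemma ratio_bound_ge0 z : 0 <= ratio_bound z.
Proof.
have [zT|Tz] := leP z T; first by rewrite fine_ge0// ratio_sup_ge0.
rewrite /ratio_bound /ratio_sup set_itv_ge; first by rewrite image_set0 ereal_sup0.
by rewrite bnd_simp -ltNge.
Qed.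

Lemma ratio_boundP x z : 0 <= z -> z <= x -> x <= T -> f (x - z) <= ratio_bound z * f x.
Proof.
move=> z0 zx xT.
have zT : 0 <= z <= T by rewrite z0 (le_trans zx).
have : ((f (x - z))%:E / (f x)%:E <= (ratio_bound z)%:E)%E.
  rewrite -ratio_boundE//; apply: ereal_sup_ubound; exists x => //=.
  by rewrite in_itv/= zx.
rewrite inver; have [->|fx] := eqVneq (f x) 0; last first.
  by rewrite -EFinM lee_fin ler_pdivrMr// lt_neqAle eq_sym fx f0.
have [->|fxz] := eqVneq (f (x - z)) 0; first by rewrite mulr0.
by rewrite gt0_muley ?leye_eq// lte_fin lt_neqAle eq_sym fxz f0.
Qed.

Let ge0_le_integral_any (g k : R -> \bar R) :
  (forall t, 0 <= g t)%E -> (forall t, g t <= k t)%E -> (\int[mu]_t g t <= \int[mu]_t k t)%E.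
Proof.
move=> g0 gk; have k0 t : (0 <= k t)%E by exact: le_trans (gk t).
rewrite !ge0_integralTE//; apply: ub_ereal_sup => _ [s gs <-].
by apply: ereal_sup_ubound; exists s => // x; exact: le_trans (gs x) (gk x).
Qed.

Hypothesis mf : measurable_fun setT f.
Hypothesis fneg : forall x : R, x < 0 -> f x = 0.
Hypothesis f1 : (\int[mu]_x (f x)%:E = 1)%E.
Hypothesis tailT : 0 < tail f T.

(** The supremum in [gamma_const] need not be measurable in [t], but the
    integral of a nonnegative function is a supremum over the simple functions
    below it, hence monotone without measurability. *)
Lemma dispersion_gamma (s : R -> R) : (forall t, 0 <= t <= T -> 0 <= s t <= t) ->
  (\int[mu]_(t in `[0%R, T]) (dispersion T f (s t) t)%:E <= gamma_const T f)%E.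
Proof.
move=> sP; rewrite /gamma_const integral_mkcond [leRHS]integral_mkcond.
apply: ge0_le_integral_any => t; rewrite !patchE mem_setE in_itv/=; case: ifPn => // tT.
  have /andP[s0 st] := sP _ tT; have /andP[_ {}tT] := tT.
  rewrite lee_fin.
  exact: (dispersion_ge0 mf f0 fneg f1 tailT ratio_bound_ge0 ratio_boundP).
have /andP[s0 st] := sP _ tT; have /andP[t0 {}tT] := tT.
apply: (@le_trans _ _ (f (t - s t) *
    (tail f (T - t) ^+ 2 / tail f (T - s t) +
     ratio_bound (t - s t) ^+ 2 * (tail f (t - s t) - tail f (T - s t)) - (tail f (t - s t))^-1))%:E).
  rewrite lee_fin.
  exact: (dispersion_le mf f0 f1 ratio_bound_ge0 ratio_boundP).
apply: ereal_sup_ubound; exists (t - s t) => /=.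
  by rewrite in_itv/= subr_ge0 st lerBlDr lerDl.
rewrite ratio_boundE; last by rewrite subr_ge0 st (le_trans _ tT)// lerBlDr lerDl.
by rewrite (_ : T - t + (t - s t) = T - s t)//; ring.
Qed.

End gamma_bound.

Section variance_bounded.
Context {R : realType} {T : R} (f : R -> R).
Local Notation mu := (@lebesgue_measure R).
Local Notation RR := (measurableTypeR R).
Local Notation pi := (renewal_intensity f).

Hypothesis T0 : 0 <= T.
Hypothesis mf : measurable_fun setT f.
Hypothesis f0 : forall x, 0 <= f x.
Hypothesis fneg : forall x : R, x < 0 -> f x = 0.
Hypothesis f1 : (\int[mu]_x (f x)%:E = 1)%E.
Hypothesis tailT : 0 < tail f T.
Hypothesis cf : {within `[0, +oo[, continuous f}.
Hypothesis ratio_fin : forall z : R, 0 <= z <= T -> (ratio_sup T f z < +oo)%E.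

Context d (Omega : measurableType d) (P : probability Omega R).
Variables (N : {RV P >-> config T}) (tau : nat -> {RV P >-> R}).
Hypothesis indep : mutually_independent tau.
Hypothesis dens : forall i A, measurable A ->
  distribution P (tau i) A = (\int[mu]_(u in A) (f u)%:E)%E.
Hypothesis NE : {ae P, forall o : Omega, forall A : set RR, measurable A ->
  N o A = (\sum_(1 <= n <oo) \d_(arrival tau n o) (A `&` `[0%R, T]))%E}.

Local Notation Z n o := (chain T tau n o).
Local Notation C := (RR * (config T * R))%type.

Let ae_good := ae_good_path fneg dens NE.
Let mN : measurable_fun setT N. Proof. exact: measurable_funP. Qed.
Let mZ n : measurable_fun setT (chain T tau n). Proof. exact: measurable_chain. Qed.

Let gap0 := ratio_bound_ge0 T f0.
Let gapP := ratio_boundP f0 ratio_fin.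

Let m1 : measurable_fun setT (@fst Omega RR). Proof. exact: measurable_fst. Qed.
Let mZx n : measurable_fun setT (fun x : Omega * RR => Z n x.1).
Proof. exact: (measurableT_comp (mZ n) m1). Qed.
Let mNx : measurable_fun setT (fun x : Omega * RR => N x.1).
Proof. exact: (measurableT_comp mN m1). Qed.
Let mnpx : measurable_fun setT (fun x : Omega * RR => npoints (N x.1) x.2).
Proof.
apply: (measurableT_comp measurable_npoints (g := fun x : Omega * RR => (x.2, N x.1))).
by apply: measurable_fun_pair => //; exact: measurable_snd.
Qed.
Let mitv : measurable_fun setT (fun x : Omega * RR => 0 <= x.2 <= T).
Proof.
by apply: measurable_and; apply: measurable_fun_ler => //; exact: measurable_snd.
Qed.

Let itvE (g : R -> \bar R) : (\int[mu]_(t in `[0%R, T]) g t =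
  \int[mu]_t (if (0 <= t <= T)%R then g t else 0))%E.
Proof.
rewrite integral_mkcond; apply: eq_integral => t _.
by rewrite patchE mem_setE in_itv.
Qed.

Section sum.
Variable Y : C * config T -> R.
Hypotheses (mY : measurable_fun setT Y) (Y0 : forall x, 0 <= Y x).

Let coord (x : Omega * RR) := ((x.2, Z (npoints (N x.1) x.2) x.1) : C, N x.1).

Let mcoord : measurable_fun setT coord.
Proof.
apply: measurable_fun_pair => //; apply: measurable_fun_pair; first exact: measurable_snd.
exact: (measurable_fun_dispatch (h := fun n (x : Omega * RR) => Z n x.1) mnpx mZx).
Qed.

Let total x : \bar R := if 0 <= x.2 <= T then (Y (coord x))%:E else 0%E.

Let mtotal : measurable_fun setT total.
Proof.
apply: measurable_fun_ifT => //; apply/measurable_EFinP.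
exact: (measurableT_comp mY mcoord).
Qed.

Let total0 x : (0 <= total x)%E.
Proof. by rewrite /total; case: ifP => // _; rewrite lee_fin. Qed.

Lemma measurable_total : measurable_fun setT (fun o =>
  \int[mu]_(t in `[0%R, T]) (Y ((t, Z (npoints (N o) t) o), N o))%:E)%E.
Proof.
rewrite (_ : (fun o => _) = (fun o => \int[mu]_t total (o, t))%E); last first.
  by apply/funext => o; rewrite itvE.
exact: (measurable_fun_fubini_tonelli_F (m2 := mu)).
Qed.

Lemma measurable_total_at o : measurable_fun (`[0%R, T]%classic : set RR)
  (fun t : RR => (Y ((t, Z (npoints (N o) t) o), N o))%:E).
Proof.
apply: measurable_funTS; apply: (measurable_fun_pair2 (f := fun x => (Y (coord x))%:E)).
by apply/measurable_EFinP; exact: (measurableT_comp mY mcoord).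
Qed.

(** Every time lies in one gap. *)
Lemma gap_sum : (\sum_(n <oo) gap_integral N tau n Y =
  \int[P]_o \int[mu]_(t in `[0%R, T]) (Y ((t, Z (npoints (N o) t) o), N o))%:E)%E.
Proof.
pose g n (x : Omega * RR) := (gap_weight N n x * Y ((x.2, Z n x.1), N x.1))%:E.
have mg n : measurable_fun setT (g n).
  apply/measurable_EFinP; apply: measurable_funM.
    apply: measurable_fun_ifT => //; apply: measurable_and => //.
    exact: measurable_fun_eqn.
  apply: (measurableT_comp mY (g := fun x : Omega * RR => ((x.2, Z n x.1) : C, N x.1))).
  by apply: measurable_fun_pair => //; apply: measurable_fun_pair => //; exact: measurable_snd.
have g0 n x : (0 <= g n x)%E.
  by rewrite lee_fin mulr_ge0// /gap_weight; case: ifP.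
transitivity (\int[P \x mu]_x \sum_(n <oo) g n x)%E.
  by rewrite integral_nneseries.
transitivity (\int[P \x mu]_x total x)%E.
  apply: eq_integral => x _; rewrite /total; case: ifPn => xT; last first.
    by apply: eseries0 => n _ _; rewrite /g /gap_weight (negbTE xT) mul0r.
  rewrite (@nneseriesD1 _ _ (npoints (N x.1) x.2))// eseries0 ?adde0.
    by rewrite /g /gap_weight xT eqxx mul1r.
  by move=> n _ /= nx; rewrite /g /gap_weight xT eq_sym (negbTE nx) mul0r.
rewrite (fubini_tonelli1 (m1 := P) (m2 := mu) total mtotal total0).
by apply: eq_integral => o _; rewrite itvE.
Qed.

End sum.

Variables (G : config T -> R) (B : R).
Hypotheses (mG : measurable_fun setT G) (G0 : forall w, 0 <= G w) (GB : forall w, G w <= B).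

Local Notation c := (cond_mean f G (@no_points R T) 0).

Let mGN : measurable_fun setT (fun o => G (N o)).
Proof. exact: (measurableT_comp mG mN). Qed.

Let second_moment_fin : (\int[P]_o (G (N o) ^+ 2)%:E < +oo)%E.
Proof.
apply: (@le_lt_trans _ _ (\int[P]_o (B ^+ 2)%:E)%E).
  apply: ge0_le_integral => //.
  - by move=> o _; rewrite lee_fin sqr_ge0.
  - by apply/measurable_EFinP; exact: measurable_funX.
  - move=> o _; rewrite lee_fin; apply: lerXn2r; rewrite ?nnegrE//.
    exact: le_trans (G0 _) (GB (N o)).
rewrite integral_cst//; apply: (@le_lt_trans _ _ ((B ^+ 2)%:E * 1)%E); last by rewrite mule1 ltry.
by rewrite lee_wpmul2l ?probability_le1// lee_fin sqr_ge0.
Qed.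

(** The cross term is moved to the other side, so that all integrands are
    nonnegative. *)
Let varianceE : (\int[P]_o ((G (N o) - c) ^+ 2)%:E = \sum_(n <oo) jump_mass f tau G n)%E.
Proof.
have c0 : 0 <= c by exact: (cond_mean_ge0 mf f0 fneg f1 mG G0 GB).
have c20 : 0 <= 2 * c by rewrite mulr_ge0.
have mdev : measurable_fun setT (fun o => ((G (N o) - c) ^+ 2)%:E).
  by apply/measurable_EFinP; apply: measurable_funX; exact: measurable_funB.
have E : (\int[P]_o ((G (N o) - c) ^+ 2)%:E + (2 * c * c)%:E =
   \int[P]_o (G (N o) ^+ 2)%:E + (c ^+ 2)%:E)%E.
  transitivity (\int[P]_o (((G (N o) - c) ^+ 2)%:E + (2 * c * G (N o))%:E))%E.
    rewrite EFinM -(mean_G T0 mf f0 fneg f1 indep dens NE mG G0 GB).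
    rewrite -ge0_integralZl_EFin//; last 2 first.
    - by move=> o _; rewrite lee_fin.
    - exact/measurable_EFinP.
    apply/esym; apply: ge0_integralD; first exact: measurableT.
    - by move=> o _; rewrite lee_fin sqr_ge0.
    - exact: mdev.
    - by move=> o _; rewrite lee_fin mulr_ge0.
    - by apply/measurable_EFinP; exact: measurable_funM.
  transitivity (\int[P]_o ((G (N o) ^+ 2)%:E + (c ^+ 2)%:E))%E.
    by apply: eq_integral => o _; rewrite -!EFinD; congr _%:E; ring.
  transitivity (\int[P]_o (G (N o) ^+ 2)%:E + \int[P]_o (c ^+ 2)%:E)%E.
    apply: ge0_integralD; first exact: measurableT.
    - by move=> o _; rewrite lee_fin sqr_ge0.
    - by apply/measurable_EFinP; exact: measurable_funX.
    - by move=> o _; rewrite lee_fin sqr_ge0.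
    - exact: measurable_cst.
  rewrite integral_cst//; congr (_ + _)%E; rewrite -[RHS]mule1; congr (_ * _)%E.
  exact: probability_setT.
have V := variance_jumps T0 mf f0 fneg f1 tailT cf indep dens NE mG G0 GB.
have cancel (x y : \bar R) : (x + (2 * c * c)%:E = (y + (c ^+ 2)%:E) + (c ^+ 2)%:E)%E -> x = y.
  rewrite -addeA -EFinD (_ : c ^+ 2 + c ^+ 2 = 2 * c * c); last by ring.
  by move=> /(congr1 (fun x => x - (2 * c * c)%:E)%E); rewrite !addeK.
by apply: cancel; rewrite [RHS](congr1 (fun x => x + (c ^+ 2)%:E)%E V).
Qed.

Let sum_fin : (\sum_(n <oo) jump_mass f tau G n)%E \is a fin_num.
Proof.
rewrite ge0_fin_numE; last by apply: nneseries_ge0 => n _ _; exact: jump_mass_ge0.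
apply: le_lt_trans second_moment_fin.
rewrite -(variance_jumps T0 mf f0 fneg f1 tailT cf indep dens NE mG G0 GB).
by rewrite leeDl// lee_fin sqr_ge0.
Qed.

Variable q : R.
Hypotheses (q0 : 0 < q) (q1 : q < 1) (gq : (gamma_const T f < (q ^+ 2)%:E)%E).

(** The sum of [jump_mass_le] over the gaps bounds the variance by
    [1 / 2 + q / 2] times itself plus the energy divided by [2 * (1 - q)]; the factor [q / 2]
    is where [gamma_const] enters, through the dispersion, and [q] stands for a
    number slightly above its square root. *)
Lemma variance_bounded : (\int[P]_o ((G (N o) - c) ^+ 2)%:E <= ((1 - q) ^- 2)%:E *
  \int[P]_o \int[mu]_(t in `[0%R, T])
    (pi t (N o) * (G (add_point t (N o)) - G (N o)) ^+ 2)%:E)%E.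
Proof.
have gam0 : (0 <= gamma_const T f)%E.
  apply: le_trans (dispersion_gamma f0 ratio_fin mf fneg f1 tailT (s := fun=> 0) _).
    apply: integral_ge0 => t /=; rewrite in_itv/= => /andP[t0 tT]; rewrite lee_fin.
    exact: (dispersion_ge0 mf f0 fneg f1 tailT gap0 gapP).
  by move=> t /andP[t0 _]; rewrite lexx.
pose gam := fine (gamma_const T f).
have gamE : gamma_const T f = gam%:E.
  by rewrite fineK// ge0_fin_numE//; exact: lt_trans gq (ltry _).
have gam0' : 0 <= gam by rewrite fine_ge0.
have gq' : gam < q ^+ 2 by rewrite -lte_fin -gamE.
(* [e] keeps the weights positive where the dispersion vanishes, at a cost of
   at most [e * T]. *)
pose e := (q ^+ 2 - gam) / (T + 1).
have T1 : 0 < T + 1 by rewrite ltr_wpDl.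
have e0 : 0 < e by rewrite divr_gt0// subr_gt0.
have eT : gam + e * T <= q ^+ 2.
  rewrite -lerBrDl /e mulrAC ler_pdivrMr// ler_wpM2l//; first by rewrite subr_ge0 ltW.
  by rewrite lerDl.
have mgrad : measurable_fun setT (gradient f G : C * config T -> R).
  have mx : measurable_fun setT (fun x : C * config T => (x.1.1, x.2)).
    apply: measurable_fun_pair; last exact: measurable_snd.
    exact: (measurableT_comp measurable_fst measurable_fst).
  apply: measurable_funM; first exact: (measurableT_comp (measurable_intensity T0 mf f0 f1) mx).
  apply: measurable_funX; apply: measurable_funB; last exact: (measurableT_comp mG measurable_snd).
  apply: (measurableT_comp mG); exact: (measurableT_comp measurable_add_point mx).
have mK : measurable_fun setT (fun z : C => gap_dispersion f z + e).
  have mz : measurable_fun setT (fun z : C => z.2.2).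
    exact: (measurableT_comp measurable_snd measurable_snd).
  have mz1 : measurable_fun setT (fun z : C => z.1 : R) by exact: measurable_fst.
  apply: measurable_funD; last exact: measurable_cst.
  apply: measurable_fun_ifT => //.
    apply: measurable_and; first exact: measurable_fun_ler.
    by apply: measurable_and; exact: measurable_fun_ler.
  apply: (measurableT_comp (measurable_dispersion T mf f0 f1) (g := fun z : C => (z.2.2 : RR, z.1))).
  by apply: measurable_fun_pair => //; exact: measurable_fst.
have mdev : measurable_fun setT (deviation f G e : C * config T -> R).
  apply: measurable_funM; first exact: (measurableT_comp mK measurable_fst).
  apply: measurable_funX; apply: measurable_funB; last exact: measurable_cst.
  exact: (measurableT_comp mG measurable_snd).
have grad0 (x : C * config T) : 0 <= gradient f G x.
  by apply: mulr_ge0; [exact: intensity_ge0|exact: sqr_ge0].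
have K0 (z : C) : 0 <= gap_dispersion f z + e.
  by rewrite addr_ge0 ?(ltW e0)// (gap_dispersion_ge0 mf f0 fneg f1 tailT gap0 gapP).
have dev0 (x : C * config T) : 0 <= deviation f G e x.
  by apply: mulr_ge0; [exact: K0|exact: sqr_ge0].
set D := (\int[P]_o \int[mu]_(t in _) _)%E.
have DE : (\sum_(n <oo) gap_integral N tau n (gradient f G) = D)%E.
  by rewrite gap_sum.
set S := (\int[P]_o _)%E; have SE : S = _ := varianceE.
have S0 : (0 <= S)%E by apply: integral_ge0 => o _; rewrite lee_fin sqr_ge0.
have Sfin : S \is a fin_num by rewrite SE.
have WE : (\sum_(n <oo) gap_integral N tau n (deviation f G e) <= (q ^+ 2)%:E * S)%E.
  have mdev2 : measurable_fun setT (fun o => ((G (N o) - c) ^+ 2)%:E).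
    by apply/measurable_EFinP; apply: measurable_funX; exact: measurable_funB.
  rewrite gap_sum// /S -ge0_integralZl_EFin ?sqr_ge0//; last first.
    by move=> o _; rewrite lee_fin sqr_ge0.
  apply: ae_ge0_le_integral => //.
  - by move=> o _; apply: integral_ge0 => t _; rewrite lee_fin.
  - exact: measurable_total.
  - by move=> o _; rewrite mule_ge0// lee_fin sqr_ge0.
  - by apply: emeasurable_funM => //; exact: measurable_cst.
  apply: filterS ae_good => o go _.
  set s := fun t => arrival tau (npoints (N o) t) o.
  have sP t : 0 <= t <= T -> 0 <= s t <= t by move=> /andP[t0 _]; exact: (arrival_le_time T0 go).
  have gE t : `[0%R, T]%classic t ->
      gap_dispersion f ((t : RR, Z (npoints (N o) t) o) : C) = dispersion T f (s t) t.
    rewrite /= in_itv/= => tT; have /andP[s0 st] := sP _ tT; have /andP[_ tT'] := tT.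
    by rewrite /gap_dispersion/= chain_arrival s0 st tT'.
  have mKt := measurable_total_at (measurableT_comp mK measurable_fst) o.
  set J := (\int[mu]_(t in `[0%R, T]) (gap_dispersion f ((t : RR, Z (npoints (N o) t) o) : C) + e)%:E)%E.
  have -> : (\int[mu]_(t in `[0%R, T]) (deviation f G e ((t, Z (npoints (N o) t) o), N o))%:E =
      ((G (N o) - c) ^+ 2)%:E * J)%E.
    rewrite /J -ge0_integralZl_EFin ?sqr_ge0//; last by move=> t _; rewrite lee_fin.
    by apply: eq_integral => t _; rewrite -EFinM mulrC.
  rewrite [leRHS]muleC lee_wpmul2l ?lee_fin ?sqr_ge0//.
  apply: (@le_trans _ _ (gam + e * T)%:E); last by rewrite lee_fin.
  have JE : J = (\int[mu]_(t in `[0%R, T]) (gap_dispersion f ((t : RR, Z (npoints (N o) t) o) : C))%:E +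
      \int[mu]_(t in `[0%R, T]) e%:E)%E.
    have md : measurable_fun (`[0%R, T]%classic : set RR)
        (fun t : RR => (gap_dispersion f ((t : RR, Z (npoints (N o) t) o) : C))%:E).
      rewrite (_ : (fun t => _) = (fun t : RR =>
          (gap_dispersion f ((t : RR, Z (npoints (N o) t) o) : C) + e)%:E - e%:E)%E); last first.
        by apply/funext => t; rewrite -EFinB addrK.
      by apply: emeasurable_funB => //; exact: measurable_cst.
    transitivity (\int[mu]_(t in `[0%R, T])
        ((gap_dispersion f ((t : RR, Z (npoints (N o) t) o) : C))%:E + e%:E))%E.
      by apply: eq_integral => t _; rewrite -EFinD.
    apply: ge0_integralD; first exact: measurable_itv.
    - move=> t _; rewrite lee_fin; exact: (gap_dispersion_ge0 mf f0 fneg f1 tailT gap0 gapP).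
    - exact: md.
    - by move=> t _; rewrite lee_fin ltW.
    - exact: measurable_cst.
  rewrite JE EFinD; apply: leeD.
    rewrite -gamE; apply: le_trans (dispersion_gamma f0 ratio_fin mf fneg f1 tailT sP).
    rewrite le_eqVlt; apply/orP; left; apply/eqP.
    by apply: eq_integral => t; rewrite inE => tT; rewrite gE.
  have muT : (mu (`[0%R, T]%classic : set R) <= T%:E)%E.
    by rewrite lebesgue_measure_itv/= lte_fin; case: ifP => _; rewrite ?sube0// lee_fin.
  rewrite integral_cst// (EFinM e T); apply: lee_wpmul2l => //.
  by rewrite lee_fin ltW.
pose a := (2 * (1 - q))^-1; pose b := (2 * q)^-1.
have a0 : 0 <= a by rewrite invr_ge0 mulr_ge0// subr_ge0 ltW.
have b0 : 0 <= b by rewrite invr_ge0 mulr_ge0// ltW.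
have gap_ge0 n (Y : C * config T -> R) : (forall x, 0 <= Y x) -> (0 <= gap_integral N tau n Y)%E.
  by move=> Y0; apply: weighted_ge0 => // x; rewrite /gap_weight; case: ifP.
have main : (S <= (2^-1)%:E * S + (a%:E * D + b%:E * ((q ^+ 2)%:E * S)))%E.
  apply: (@le_trans _ _ ((2^-1)%:E * S + (a%:E * D + b%:E *
      \sum_(n <oo) gap_integral N tau n (deviation f G e)))%E); last first.
    by rewrite leeD2l// leeD2l// lee_wpmul2l ?lee_fin.
  rewrite -DE SE -!nneseriesZl; last 3 first.
  - by move=> n _; exact: gap_ge0.
  - by move=> n _; exact: gap_ge0.
  - by move=> n _; exact: jump_mass_ge0.
  rewrite -nneseriesD; last 2 first.
  - by move=> n _ _; rewrite mule_ge0// ?lee_fin//; exact: gap_ge0.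
  - by move=> n _ _; rewrite mule_ge0// ?lee_fin//; exact: gap_ge0.
  rewrite -nneseriesD; last 2 first.
  - by move=> n _ _; rewrite mule_ge0// ?lee_fin//; exact: jump_mass_ge0.
  - by move=> n _ _; rewrite adde_ge0// mule_ge0 ?lee_fin//; exact: gap_ge0.
  apply: lee_nneseries => [n _ _|n _]; first exact: jump_mass_ge0.
  exact: (jump_mass_le T0 mf f0 fneg f1 tailT gap0 gapP indep dens NE mG G0 GB q0 q1 e0 n).
have D0 : (0 <= D)%E.
  apply: integral_ge0 => o _; apply: integral_ge0 => t _; rewrite lee_fin.
  by apply: mulr_ge0; [exact: intensity_ge0|exact: sqr_ge0].
have p0 : 0 < (1 - q) ^- 2 by rewrite invr_gt0 exprn_gt0// subr_gt0.
have py : (((1 - q) ^- 2)%:E * +oo = +oo :> \bar R)%E by rewrite gt0_muley ?lte_fin.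
move: D S D0 S0 Sfin main {DE SE WE} => [r| |] // [v| |] // _ _ _; last first.
  by rewrite py leey.
rewrite -!EFinM -!EFinD !lee_fin /a /b => main.
have qn : q != 0 by rewrite gt_eqF.
have qn1 : 1 - q != 0 by rewrite gt_eqF// subr_gt0.
have E : 2^-1 * v + ((2 * (1 - q))^-1 * r + (2 * q)^-1 * (q ^+ 2 * v)) =
   v - (2^-1 * (1 - q)) * (v - (1 - q) ^- 2 * r) by field; rewrite qn qn1.
move: main; rewrite E lerBrDl gerDr => main.
have p2 : 0 < 2^-1 * (1 - q) by rewrite mulr_gt0// subr_gt0.
by rewrite -subr_le0 -(pmulr_rle0 _ p2).
Qed.

End variance_bounded.

(** * Truncation *)

Definition clip {R : realType} (n : nat) (x : R) : R := Num.max (- n%:R) (Num.min x n%:R).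

Section clip.
Context {R : realType}.
Implicit Types x y : R.

Lemma clip_ge n x : - n%:R <= clip n x. Proof. by rewrite le_max lexx. Qed.

Lemma clip_le n x : clip n x <= n%:R.
Proof. by rewrite ge_max ge_min lexx orbT andbT (le_trans _ (ler0n _ _))// oppr_le0. Qed.

Lemma clip_id n x : `|x| <= n%:R -> clip n x = x.
Proof. by rewrite ler_norml => /andP[nx xn]; rewrite /clip min_l// max_r. Qed.

Lemma clip_lipschitz n x y : `|clip n x - clip n y| <= `|x - y|.
Proof.
have n0 : 0 <= n%:R :> R by [].
move: n0; rewrite /clip; set m := n%:R => m0.
wlog xy : x y / x <= y.
  by move=> h; have [/h//|/ltW/h] := leP x y; rewrite distrC (distrC x).
have le : Num.max (- m) (Num.min x m) <= Num.max (- m) (Num.min y m).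
  by rewrite ge_max le_max lexx/= le_max ge_min; apply/orP; right; rewrite le_min ge_min xy/= ge_min lexx orbT.
rewrite ler0_norm ?subr_le0// ler0_norm ?subr_le0// !opprB.
have yx : 0 <= y - x by rewrite subr_ge0.
rewrite lerBlDr ge_max; apply/andP; split.
  by rewrite -[leLHS]add0r lerD// le_max lexx.
have [xm|mx] := leP x m.
  apply: (@le_trans _ _ y); first by rewrite ge_min lexx.
  by rewrite -lerBlDl opprB addrC subrK le_max lexx orbT.
apply: (@le_trans _ _ m); first by rewrite ge_min lexx orbT.
by rewrite -[leLHS]add0r lerD// le_max lexx orbT.
Qed.

Lemma clip_norm n x : `|clip n x| <= `|x|.
Proof.
have := clip_lipschitz n x 0; rewrite subr0 [clip n 0]clip_id ?normr0//.
by rewrite subr0.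
Qed.

Lemma measurable_clip n : measurable_fun setT (@clip R n).
Proof. by apply: measurable_maxr => //; exact: measurable_minr. Qed.

End clip.

Section truncation.
Context {R : realType} d (Omega : measurableType d) (P : probability Omega R).
Variables (X : Omega -> R) (K : \bar R).
Hypothesis mX : measurable_fun setT X.
Hypothesis X2 : (\int[P]_o (X o ^+ 2)%:E < +oo)%E.

Let mean n : R := fine (\int[P]_o (clip n (X o))%:E).

Let mXn n : measurable_fun setT (fun o => clip n (X o)).
Proof. exact: (measurableT_comp (measurable_clip n) mX). Qed.

Let bound_integrable : P.-integrable setT (fun o => (1 + X o ^+ 2)%:E).
Proof.
have m2 : measurable_fun setT (fun o => (1 + X o ^+ 2)%:E).
  by apply/measurable_EFinP; apply: measurable_funD => //; exact: measurable_funX.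
apply/integrableP; split => //.
have -> : (\int[P]_o `|(1 + X o ^+ 2)%:E| = \int[P]_o 1 + \int[P]_o (X o ^+ 2)%:E)%E.
  transitivity (\int[P]_o (1 + (X o ^+ 2)%:E))%E.
    by apply: eq_integral => o _; rewrite gee0_abs ?EFinD// lee_fin addr_ge0// sqr_ge0.
  apply: ge0_integralD; first exact: measurableT.
  - by move=> o _; exact: lee01.
  - exact: measurable_cst.
  - by move=> o _; rewrite lee_fin sqr_ge0.
  - by apply/measurable_EFinP; exact: measurable_funX.
rewrite integral_cst// mul1e; apply: lte_add_pinfty => //.
exact: le_lt_trans (probability_le1 _ _) (ltry _).
Qed.

Let sqr_dominates (x : R) : `|x| <= 1 + x ^+ 2.
Proof. by rewrite -(real_normK (num_real x)); nra. Qed.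

Let means : (fun n => (\int[P]_o (clip n (X o))%:E)%E) @ \oo --> (\int[P]_o (X o)%:E)%E /\
  P.-integrable setT (fun o => (X o)%:E).
Proof.
have [] := @dominated_convergence _ _ _ P setT measurableT
  (fun n o => (clip n (X o))%:E) (fun o => (X o)%:E) (fun o => (1 + X o ^+ 2)%:E).
- by move=> n; exact/measurable_EFinP.
- exact/measurable_EFinP.
- apply: aeW => o _; apply: cvg_EFin; first by near=> n.
  apply: cvg_near_cst; near=> n; rewrite /=; apply: clip_id.
  by near: n; exact: nbhs_infty_ger.
- exact: bound_integrable.
- apply: aeW => o n _; have := le_trans (clip_norm n (X o)) (sqr_dominates (X o)).
  by rewrite -lee_fin.
by move=> ? _ ?.
Unshelve. all: by end_near. Qed.

(** Fatou's lemma along the truncations. *)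
Lemma variance_clip :
  (forall n, \int[P]_o ((clip n (X o) - mean n) ^+ 2)%:E <= K)%E -> ('V_P[X] <= K)%E.
Proof.
move=> h; pose m : R := fine (\int[P]_o (X o)%:E).
have -> : 'V_P[X] = (\int[P]_o ((X o - m) ^+ 2)%:E)%E.
  rewrite /variance covariance.unlock expectation.unlock; apply: eq_integral => o _.
  by rewrite expr2.
have mcvg : mean n @[n --> \oo] --> m.
  apply: fine_cvg; rewrite fineK; first by case: means.
  by apply: integrable_fin_num => //; case: means.
have -> : (\int[P]_o ((X o - m) ^+ 2)%:E =
    \int[P]_o limn_einf (fun n => ((clip n (X o) - mean n) ^+ 2)%:E))%E.
  apply: eq_integral => o _; apply/esym; apply: (cvg_limn_einf_sup _).1.
  apply: cvg_EFin; first by near=> n.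
  rewrite expr2; under eq_fun do rewrite /= expr2.
  by apply: cvgM; apply: cvgB => //; apply: cvg_near_cst; near=> n; apply: clip_id;
    near: n; exact: nbhs_infty_ger.
apply: le_trans (fatou P measurableT _ _) _.
- by move=> n; apply/measurable_EFinP; apply: measurable_funX; exact: measurable_funB.
- by move=> n o _; rewrite lee_fin sqr_ge0.
rewrite limn_einf_lim; apply: lime_le; first exact: is_cvg_einfs.
near=> n; apply: le_trans (h n).
by apply: ereal_inf_lbound; exists n => //=.
Unshelve. all: by end_near. Qed.

End truncation.

(** * Densities on the half-line *)

Section half_line.
Context {R : realType} (T : R) (f : R -> R).
Local Notation mu := (@lebesgue_measure R).
Local Notation RR := (measurableTypeR R).

Hypothesis T0 : 0 <= T.
Hypothesis den : is_density f.

(** The values of a density at negative numbers are arbitrary; here they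
    vanish. *)
Definition half_line (x : R) : R := if 0 <= x then f x else 0.

Lemma half_lineE x : 0 <= x -> half_line x = f x.
Proof. by rewrite /half_line => ->. Qed.

Let half_line_patch : half_line = f \_ (`[0%R, +oo[%classic : set R).
Proof. by apply/funext => x; rewrite patchE mem_setE in_itv/= andbT. Qed.

Lemma measurable_half_line : measurable_fun setT half_line.
Proof.
have [mf _ _] := den; rewrite half_line_patch.
by apply/(measurable_restrictT _ _).1 => //; exact: measurable_itv.
Qed.

Lemma half_line_ge0 x : 0 <= half_line x.
Proof. by have [_ f0 _] := den; rewrite /half_line; case: ifP => // /f0. Qed.

Lemma half_line_neg x : x < 0 -> half_line x = 0.
Proof. by rewrite /half_line leNgt => ->. Qed.

Lemma integral_half_line (A : set R) :
  (\int[mu]_(u in A `&` `[0%R, +oo[) (f u)%:E = \int[mu]_(u in A) (half_line u)%:E)%E.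
Proof.
rewrite integral_mkcond [RHS]integral_mkcond; apply: eq_integral => x _.
rewrite !patchE in_setI mem_setE in_itv/= andbT /half_line.
by case: (x \in A) => //=; case: ifP.
Qed.

Lemma half_line_mass : (\int[mu]_x (half_line x)%:E = 1)%E.
Proof. by have [_ _ <-] := den; rewrite -integral_half_line setTI. Qed.

Lemma tail_half_line x : 0 <= x -> tail half_line x = tail f x.
Proof.
move=> x0; apply: eq_Rintegral => u; rewrite inE/= in_itv/= andbT => xu.
by rewrite half_lineE// (le_trans x0).
Qed.

Lemma continuous_half_line : {within `[0, +oo[, continuous f} ->
  {within `[0, +oo[, continuous half_line}.
Proof.
apply: subspace_eq_continuous => x; rewrite inE/= in_itv/= andbT => x0.
exact/esym/half_lineE.
Qed.

Lemma ratio_sup_half_line z : 0 <= z -> ratio_sup T half_line z = ratio_sup T f z.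
Proof.
move=> z0; congr ereal_sup; apply: eq_imagel => x /=; rewrite in_itv/= => /andP[zx _].
by rewrite !half_lineE// ?subr_ge0// (le_trans z0).
Qed.

Lemma gamma_half_line : gamma_const T half_line = gamma_const T f.
Proof.
apply: eq_integral => t; rewrite inE/= in_itv/= => /andP[t0 tT].
congr ereal_sup; apply: eq_imagel => z /=; rewrite in_itv/= => /andP[z0 zt].
have h : 0 <= T - t by rewrite subr_ge0.
by rewrite half_lineE// ratio_sup_half_line// !tail_half_line// addr_ge0.
Qed.

Lemma intensity_half_line t (w : config T) : 0 <= t <= T ->
  renewal_intensity half_line t w = renewal_intensity f t w.
Proof.
move=> tT; have [t0 t1] := andP tT; rewrite /renewal_intensity; case: ifPn => lt.
  have h1 := point_of_le w tT; have h2 := point_of_ge tT lt.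
  by rewrite !half_lineE// ?subr_ge0// (le_trans h1).
have E : npoints w T = npoints w t.
  by apply/eqP; rewrite eqn_leq leqNgt lt npoints_le.
have h1 : point_of w (npoints w T) <= t by rewrite E point_of_le.
by rewrite half_lineE ?subr_ge0// !tail_half_line// subr_ge0// (le_trans h1).
Qed.

(** The density is positive right after [T], where the survival function thus
    decreases. *)
Lemma tail_half_line_gt0 (C : \bar R) : {within `[0, +oo[, continuous f} ->
  (T%:E < C)%E -> (forall x : R, T < x -> (x%:E < C)%E -> 0 < f x) ->
  0 < tail half_line T.
Proof.
move=> cf TC fpos.
have mf := measurable_half_line; have f0 := half_line_ge0.
have f1 := half_line_mass.
rewrite lt_neqAle (tail_ge0 mf f0 f1) andbT; apply/eqP => tail0.
have [x Tx xC] : exists2 x, T < x & (x%:E < C)%E.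
  move: C TC {fpos} => [c| |] //; rewrite ?lte_fin => Tc.
    by exists ((T + c) / 2); rewrite ?lte_fin; lra.
  by exists (T + 1); rewrite ?ltry// ltrDl.
have x0 : 0 < x by exact: le_lt_trans T0 Tx.
have h1 := is_derive_tail mf f0 half_line_neg half_line_mass (continuous_half_line cf) x0.
have h2 : is_derive x 1 (tail half_line) 0.
  apply: near_eq_is_derive (is_derive_cst 0 x 1).
  near=> y; apply/esym/eqP; rewrite eq_le (tail_ge0 mf f0 f1) andbT tail0.
  apply: (tail_nincr mf f0 f1); near: y.
  by apply: filterS (lt_nbhsr Tx) => y /ltW.
have : half_line x = 0.
  by apply/eqP; rewrite -oppr_eq0; apply/eqP; rewrite -(@derive_val _ _ _ _ _ _ _ h1) (@derive_val _ _ _ _ _ _ _ h2).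
by rewrite half_lineE ?ltW// => fx; have := fpos _ Tx xC; rewrite fx ltxx.
Unshelve. all: by end_near. Qed.

End half_line.

(** * The variance inequality in general *)

(** The right-hand side is continuous in [q], whether [D] is finite or not. *)
Lemma le_parameter_limit {R : realType} (r : R) (V D : \bar R) : 0 <= r -> r < 1 ->
  (0 <= V)%E -> (0 <= D)%E ->
  (forall q : R, r < q -> q < 1 -> (V <= ((1 - q) ^- 2)%:E * D)%E) ->
  (V <= ((1 - r) ^- 2)%:E * D)%E.
Proof.
move=> r0 r1 V0 D0 h.
have pos (x : R) : x < 1 -> 0 < (1 - x) ^- 2 by move=> x1; rewrite invr_gt0 exprn_gt0// subr_gt0.
have [Dy|Dfin] := eqVneq D +oo%E; first by rewrite Dy gt0_muley ?leey// lte_fin pos.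
have {Dfin} : D \is a fin_num by rewrite ge0_fin_numE// lt_neqAle Dfin leey.
move: D D0 h => [e| |] // D0 h _.
have [v vE] : exists v, V = v%:E.
  have q1 : r < (1 + r) / 2 by lra.
  have q2 : (1 + r) / 2 < 1 by lra.
  have := h _ q1 q2; rewrite -EFinM; move: V V0 {h} => [v| |] // _ _.
  by exists v.
rewrite vE lee_fin in V0 h *; rewrite -EFinM lee_fin mulrC ler_pdivlMr ?exprn_gt0 ?subr_gt0//.
apply/ler_addgt0Pr => eps eps0.
(* The square of [1 - q] loses at most [2 * dl] when [q] is [r + dl]. *)
pose dl := Num.min ((1 - r) / 2) (eps / (2 * v + 1)).
have v1 : 0 < 2 * v + 1 by rewrite ltr_wpDl// mulr_ge0.
have dl0 : 0 < dl by rewrite lt_min !divr_gt0// subr_gt0.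
have dl1 : dl <= (1 - r) / 2 by rewrite ge_min lexx.
have dl2 : dl * (2 * v + 1) <= eps by rewrite -ler_pdivlMr// ge_min lexx orbT.
have q1 : r < r + dl by rewrite ltrDl.
have q2 : r + dl < 1 by lra.
have := h _ q1 q2; rewrite -EFinM lee_fin mulrC ler_pdivlMr ?exprn_gt0 ?subr_gt0// => hq.
have E : v * (1 - r) ^+ 2 = v * (1 - (r + dl)) ^+ 2 + v * dl * (2 - 2 * r - dl) by ring.
rewrite E; apply: lerD => //; apply: le_trans dl2.
have : 0 <= v * dl by rewrite mulr_ge0// ltW.
by nra.
Qed.

Section poincare.
Context {R : realType} {T : R} (f : R -> R).
Local Notation mu := (@lebesgue_measure R).
Local Notation RR := (measurableTypeR R).
Local Notation pi := (renewal_intensity f).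

Hypothesis T0 : 0 <= T.
Hypothesis mf : measurable_fun setT f.
Hypothesis f0 : forall x, 0 <= f x.
Hypothesis fneg : forall x : R, x < 0 -> f x = 0.
Hypothesis f1 : (\int[mu]_x (f x)%:E = 1)%E.
Hypothesis tailT : 0 < tail f T.
Hypothesis cf : {within `[0, +oo[, continuous f}.
Hypothesis ratio_fin : forall z : R, 0 <= z <= T -> (ratio_sup T f z < +oo)%E.
Hypothesis gamma1 : (gamma_const T f < 1)%E.

Context d (Omega : measurableType d) (P : probability Omega R).
Variables (N : {RV P >-> config T}) (tau : nat -> {RV P >-> R}).
Hypothesis indep : mutually_independent tau.
Hypothesis dens : forall i A, measurable A ->
  distribution P (tau i) A = (\int[mu]_(u in A) (f u)%:E)%E.
Hypothesis NE : {ae P, forall o : Omega, forall A : set RR, measurable A ->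
  N o A = (\sum_(1 <= n <oo) \d_(arrival tau n o) (A `&` `[0%R, T]))%E}.

Variable G : config T -> R.
Hypothesis mG : measurable_fun setT G.
Hypothesis G2 : (\int[P]_o (G (N o) ^+ 2)%:E < +oo)%E.

Let mN : measurable_fun setT N. Proof. exact: measurable_funP. Qed.

Let measurable_gradient (H : config T -> R) : measurable_fun setT H ->
  measurable_fun setT (gradient f H : RR * (config T * R) * config T -> R).
Proof.
move=> mH.
have mx : measurable_fun setT (fun x : RR * (config T * R) * config T => (x.1.1, x.2)).
  apply: measurable_fun_pair; last exact: measurable_snd.
  exact: (measurableT_comp measurable_fst measurable_fst).
apply: measurable_funM; first exact: (measurableT_comp (measurable_intensity T0 mf f0 f1) mx).
apply: measurable_funX; apply: measurable_funB; last exact: (measurableT_comp mH measurable_snd).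
by apply: (measurableT_comp mH); exact: (measurableT_comp measurable_add_point mx).
Qed.

Let gradient_ge0 (H : config T -> R) x : 0 <= gradient f H x.
Proof. by apply: mulr_ge0; [exact: intensity_ge0|exact: sqr_ge0]. Qed.

Let energy (H : config T -> R) : \bar R := (\int[P]_o \int[mu]_(t in `[0%R, T])
  (pi t (N o) * (H (add_point t (N o)) - H (N o)) ^+ 2)%:E)%E.

Let energy_le (H H' : config T -> R) : measurable_fun setT H -> measurable_fun setT H' ->
  (forall w w', `|H w - H w'| <= `|H' w - H' w'|) -> (energy H <= energy H')%E.
Proof.
move=> mH mH' le.
have mE (H1 : config T -> R) (mH1 : measurable_fun setT H1) := measurable_total (Y := gradient f H1)
  N tau (measurable_gradient mH1) (@gradient_ge0 H1).
apply: ge0_le_integral => //.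
- by move=> o _; apply: integral_ge0 => t _; rewrite lee_fin; exact: (gradient_ge0 H ((t, (N o, 0)), N o)).
- exact: mE.
- exact: mE.
move=> o _; apply: ge0_le_integral; first exact: measurable_itv.
- by move=> t _; rewrite lee_fin; exact: (gradient_ge0 H ((t, (N o, 0)), N o)).
- exact: (measurable_total_at N tau (measurable_gradient mH) o).
- exact: (measurable_total_at N tau (measurable_gradient mH') o).
move=> t _; rewrite lee_fin ler_wpM2l ?intensity_ge0//.
by rewrite -(real_normK (num_real (H _ - _))) -[leRHS]real_normK ?num_real// lerXn2r ?nnegrE.
Qed.

(** The functional is cut off, which increases no gradient, and shifted to be
    nonnegative, which changes neither side. *)
Lemma variance_poincare :
  ('V_P[fun o => G (N o)] <= ((1 - Num.sqrt (fine (gamma_const T f))) ^- 2)%:E * energy G)%E.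
Proof.
apply: variance_clip; [exact: (measurableT_comp mG mN)|exact: G2|move=> n].
have gam0 : (0 <= gamma_const T f)%E.
  apply: le_trans (dispersion_gamma f0 ratio_fin mf fneg f1 tailT (s := fun=> 0) _).
    apply: integral_ge0 => t /=; rewrite in_itv/= => /andP[t0 tT]; rewrite lee_fin.
    exact: (dispersion_ge0 mf f0 fneg f1 tailT (ratio_bound_ge0 T f0) (ratio_boundP f0 ratio_fin)).
  by move=> t /andP[t0 _]; rewrite lexx.
pose g := fine (gamma_const T f).
have gE : gamma_const T f = g%:E.
  by rewrite fineK// ge0_fin_numE//; exact: lt_trans gamma1 (ltry _).
have g0 : 0 <= g by rewrite fine_ge0.
have g1 : g < 1 by rewrite -lte_fin -gE.
have r1 : Num.sqrt g < 1 by rewrite -sqrtr1 ltr_sqrt.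
pose H w := clip n (G w) + n%:R.
have mH : measurable_fun setT H.
  by apply: measurable_funD => //; exact: (measurableT_comp (measurable_clip n) mG).
have H0 w : 0 <= H w by rewrite /H -lerBlDr sub0r clip_ge.
have HB w : H w <= n%:R + n%:R by rewrite lerD2r clip_le.
apply: le_parameter_limit => //.
- by apply: integral_ge0 => o _; rewrite lee_fin sqr_ge0.
- by apply: integral_ge0 => o _; apply: integral_ge0 => t _; rewrite lee_fin;
    exact: (gradient_ge0 G ((t, (N o, 0)), N o)).
move=> q rq q1.
have q0 : 0 < q by exact: le_lt_trans (sqrtr_ge0 _) rq.
have gq : (gamma_const T f < (q ^+ 2)%:E)%E.
  by rewrite gE lte_fin -(sqr_sqrtr g0) ltrXn2r ?nnegrE// ltW.
have := variance_bounded T0 mf f0 fneg f1 tailT cf ratio_fin indep dens NE mH H0 HB q0 q1 gq.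
set c := cond_mean _ _ _ _ => main.
have cE : fine (\int[P]_o (clip n (G (N o)))%:E) = c - n%:R.
  have := mean_G T0 mf f0 fneg f1 indep dens NE mH H0 HB; rewrite -/c => HE.
  have mc : measurable_fun setT (fun o => (clip n (G (N o)))%:E).
    apply/measurable_EFinP; apply: (measurableT_comp (measurable_clip n)).
    exact: (measurableT_comp mG mN).
  have ic : P.-integrable setT (fun o => (clip n (G (N o)))%:E).
    apply: le_integrable (finite_measure_integrable_cst P n%:R measurableT) => // o _ /=.
    by rewrite lee_fin [leRHS]ger0_norm// ler_norml clip_ge clip_le.
  have : (\int[P]_o (clip n (G (N o)))%:E + n%:R%:E = c%:E)%E.
    rewrite -HE; transitivity (\int[P]_o (clip n (G (N o)))%:E + \int[P]_o n%:R%:E)%E.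
      rewrite integral_cst//; congr (_ + _)%E; rewrite -[LHS]mule1; congr (_ * _)%E.
      exact/esym/probability_setT.
    rewrite -integralD//; last exact: (finite_measure_integrable_cst P n%:R measurableT).
  have := integrable_fin_num measurableT ic.
  by move: (\int[P]_o _)%E => [x| |] //= _ [] <-; rewrite addrK.
rewrite cE; apply: (@le_trans _ _ (((1 - q) ^- 2)%:E * energy H)%E).
  apply: le_trans main; rewrite le_eqVlt; apply/orP; left; apply/eqP.
  by apply: eq_integral => o _; congr (_ ^+ 2)%:E; rewrite /H; ring.
rewrite lee_wpmul2l ?lee_fin ?invr_ge0 ?exprn_ge0 ?subr_ge0 ?(ltW q1)//.
apply: energy_le => // w w'; rewrite /H opprD addrACA subrr addr0.
exact: clip_lipschitz.
Qed.

End poincare.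

Unset Implicit Arguments.
Set Strict Implicit.
Set Printing Implicit Defensive.

Theorem corollary3p2 (R : realType) (d : measure_display)
  (Omega : measurableType d) (P : probability Omega R)
  (T : R) (hT : 0 <= T)
  (f : R -> R) (N : {RV P >-> config T})
  (hN : is_renewal_process f N)
  (hf : {within `[0, +oo[, continuous f})
  (a : R) (ha : 0 <= a <= T) (C : \bar R) (hC : (T%:E < C)%E)
  (hpos : forall x : R, a < x -> (x%:E < C)%E -> 0 < f x)
  (hh : forall z : R, 0 <= z <= T -> (ratio_sup T f z < +oo)%E)
  (hgamma : (gamma_const T f < 1)%E) :
  is_papangelou N (renewal_intensity f) /\
  forall G : {mfun config T >-> R},
    ('E_P[(fun o => G (N o) ^+ 2)%R] < +oo)%E ->
    ('V_P[(fun o => G (N o))]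
     <= ((1 - Num.sqrt (fine (gamma_const T f))) ^- 2)%:E
        * \int[P]_o \int[@lebesgue_measure R]_(t in `[0%R, T])
            (renewal_intensity f t (N o) * `|diff_operator t G (N o)| ^+ 2)%R%:E)%E.
Proof.
have [den [tau [indep hdens NE]]] := hN.
pose h := half_line f.
have mh : measurable_fun setT h := measurable_half_line den.
have h0 : forall x, 0 <= h x := half_line_ge0 den.
have hneg x : x < 0 -> h x = 0 by exact: half_line_neg.
have h1 : (\int[@lebesgue_measure R]_x (h x)%:E = 1)%E := half_line_mass den.
have ch : {within `[0, +oo[, continuous h} := continuous_half_line hf.
have tailT : 0 < tail h T.
  apply: (tail_half_line_gt0 hT den hf hC) => x Tx; apply: hpos.
  by apply: le_lt_trans Tx; case/andP: ha.
have ratio_fin (z : R) : 0 <= z <= T -> (ratio_sup T h z < +oo)%E.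
  by move=> zT; rewrite ratio_sup_half_line ?hh//; case/andP: zT.
have dens i A : measurable A ->
    distribution P (tau i) A = (\int[@lebesgue_measure R]_(u in A) (h u)%:E)%E.
  by move=> mA; rewrite -integral_half_line; exact: hdens.
have hvanish x z : 0 <= z -> z <= x -> x <= T -> h x = 0 -> h (x - z) = 0.
  move=> z0 zx xT hx; apply/eqP; rewrite eq_le h0 andbT.
  by have := ratio_boundP h0 ratio_fin z0 zx xT; rewrite hx mulr0.
have piE t (w : config T) : 0 <= t <= T -> renewal_intensity h t w = renewal_intensity f t w.
  exact: intensity_half_line.
have mpi := measurable_intensity hT mh h0 h1.
have mD : measurable (`[0, T]%classic `*` setT : set (measurableTypeR R * config T)).
  by apply: measurableX => //; exact: measurable_itv.
split; last first.
  move=> G G2.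
  have G2' : (\int[P]_o (G (N o) ^+ 2)%:E < +oo)%E by move: G2; rewrite expectation.unlock.
  have mG : measurable_fun setT G by exact: measurable_funP.
  have := variance_poincare hT mh h0 hneg h1 tailT ch ratio_fin _ indep dens NE mG G2'.
  rewrite gamma_half_line// => /(_ hgamma).
  congr (_ <= _ * _)%E; apply: eq_integral => o _; apply: eq_integral => t.
  rewrite inE/= in_itv/= => tT.
  by rewrite real_normK ?num_real// piE.
split.
- apply: (eq_measurable_fun (fun x : measurableTypeR R * config T => renewal_intensity h x.1 x.2)).
    by move=> [t w]; rewrite inE => -[/=]; rewrite in_itv/= => tT _; exact: piE.
  exact: measurable_funTS.
- move=> [t w] [/=]; rewrite in_itv/= => tT _; rewrite -piE//.
  exact: intensity_ge0.
move=> X mX X0.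
pose X' := X \_ (`[0, T]%classic `*` setT).
have mX' : measurable_fun setT X' by exact/(measurable_restrictT _ _).1.
have X'0 x : (0 <= X' x)%E by apply: erestrict_ge0.
have X'E (t : R) (w : config T) : 0 <= t <= T -> X' (t, w) = X (t, w).
  by move=> tT; rewrite /X' patchE mem_set//; split => //=; rewrite in_itv.
have := papangelou_intensity hT mh h0 hneg h1 tailT hvanish indep dens NE mX' X'0.
rewrite (_ : (\int[P]_o _)%E = \int[P]_o \int[N o]_(t in `[0%R, T]) X (t, del_point t (N o)))%E; last first.
  by apply: eq_integral => o _; apply: eq_integral => t; rewrite inE/= in_itv/= => tT; exact: X'E.
move=> ->; apply: eq_integral => o _; apply: eq_integral => t; rewrite inE/= in_itv/= => tT.
by rewrite X'E// piE.
Qed.
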